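(* Let $k\in\mathbb{Z}$, $N\in\mathbb{N}$, $\psi$ a Dirichlet character modulo $N$, and $f\in H_k(N,\psi)$ with Fourier expansion $f(z)=\sum_{n\ge-n_0'}a(n)e^{2\pi inz}+\sum_{n<0}b(n)\Gamma(1-k,-4\pi ny)e^{2\pi inz}$. Set $g=f|_kW_N$ and let $n_0\in\mathbb{N}$ be such that $f(z)$ and $g(z)$ are $O(e^{2\pi n_0y})$ as $y=\Im z\to\infty$. Suppose $\varphi$ is a non-zero piecewise smooth function such that, for some $\epsilon>0$, $\varphi(x)$ and $\varphi(x^{-1})$ are $o(e^{-2\pi(n_0+\epsilon)x})$ as $x\to\infty$, and that the series $$\sum_{n\ge-n_0}|a(n)|\big((\mathcal{L}|\varphi|^2)(2\pi n)\big)^{1/2}+\sum_{n<0}|b(n)||4\pi n|^{1-k}\int_0^\infty\frac{\big((\mathcal{L}|\varphi_{2-k}|^2)(-2\pi n(2t+1))\big)^{1/2}}{(1+t)^k}\,dt$$ converges. Then $L(s,f,\varphi):=L_f(\varphi_s)$ converges absolutely for $\Re(s)>\frac12$, has an analytic continuation to all $s\in\mathbb{C}$, and satisfies $$L(s,f,\varphi)=N^{-s-\frac k2+1}i^kL(1-s,g,\varphi|_{1-k}W_N).$$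
   Context: $\mathbb{H}$ is the upper half-plane, $z=x+iy$; $\Gamma(r,z)=\int_z^\infty e^{-t}t^{r-1}dt$. For $k\in\mathbb{Z}$ and $\gamma=\begin{pmatrix}a&b\\c&d\end{pmatrix}$, $(f|_k\gamma)(z)=(cz+d)^{-k}f(\gamma z)$; $W_N=\begin{pmatrix}0&-1/\sqrt N\\\sqrt N&0\end{pmatrix}$, so $(f|_kW_N)(z)=(\sqrt Nz)^{-k}f(-1/(Nz))$. $\Delta_k=-4y^2\partial_z\partial_{\bar z}+2iky\partial_{\bar z}$. $H_k(N,\psi)$: smooth $f\colon\mathbb{H}\to\mathbb{C}$ with $f|_k\gamma=\psi(d)f$ for $\gamma=\begin{pmatrix}*&*\\ *&d\end{pmatrix}\in\Gamma_0(N)$, $\Delta_kf=0$, and for every $\gamma=\begin{pmatrix}*&*\\c&d\end{pmatrix}\in\mathrm{SL}_2(\mathbb{Z})$ a polynomial $P\in\mathbb{C}[e^{-2\pi iz}]$ with $f(\gamma z)(cz+d)^{-k}-P(z)=O(e^{-\epsilon y})$ as $y\to\infty$ for some $\epsilon>0$. Laplace transform $(\mathcal{L}\varphi)(s)=\int_0^\infty e^{-st}\varphi(t)dt$; $\varphi_s(x)=\varphi(x)x^{s-1}$; $(\varphi|_aW_N)(x)=(Nx)^{-a}\varphi(1/(Nx))$. For a function $h(z)=\sum_{n\ge-n_0}a(n)e^{2\pi inz}+\sum_{n<0}b(n)\Gamma(1-k,-4\pi ny)e^{2\pi inz}$, $L_h(\varphi)=\sum_{n\ge-n_0}a(n)(\mathcal{L}\varphi)(2\pi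 n)+\sum_{n<0}b(n)(-4\pi n)^{1-k}\int_0^\infty\frac{(\mathcal{L}\varphi_{2-k})(-2\pi n(2t+1))}{(1+t)^k}dt$, defined on the set $\mathcal{F}_h$ of piecewise smooth $\varphi$ for which $\mathcal{L}\varphi(s)$ converges absolutely for $\Re s\ge-2\pi n_0$, $\mathcal{L}\varphi_{2-k}(s)$ converges absolutely for $\Re s>0$, and the same series with $a(n),b(n),\mathcal{L}\varphi,\mathcal{L}\varphi_{2-k}$ replaced by $|a(n)|,|b(n)|,\mathcal{L}|\varphi|,\mathcal{L}|\varphi_{2-k}|$ converges. $L(s,h,\phi)$ denotes $L_h(\phi_s)$ (and its analytic continuation). *)

(* Defs.v *)
(* The complex numbers are R[i] (real-closed) over a
   realType R.  Functions on the upper half-plane are total functions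
   R[i] -> R[i] of which only the values at points with positive imaginary part
   matter; test functions are total functions R -> R[i] of which only the values
   on ]0, +oo[ matter. *)
From HB Require Import structures.
From mathcomp Require Import all_boot all_order all_algebra.
From mathcomp Require Import all_classical all_reals all_analysis.
From mathcomp Require Import complex.

Set Implicit Arguments.
Unset Strict Implicit.
Unset Printing Implicit Defensive.

Import Order.TTheory GRing.Theory Num.Theory.
Import numFieldNormedType.Exports.

Local Open Scope classical_set_scope.
Local Open Scope complex_scope.
Local Open Scope ring_scope.

Definition cnorm (R : realType) (z : R[i]) : R := ComplexField.Normc.normc z.

Definition cexp (R : realType) (z : R[i]) : R[i] :=
  (expR (complex.Re z) * cos (complex.Im z)) +i*
  (expR (complex.Re z) * sin (complex.Im z)).

(* x^s for x > 0, principal branch *)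
Definition cpow (R : realType) (x : R) (s : R[i]) : R[i] :=
  cexp (s * (ln x)%:C).

Definition entire (R : realType) (F : R[i] -> R[i]) : Prop :=
  forall z : R[i], derivable (F : R[i]^o -> R[i]^o) z 1.

Definition cderivable (R : realType) (u : R -> R[i]) (x : R) : Prop :=
  derivable (fun t => complex.Re (u t)) x 1 /\
  derivable (fun t => complex.Im (u t)) x 1.

Definition cderive1 (R : realType) (u : R -> R[i]) (x : R) : R[i] :=
  derive1 (fun t => complex.Re (u t)) x +i* derive1 (fun t => complex.Im (u t)) x.

Definition cintegrable (R : realType) (D : set R) (u : R -> R[i]) : Prop :=
  lebesgue_measure.-integrable D (fun t => (complex.Re (u t))%:E) /\
  lebesgue_measure.-integrable D (fun t => (complex.Im (u t))%:E).

Definition cintegral (R : realType) (D : set R) (u : R -> R[i]) : R[i] :=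
  (\int[lebesgue_measure]_(t in D) complex.Re (u t)) +i*
  (\int[lebesgue_measure]_(t in D) complex.Im (u t)).

(* partial derivatives in x and y, where z = x + iy *)
Definition dx (R : realType) (f : R[i] -> R[i]) (z : R[i]) : R[i] :=
  cderive1 (fun t => f (z + t%:C)) 0.

Definition dy (R : realType) (f : R[i] -> R[i]) (z : R[i]) : R[i] :=
  cderive1 (fun t => f (z + t *i)) 0.

Definition iter_partial (R : realType) (w : seq bool) (f : R[i] -> R[i]) :=
  foldr (fun (d : bool) h => if d then dx h else dy h) f w.

(* partial derivatives of all orders exist and are continuous on the upper
   half-plane *)
Definition smooth_upper_half (R : realType) (f : R[i] -> R[i]) : Prop :=
  forall (w : seq bool) (z : R[i]), 0 < complex.Im z ->
    [/\ cderivable (fun t => iter_partial w f (z + t%:C)) 0,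
        cderivable (fun t => iter_partial w f (z + t *i)) 0 &
        {for (z : R[i]^o), continuous (iter_partial w f : R[i]^o -> R[i]^o)}].

Definition d_z (R : realType) (f : R[i] -> R[i]) (z : R[i]) : R[i] :=
  (dx f z - 'i%C * dy f z) / 2.

Definition d_zbar (R : realType) (f : R[i] -> R[i]) (z : R[i]) : R[i] :=
  (dx f z + 'i%C * dy f z) / 2.

Definition laplacian (R : realType) (k : int) (f : R[i] -> R[i]) (z : R[i])
    : R[i] :=
  - 4 * (complex.Im z)%:C ^+ 2 * d_z (d_zbar f) z
  + 2 * 'i%C * k%:~R * (complex.Im z)%:C * d_zbar f z.

Definition slash (R : realType) (k : int) (g : 'M[R]_2) (f : R[i] -> R[i])
    (z : R[i]) : R[i] :=
  let j := (g 1 0)%:C * z + (g 1 1)%:C in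
  j ^ (- k) * f (((g 0 0)%:C * z + (g 0 1)%:C) / j).

Definition mxR (R : realType) (g : 'M[int]_2) : 'M[R]_2 := map_mx intr g.

Definition W_mx (R : realType) (N : nat) : 'M[R]_2 :=
  \matrix_(i < 2, j < 2)
    if i == j then 0
    else if i == 0 then - (Num.sqrt N%:R)^-1 else Num.sqrt N%:R.

Definition SL2Z (g : 'M[int]_2) : Prop := \det g = 1.

Definition Gamma0 (N : nat) (g : 'M[int]_2) : Prop :=
  SL2Z g /\ (N%:Z %| g 1%R 0%R)%Z.

Definition dirichlet_character (R : realType) (N : nat) (psi : int -> R[i])
    : Prop :=
  [/\ forall m n : int, psi (m * n) = psi m * psi n,
      forall m : int, psi (m + N%:Z) = psi m &
      forall m : int, psi m != 0 <-> coprimez m N%:Z].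

(* h(z) = O(e^{c y}) as y = Im z -> oo, uniformly in Re z *)
Definition exp_bigO (R : realType) (c : R) (h : R[i] -> R[i]) : Prop :=
  exists M Y : R, forall z : R[i], Y < complex.Im z ->
    cnorm (h z) <= M * expR (c * complex.Im z).

Definition harmonic_form (R : realType) (k : int) (N : nat)
    (psi : int -> R[i]) (f : R[i] -> R[i]) : Prop :=
  [/\ smooth_upper_half f,
      forall g : 'M[int]_2, Gamma0 N g -> forall z : R[i], 0 < complex.Im z ->
        slash k (mxR R g) f z = psi (g 1 1) * f z,
      forall z : R[i], 0 < complex.Im z -> laplacian k f z = 0 &
      forall g : 'M[int]_2, SL2Z g ->
        exists (P : {poly R[i]}) (eps : R), 0 < eps /\
          exp_bigO (- eps) (fun z =>
            slash k (mxR R g) f z - P.[cexp (- 2 * pi%:C * 'i%C * z)])].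

(* Gamma(r, x) for integral r and real x > 0 *)
Definition inc_gamma (R : realType) (r : int) (x : R) : R :=
  \int[lebesgue_measure]_(t in `[x, +oo[) (expR (- t) * t ^ (r - 1)).

(* The sums over n >= -n0 and over n < 0 are re-indexed by j : nat through
   n = j - n0 and n = -(j + 1) respectively. *)
Definition idx_ge (n0 j : nat) : int := j%:Z - n0%:Z.
Definition idx_neg (j : nat) : int := - (j.+1)%:Z.

Definition exp_term (R : realType) (n : int) (z : R[i]) : R[i] :=
  cexp (2 * pi%:C * 'i%C * n%:~R * z).

(* The coefficients a(n) that do not occur in the expansion are set to 0, so
   that the starting index can be changed freely. *)
Definition fourier_expansion (R : realType) (k : int) (n0 : nat)
    (a b : int -> R[i]) (h : R[i] -> R[i]) : Prop :=
  (forall n : int, n < - n0%:Z -> a n = 0) /\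
  forall z : R[i], 0 < complex.Im z -> exists A B : R[i]^o,
    [/\ series (fun j => a (idx_ge n0 j) * exp_term (idx_ge n0 j) z : R[i]^o)
          @ \oo --> A,
        series (fun j => b (idx_neg j) *
            (inc_gamma (1 - k) (- 4 * pi * (idx_neg j)%:~R * complex.Im z))%:C *
            exp_term (idx_neg j) z : R[i]^o)
          @ \oo --> B &
        h z = A + B].

Definition smooth_on (R : realType) (U : set R) (u : R -> R[i]) : Prop :=
  forall (n : nat) (x : R), U x -> cderivable (iter n (@cderive1 R) u) x.

(* Every [a, b] with 0 < a < b has a finite subdivision such that on each open
   piece phi agrees with a function that is smooth on a neighbourhood of the
   closed piece. *)
Definition piecewise_smooth (R : realType) (phi : R -> R[i]) : Prop :=
  forall a b : R, 0 < a -> a < b ->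
  exists (m : nat) (t : nat -> R), [/\ t 0%N = a, t m = b &
    forall i : nat, (i < m)%N -> t i < t i.+1 /\
      exists (u : R -> R[i]) (U : set R),
        [/\ open U, `[t i, t i.+1] `<=` U, smooth_on U u &
            forall x : R, x \in `]t i, t i.+1[ -> phi x = u x]].

Definition laplace (R : realType) (phi : R -> R[i]) (s : R[i]) : R[i] :=
  cintegral `]0, +oo[ (fun t => cexp (- s * t%:C) * phi t).

Definition laplace_cvg (R : realType) (phi : R -> R[i]) (s : R[i]) : Prop :=
  cintegrable `]0, +oo[ (fun t => cexp (- s * t%:C) * phi t).

(* Laplace transform at a real point of a nonnegative function, with values in
   [0, +oo] *)
Definition laplace_nng (R : realType) (u : R -> R) (s : R) : \bar R :=
  (\int[lebesgue_measure]_(t in `]0%R, +oo[) (expR (- s * t) * u t)%:E)%E.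

(* phi_s(x) = phi(x) x^(s-1) *)
Definition twist (R : realType) (phi : R -> R[i]) (s : R[i]) (x : R) : R[i] :=
  phi x * cpow x (s - 1).

(* (phi |_a W_N)(x) = (N x)^(-a) phi(1/(N x)) *)
Definition slashW (R : realType) (a : int) (N : nat) (phi : R -> R[i]) (x : R)
    : R[i] :=
  ((N%:R * x) ^ (- a))%:C * phi (N%:R * x)^-1.

(* L_h(phi), where a and b are the coefficients of h *)
Definition Lmap (R : realType) (k : int) (n0 : nat) (a b : int -> R[i])
    (phi : R -> R[i]) : R[i] :=
  limn (series (fun j =>
    a (idx_ge n0 j) * laplace phi (2 * pi * (idx_ge n0 j)%:~R)%:C
      : R[i]^o)) +
  limn (series (fun j =>
    b (idx_neg j) * ((- 4 * pi * (idx_neg j)%:~R) ^ (1 - k))%:C *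
    cintegral `]0, +oo[ (fun t =>
      laplace (twist phi (2 - k)%:~R)
        (- 2 * pi * (idx_neg j)%:~R * (2 * t + 1))%:C / ((1 + t) ^ k)%:C)
      : R[i]^o)).

Definition Lmap_abs (R : realType) (k : int) (n0 : nat) (a b : int -> R[i])
    (phi : R -> R[i]) : \bar R :=
  ((\sum_(0 <= j <oo)
      (cnorm (a (idx_ge n0 j)))%:E *
      laplace_nng (fun x => cnorm (phi x)) (2 * pi * (idx_ge n0 j)%:~R)%R) +
   (\sum_(0 <= j <oo)
      (cnorm (b (idx_neg j)) * (- 4 * pi * (idx_neg j)%:~R) ^ (1 - k))%:E *
      \int[lebesgue_measure]_(t in `]0%R, +oo[)
        (laplace_nng (fun x => cnorm (twist phi (2 - k)%:~R x))
           (- 2 * pi * (idx_neg j)%:~R * (2 * t + 1))%R *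
         ((1 + t) ^ k)^-1%:E)))%E.

(* the set F_h *)
Definition test_fun (R : realType) (k : int) (n0 : nat) (a b : int -> R[i])
    (phi : R -> R[i]) : Prop :=
  [/\ piecewise_smooth phi,
      forall s : R[i], - 2 * pi * n0%:R <= complex.Re s -> laplace_cvg phi s,
      forall s : R[i], 0 < complex.Re s ->
        laplace_cvg (twist phi (2 - k)%:~R) s &
      (Lmap_abs k n0 a b phi < +oo)%E].

Definition Lsq_abs (R : realType) (k : int) (n0 : nat) (a b : int -> R[i])
    (phi : R -> R[i]) : \bar R :=
  ((\sum_(0 <= j <oo)
      (cnorm (a (idx_ge n0 j)))%:E *
      poweR (laplace_nng (fun x => cnorm (phi x) ^+ 2)%R
               (2 * pi * (idx_ge n0 j)%:~R)%R) 2^-1) +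
   (\sum_(0 <= j <oo)
      (cnorm (b (idx_neg j)) * `|4 * pi * (idx_neg j)%:~R| ^ (1 - k))%:E *
      \int[lebesgue_measure]_(t in `]0%R, +oo[)
        (poweR (laplace_nng (fun x => cnorm (twist phi (2 - k)%:~R x) ^+ 2)%R
                  (- 2 * pi * (idx_neg j)%:~R * (2 * t + 1))%R) 2^-1 *
         ((1 + t) ^ k)^-1%:E)))%E.

(* L(s, h, phi) as an entire function: Lam is entire and equals L_h(phi_s) at
   every s for which phi_s lies in F_h. *)
Definition continues_L (R : realType) (k : int) (n0 : nat)
    (a b : int -> R[i]) (phi : R -> R[i]) (Lam : R[i] -> R[i]) : Prop :=
  entire Lam /\
  forall s : R[i], test_fun k n0 a b (twist phi s) ->
    Lam s = Lmap k n0 a b (twist phi s).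

(* phi(x) = o(e^{-c x}) as x -> +oo *)
Definition exp_littleo (R : realType) (c : R) (phi : R -> R[i]) : Prop :=
  cnorm (phi x) / expR (- c * x) @[x --> +oo] --> (0 : R).

(* Main.v *)
(* For L_h(phi), Fubini's theorem for the incomplete gamma terms and dominated
   convergence for the Fourier series give
     L_h(phi) = int_0^oo h(iy) phi(y) dy
   as soon as phi lies in F_h.  Hence L(s, f, phi) continues to
     int_0^oo f(iy) phi(y) y^(s-1) dy,
   which is entire: f(iy) is O(exp(2 pi n0 y)) at infinity and, by the growth of
   f|W_N, O(y^(-k) exp(2 pi n0 / (N y))) at 0, both beaten by phi.  The
   substitution y -> 1/(N y) turns f(iy) into f|W_N and yields the functional
   equation.  Absolute convergence for Re s > 1/2 is Cauchy-Schwarz. *)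
Require Import Defs.
From HB Require Import structures.
From mathcomp Require Import all_boot all_order all_algebra.
From mathcomp Require Import all_classical all_reals all_analysis.
From mathcomp Require Import complex.
From mathcomp Require Import measurable_realfun ring lra.
Import Order.TTheory GRing.Theory Num.Theory.
Import numFieldNormedType.Exports.
Local Open Scope classical_set_scope.
Local Open Scope complex_scope.
Local Open Scope ring_scope.

Local Notation mu := lebesgue_measure.
Local Notation Rpos R := (`](0 : R), +oo[%classic).

(** * Complex numbers *)

Lemma norm_cnormE {R : realType} (z : R[i]) : `|z| = (cnorm z)%:C.
Proof. by []. Qed.

Lemma cnorm_ge0 {R : realType} (z : R[i]) : 0 <= cnorm z.
Proof. by case: z => x y; exact: sqrtr_ge0. Qed.

Lemma cnormM {R : realType} (z w : R[i]) : cnorm (z * w) = cnorm z * cnorm w.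
Proof. exact: ComplexField.Normc.normcM. Qed.

Lemma cnormV {R : realType} (z : R[i]) : cnorm z^-1 = (cnorm z)^-1.
Proof. exact: ComplexField.Normc.normcV. Qed.

Lemma cnormN {R : realType} (z : R[i]) : cnorm (- z) = cnorm z.
Proof. by case: z => x y; rewrite /cnorm /= !sqrrN. Qed.

Lemma cnormR {R : realType} (x : R) : cnorm x%:C = `|x|.
Proof. by rewrite /cnorm /= expr0n /= addr0 sqrtr_sqr. Qed.

Lemma cnorm0 {R : realType} : cnorm (0 : R[i]) = 0.
Proof. by rewrite -[0]/(0%:C) cnormR normr0. Qed.

Lemma cnormD {R : realType} (z w : R[i]) : cnorm (z + w) <= cnorm z + cnorm w.
Proof. by have := ler_normD z w; rewrite !norm_cnormE -rmorphD lecR. Qed.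

Lemma cnorm_eq0 {R : realType} (z : R[i]) : (cnorm z == 0) = (z == 0).
Proof.
apply/eqP/eqP => [/ComplexField.Normc.eq0_normc//|->]; exact: cnorm0.
Qed.

Lemma cnormX {R : realType} (z : R[i]) n : cnorm (z ^+ n) = cnorm z ^+ n.
Proof.
elim: n => [|n IHn]; last by rewrite !exprS cnormM IHn.
by rewrite !expr0 -[1]/(1%:C) cnormR normr1.
Qed.

Lemma cnormXz {R : realType} (z : R[i]) (n : int) : cnorm (z ^ n) = cnorm z ^ n.
Proof. by case: n => n; rewrite ?NegzE -?exprnN -?exprnP ?cnormV cnormX. Qed.

Lemma Re_le_cnorm {R : realType} (z : R[i]) : `|complex.Re z| <= cnorm z.
Proof.
case: z => x y; rewrite /cnorm /= -sqrtr_sqr ler_sqrt ?sqr_ge0//.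
  by rewrite lerDl sqr_ge0.
by rewrite addr_ge0// sqr_ge0.
Qed.

Lemma Im_le_cnorm {R : realType} (z : R[i]) : `|complex.Im z| <= cnorm z.
Proof.
case: z => x y; rewrite /cnorm /= -sqrtr_sqr ler_sqrt ?sqr_ge0//.
  by rewrite lerDr sqr_ge0.
by rewrite addr_ge0// sqr_ge0.
Qed.

Lemma cnorm_le {R : realType} (z : R[i]) :
  cnorm z <= `|complex.Re z| + `|complex.Im z|.
Proof.
have -> : z = (complex.Re z)%:C + 'i%C * (complex.Im z)%:C by exact: complexE.
apply: le_trans (cnormD _ _) _; rewrite cnormM !cnormR.
have -> : cnorm ('i%C : R[i]) = 1.
  by rewrite /cnorm /= expr0n /= add0r expr1n sqrtr1.
by case: z => x y; rewrite mul1r /= !(mul0r, mulr0, mul1r, addr0, add0r, subr0).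
Qed.

Lemma cReD {R : realType} (z w : R[i]) :
  complex.Re (z + w) = complex.Re z + complex.Re w.
Proof. by case: z w => a b [c d]. Qed.

Lemma cImD {R : realType} (z w : R[i]) :
  complex.Im (z + w) = complex.Im z + complex.Im w.
Proof. by case: z w => a b [c d]. Qed.

Lemma cReM {R : realType} (z w : R[i]) :
  complex.Re (z * w) =
  complex.Re z * complex.Re w - complex.Im z * complex.Im w.
Proof. by case: z w => a b [c d]. Qed.

Lemma cImM {R : realType} (z w : R[i]) :
  complex.Im (z * w) =
  complex.Re z * complex.Im w + complex.Im z * complex.Re w.
Proof. by case: z w => a b [c d] /=; rewrite addrC. Qed.

Lemma cReN {R : realType} (z : R[i]) : complex.Re (- z) = - complex.Re z.
Proof. by case: z. Qed.

Lemma cImN {R : realType} (z : R[i]) : complex.Im (- z) = - complex.Im z.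
Proof. by case: z. Qed.

Lemma Re_sum {R : realType} (I : Type) (r : seq I) (F : I -> R[i]) :
  complex.Re (\sum_(i <- r) F i) = \sum_(i <- r) complex.Re (F i).
Proof. exact: (big_morph _ cReD). Qed.

Lemma Im_sum {R : realType} (I : Type) (r : seq I) (F : I -> R[i]) :
  complex.Im (\sum_(i <- r) F i) = \sum_(i <- r) complex.Im (F i).
Proof. exact: (big_morph _ cImD). Qed.

Lemma cpx_eqP {R : realType} (z w : R[i]) :
  complex.Re z = complex.Re w -> complex.Im z = complex.Im w -> z = w.
Proof. by case: z w => a b [c d] /= -> ->. Qed.

Lemma mulCC {R : realType} (c : R) (z : R[i]) :
  c%:C * z = (c * complex.Re z) +i* (c * complex.Im z).
Proof. by case: z => a b; apply: cpx_eqP; rewrite ?cReM ?cImM /= ?mul0r ?subr0 ?addr0. Qed.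

Lemma Re_mulC {R : realType} (c : R) (z : R[i]) :
  complex.Re (c%:C * z) = c * complex.Re z.
Proof. by rewrite mulCC. Qed.

Lemma Im_mulC {R : realType} (c : R) (z : R[i]) :
  complex.Im (c%:C * z) = c * complex.Im z.
Proof. by rewrite mulCC. Qed.

Lemma intC {R : realType} (n : int) : (n%:~R : R[i]) = (n%:~R : R)%:C.
Proof. by rewrite rmorph_int. Qed.

Lemma natC {R : realType} (n : nat) : (n%:R : R[i]) = (n%:R : R)%:C.
Proof. by rewrite rmorph_nat. Qed.

Lemma cexpD {R : realType} (z w : R[i]) : cexp (z + w) = cexp z * cexp w.
Proof.
apply: cpx_eqP; rewrite ?cReM ?cImM /cexp /= cReD cImD expRD ?cosD ?sinD; ring.
Qed.

Lemma cexpR {R : realType} (x : R) : cexp x%:C = (expR x)%:C.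
Proof. by rewrite /cexp /= cos0 sin0 mulr1 mulr0. Qed.

Lemma cexp0 {R : realType} : cexp (0 : R[i]) = 1.
Proof. by rewrite -[0]/(0%:C) cexpR expR0. Qed.

Lemma cnorm_cexp {R : realType} (z : R[i]) : cnorm (cexp z) = expR (complex.Re z).
Proof.
rewrite /cexp /cnorm /= !exprMn -mulrDr cos2Dsin2 mulr1 sqrtr_sqr.
by rewrite ger0_norm// expR_ge0.
Qed.

Lemma cnorm_cpow {R : realType} (x : R) (s : R[i]) :
  cnorm (cpow x s) = expR (complex.Re s * ln x).
Proof. by rewrite /cpow cnorm_cexp cReM /= mulr0 subr0. Qed.

Lemma cpowD {R : realType} (x : R) (s t : R[i]) :
  cpow x (s + t) = cpow x s * cpow x t.
Proof. by rewrite /cpow mulrDl cexpD. Qed.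

Lemma exprz_expR_ln {R : realType} (x : R) (n : int) : 0 < x ->
  x ^ n = expR (n%:~R * ln x).
Proof.
move=> x0; case: n => n.
  by rewrite -pmulrn -exprnP expRM_natl lnK.
by rewrite NegzE mulrNz -pmulrn mulNr expRN expRM_natl lnK.
Qed.

Lemma cpow_int {R : realType} (x : R) (n : int) : 0 < x ->
  cpow x n%:~R = (x ^ n)%:C.
Proof.
by move=> x0; rewrite /cpow intC -rmorphM cexpR -exprz_expR_ln.
Qed.

Lemma cpowM {R : realType} (x y : R) (s : R[i]) : 0 < x -> 0 < y ->
  cpow (x * y) s = cpow x s * cpow y s.
Proof.
by move=> x0 y0; rewrite /cpow lnM ?posrE// rmorphD mulrDr cexpD.
Qed.

Lemma cpowV {R : realType} (x : R) (s : R[i]) : 0 < x ->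
  cpow x^-1 s = cpow x (- s).
Proof. by move=> x0; rewrite /cpow lnV ?posrE// rmorphN mulrN mulNr. Qed.

Lemma cvg_cnormP {R : realType} (T : Type) (F : set_system T) {FF : Filter F}
    (u : T -> R[i]) (l : R[i]) :
  ((u : T -> R[i]^o) @ F --> (l : R[i]^o)) <->
  (cnorm (u x - l) @[x --> F] --> (0 : R)).
Proof.
split=> [/cvgrPdist_lt H|/cvgrPdist_lt H].
  apply/cvgrPdist_lt => e e0; have /H : (0 : R[i]) < e%:C by rewrite ltcR.
  apply: filterS => x; rewrite norm_cnormE ltcR sub0r normrN ger0_norm ?cnorm_ge0//.
  by rewrite -cnormN opprB.
apply/cvgrPdist_lt => e; case: e => e e' /[!ltcE]/= /andP[/eqP -> /H].
apply: filterS => x; rewrite norm_cnormE sub0r normrN ger0_norm ?cnorm_ge0// ltcE/= eqxx/=.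
by rewrite -cnormN opprB.
Qed.

Lemma cvg_Re {R : realType} (T : Type) (F : set_system T) {FF : Filter F}
    (u : T -> R[i]) (l : R[i]) :
  ((u : T -> R[i]^o) @ F --> (l : R[i]^o)) ->
  complex.Re (u x) @[x --> F] --> complex.Re l.
Proof.
move=> /cvg_cnormP/cvgrPdist_lt H; apply/cvgrPdist_lt => e /H; apply: filterS => x.
rewrite sub0r normrN (ger0_norm (cnorm_ge0 _)); apply: le_lt_trans.
by rewrite -[leRHS]cnormN opprB -cReN -cReD Re_le_cnorm.
Qed.

Lemma cvg_Im {R : realType} (T : Type) (F : set_system T) {FF : Filter F}
    (u : T -> R[i]) (l : R[i]) :
  ((u : T -> R[i]^o) @ F --> (l : R[i]^o)) ->
  complex.Im (u x) @[x --> F] --> complex.Im l.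
Proof.
move=> /cvg_cnormP/cvgrPdist_lt H; apply/cvgrPdist_lt => e /H; apply: filterS => x.
rewrite sub0r normrN (ger0_norm (cnorm_ge0 _)); apply: le_lt_trans.
by rewrite -[leRHS]cnormN opprB -cImN -cImD Im_le_cnorm.
Qed.

Lemma cvg_complex {R : realType} (T : Type) (F : set_system T) {FF : Filter F}
    (u : T -> R[i]) (l : R[i]) :
  complex.Re (u x) @[x --> F] --> complex.Re l ->
  complex.Im (u x) @[x --> F] --> complex.Im l ->
  ((u : T -> R[i]^o) @ F --> (l : R[i]^o)).
Proof.
move=> uRe uIm; apply/cvg_cnormP.
apply: (@squeeze_cvgr _ _ _ _ (fun=> 0)
  (fun x => `|complex.Re (u x) - complex.Re l| + `|complex.Im (u x) - complex.Im l|)).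
- apply: nearW => x; rewrite cnorm_ge0/=.
  by apply: le_trans (cnorm_le _) _; rewrite cReD cReN cImD cImN.
- exact: cvg_cst.
- have h (v : T -> R) (m : R) : v x @[x --> F] --> m ->
    `|v x - m| @[x --> F] --> (0 : R).
    move=> vm; rewrite -(normr0 R) -(subrr m).
    by apply: cvg_norm; apply: cvgB => //; exact: cvg_cst.
  by rewrite -[X in _ --> X]addr0; apply: cvgD; exact: h.
Qed.

(** * Substitution in Lebesgue integrals *)

Lemma lebesgue_measure_affine {R : realType} (c : {posnum R}) (a : R)
    (A : set R) : measurable A ->
  (mu A = c%:num%:E * mu [set x | A (c%:num * x + a)%R])%E.
Proof.
move=> mA.
have mf : measurable_fun [set: R] (fun x : R => c%:num * x + a : measurableTypeR R).
  by apply: measurable_funD => //; apply: measurable_funM.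
apply: (@lebesgue_measure_unique _
  (mscale (c%:num)%:nng (pushforward mu (fun x : R => c%:num * x + a : measurableTypeR R)))) => //.
move=> X /ocitvP[->|[[u v]/= uv ->]]; first by rewrite !measure0.
rewrite /mscale /pushforward/=.
rewrite [X in (_ * mu X)%E](_ : _ =
   `](u - a) / c%:num, (v - a) / c%:num]%classic); last first.
  apply/seteqP; split => x /=; rewrite !in_itv/=.
    by rewrite ltr_pdivrMr// ler_pdivlMr// ltrBlDr lerBrDr mulrC.
  by rewrite ltr_pdivrMr// ler_pdivlMr// ltrBlDr lerBrDr mulrC.
rewrite !lebesgue_measure_itv/= !lte_fin uv ltr_pM2r ?invr_gt0// ltrD2r uv.
rewrite -!EFinB -EFinM; congr EFin.
by rewrite -mulrBl mulrC mulfVK//; lra.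
Qed.

Lemma ge0_integral_affine {R : realType} (c a : R) (F : R -> \bar R) : 0 < c ->
  measurable_fun setT F -> (forall x, 0 <= F x)%E ->
  (\int[mu]_x F x = c%:E * \int[mu]_x F (c * x + a)%R)%E.
Proof.
move=> c0 mF F0.
have mf : measurable_fun [set: R] (fun x : R => c * x + a : measurableTypeR R).
  by apply: measurable_funD => //; apply: measurable_funM.
rewrite [X in (_ * X)%E](_ : _ = \int[pushforward mu
    (fun x : R => (c * x + a)%R : measurableTypeR R)]_x F x)%E; last first.
  by rewrite ge0_integral_pushforward.
rewrite -(@ge0_integral_mscale _ _ _ _ _ measurableT (PosNum c0)%:num%:nng)//.
apply: eq_measure_integral => A mA _.
rewrite /mscale /pushforward/=; exact: (lebesgue_measure_affine (PosNum c0)).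
Qed.

Definition haar_weight {R : realType} (x : R) : R :=
  (if 0 < x then x `^ (-1) else 0)%R.

Lemma measurable_haar_weight {R : realType} :
  measurable_fun setT (@haar_weight R).
Proof.
by apply: measurable_fun_ifT => //; exact: measurable_fun_ltr.
Qed.

Lemma haar_weight_ge0 {R : realType} (x : R) : 0 <= haar_weight x.
Proof. by rewrite /haar_weight; case: ifP => // _; exact: powR_ge0. Qed.

Lemma haar_weightE {R : realType} (x : R) : 0 < x -> haar_weight x = x^-1.
Proof. by move=> x0; rewrite /haar_weight x0 powR_inv1// ltW. Qed.

Lemma haar_scale {R : realType} (c : R) (G : R -> \bar R) : 0 < c ->
  measurable_fun setT G -> (forall x, 0 <= G x)%E ->
  (\int[mu]_x ((haar_weight x)%:E * G (c * x)%R) =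
   \int[mu]_x ((haar_weight x)%:E * G x))%E.
Proof.
move=> c0 mG G0; have mw := @measurable_haar_weight R.
rewrite [RHS](@ge0_integral_affine _ c 0)//; last 2 first.
- by apply: emeasurable_funM => //; exact/measurable_EFinP.
- by move=> x; rewrite mule_ge0// lee_fin haar_weight_ge0.
under [in RHS]eq_integral do rewrite addr0.
have mc : measurable_fun setT (fun x : R => c * x : R) by exact: measurable_funM.
rewrite -ge0_integralZl//; last 3 first.
- apply: emeasurable_funM; last exact: (measurableT_comp mG).
  by apply/measurable_EFinP; exact: (measurableT_comp mw).
- by move=> x _; rewrite mule_ge0// lee_fin haar_weight_ge0.
- by rewrite lee_fin ltW.
apply: eq_integral => x _; rewrite muleA -EFinM; congr (_%:E * _)%E.
rewrite /haar_weight pmulr_rgt0//; case: ifPn => x0; last by rewrite mulr0.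
by rewrite !powR_inv1 ?mulr_ge0 ?ltW// invfM mulrA divff ?gt_eqF// mul1r.
Qed.

(* Uniqueness of Haar measure on the multiplicative group, made explicit:
   by Tonelli and scale invariance, both sides multiplied by the mass of h
   equal the integral of h x G(y/x) against dx/x dy/y. *)
Lemma haar_inv {R : realType} (G : R -> \bar R) :
  measurable_fun setT G -> (forall x, 0 <= G x)%E ->
  (\int[mu]_x ((haar_weight x)%:E * G (x `^ (-1))%R) =
   \int[mu]_x ((haar_weight x)%:E * G x))%E.
Proof.
move=> mG G0; have mw := @measurable_haar_weight R.
have mwE : measurable_fun setT (EFin \o @haar_weight R) by exact/measurable_EFinP.
have w0 (x : R) : (0 <= (haar_weight x)%:E)%E by rewrite lee_fin haar_weight_ge0.
pose h (x : R) : \bar R := (\1_`[1, 2] x)%:E.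
have mh : measurable_fun setT h by apply/measurable_EFinP; exact: measurable_indic.
have h0 x : (0 <= h x)%E by rewrite lee_fin indicE.
pose H := (\int[mu]_x ((haar_weight x)%:E * h x))%E.
have mpow : measurable_fun setT (fun x : R => x `^ (-1)) := measurable_powR (-1).
have mmul : measurable_fun setT (fun z : R * R => z.1 * z.2)
  by apply: measurable_funM; [exact: measurable_fst|exact: measurable_snd].
have HE : H = (\int[mu]_(x in `[1%R, 2%R]) (x `^ (-1))%:E)%E.
  rewrite /H [RHS]integral_mkcond; apply: eq_integral => x _.
  rewrite /h patchE indicE mem_setE; case: ifPn => xI; last by rewrite mule0.
  rewrite mule1 /haar_weight; move: xI; rewrite in_itv/= => /andP[x1 _].
  by rewrite (lt_le_trans _ x1).
have Hfin : H \is a fin_num.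
  rewrite ge0_fin_numE; last by apply: integral_ge0 => x _; rewrite mule_ge0.
  rewrite HE; apply: (@le_lt_trans _ _ (\int[mu]_(x in `[1%R, 2%R]) (cst 1%:E x))%E).
    apply: ge0_le_integral => //.
    - by move=> x _; rewrite lee_fin powR_ge0.
    - by apply/measurable_EFinP; exact: measurable_funTS.
    - move=> x /=; rewrite in_itv/= => /andP[x1 _].
      rewrite lee_fin powR_inv1 ?(le_trans _ x1)// invf_le1//.
      exact: lt_le_trans x1.
  by rewrite integral_cst//= lebesgue_measure_itv/= lte_fin ltr1n mul1e -EFinB ltry.
have Hgt0 : (0 < H)%E.
  rewrite HE.
  apply: (@lt_le_trans _ _ (\int[mu]_(x in `[1%R, 2%R]) (cst (2^-1)%:E x))%E).
    rewrite integral_cst//= lebesgue_measure_itv/= lte_fin ltr1n -EFinB -EFinM lte_fin.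
    by lra.
  apply: ge0_le_integral => //.
  - by move=> x _; rewrite lee_fin invr_ge0.
  - by apply/measurable_EFinP; exact: measurable_funTS.
  - move=> x /=; rewrite in_itv/= => /andP[x1 x2].
    rewrite lee_fin powR_inv1 ?(le_trans _ x1)// lef_pV2 ?posrE//.
    exact: lt_le_trans x1.
suff E : (H * \int[mu]_x ((haar_weight x)%:E * G (x `^ (-1))%R) =
          H * \int[mu]_x ((haar_weight x)%:E * G x))%E.
  by apply/le_anti/andP; split; rewrite -(lee_pmul2l Hfin Hgt0) E.
pose K (z : R * R) : \bar R :=
  ((haar_weight z.1)%:E * (haar_weight z.2)%:E * G (z.1 `^ (-1))%R * h (z.1 * z.2)%R)%E.
have mK : measurable_fun setT K.
  apply: emeasurable_funM; last exact: (measurableT_comp mh).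
  apply: emeasurable_funM; last first.
    by apply: (measurableT_comp mG); exact: (measurableT_comp mpow measurable_fst).
  apply: emeasurable_funM.
    exact: (measurableT_comp mwE measurable_fst).
  exact: (measurableT_comp mwE measurable_snd).
have K0 z : (0 <= K z)%E by rewrite /K !mule_ge0.
pose K' (z : R * R) : \bar R :=
  ((haar_weight z.1)%:E * (haar_weight z.2)%:E * G (z.1 `^ (-1) * z.2)%R * h z.1)%E.
have mK' : measurable_fun setT K'.
  apply: emeasurable_funM; last exact: (measurableT_comp mh measurable_fst).
  apply: emeasurable_funM; last first.
    apply: (measurableT_comp mG); apply: measurable_funM; last exact: measurable_snd.
    exact: (measurableT_comp mpow measurable_fst).
  apply: emeasurable_funM.
    exact: (measurableT_comp mwE measurable_fst).
  exact: (measurableT_comp mwE measurable_snd).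
have K'0 z : (0 <= K' z)%E by rewrite /K' !mule_ge0.
transitivity (\int[mu]_x \int[mu]_y K (x, y))%E.
  rewrite -ge0_integralZl//; last 3 first.
  - apply: emeasurable_funM => //; exact: (measurableT_comp mG mpow).
  - by move=> x _; rewrite mule_ge0.
  - exact: ltW.
  apply: eq_integral => x _; rewrite /K/=.
  have [x0|x0] := ltP 0 x; last first.
    rewrite /haar_weight ltNge x0/= !mul0e mule0 integral0_eq// => y _.
    by rewrite !mul0e.
  rewrite /H -(@haar_scale _ x h)// muleC -ge0_integralZl//.
  - apply: eq_integral => y _; rewrite !muleA; congr (_ * _)%E.
    by rewrite -!muleA; congr (_ * _)%E; rewrite muleC.
  - apply: emeasurable_funM => //; apply: (measurableT_comp mh).
    exact: measurable_funM.
  - by move=> y _; rewrite mule_ge0.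
  - by rewrite mule_ge0.
transitivity (\int[mu]_y \int[mu]_x K (x, y))%E.
  exact: (@fubini_tonelli _ _ _ _ _ mu mu K).
transitivity (\int[mu]_y \int[mu]_x K' (x, y))%E.
  apply: eq_integral => y _.
  have [y0|y0] := ltP 0 y; last first.
    rewrite !integral0_eq// => x _; rewrite /K' /K /= {2}/haar_weight ltNge y0/=.
      by rewrite mule0 !mul0e.
    by rewrite mule0 !mul0e.
  pose F (x : R) : \bar R := (G (x `^ (-1) * y)%R * h x)%E.
  transitivity ((haar_weight y)%:E * \int[mu]_x ((haar_weight x)%:E * F (y * x)%R))%E.
    rewrite -ge0_integralZl//.
    - apply: eq_integral => x _; rewrite /K /F/=.
      have [x0|x0] := ltP 0 x; last first.
        by rewrite /haar_weight (ltNge _ x) x0/= !(mul0e, mule0).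
      rewrite powRM ?ltW// mulrAC (@powR_inv1 _ y) ?ltW// mulVf ?gt_eqF// mul1r.
      by rewrite [(y * x)%R]mulrC [in RHS]muleCA !muleA.
    - apply: emeasurable_funM => //; apply: emeasurable_funM.
        apply: (measurableT_comp mG); apply: measurable_funM => //.
        by apply: (measurableT_comp mpow); exact: measurable_funM.
      by apply: (measurableT_comp mh); exact: measurable_funM.
    - by move=> x _; rewrite !mule_ge0.
  have mF : measurable_fun setT F.
    apply: emeasurable_funM => //.
    by apply: (measurableT_comp mG); exact: measurable_funM.
  rewrite haar_scale//; last by move=> x; rewrite /F mule_ge0.
  rewrite -ge0_integralZl//.
  - by apply: eq_integral => x _; rewrite /K' /F/= muleCA !muleA.
  - exact: emeasurable_funM.
  - by move=> x _; rewrite !mule_ge0.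
transitivity (\int[mu]_x \int[mu]_y K' (x, y))%E.
  by symmetry; exact: (@fubini_tonelli _ _ _ _ _ mu mu K').
rewrite muleC -ge0_integralZl//; last 3 first.
- exact: emeasurable_funM.
- by move=> x _; rewrite mule_ge0.
- by apply: integral_ge0 => x _; rewrite mule_ge0.
apply: eq_integral => x _; rewrite /K'/=.
have [x0|x0] := ltP 0 x; last first.
  rewrite integral0_eq => [|y _]; rewrite /haar_weight (ltNge _ x) x0/= ?(mul0e, mule0)//.
rewrite -(@haar_scale _ (x `^ (-1)) G)//; last by rewrite powR_gt0.
rewrite muleC -ge0_integralZl//.
- apply: eq_integral => y _; rewrite -!muleA; congr (_ * _)%E.
  by rewrite [RHS]muleCA; congr (_ * _)%E; rewrite muleC.
- by apply: emeasurable_funM => //; apply: (measurableT_comp mG); exact: measurable_funM.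
- by move=> y _; rewrite mule_ge0.
- by rewrite mule_ge0.
Qed.

Lemma ge0_integral_comp_inv {R : realType} (c : R) (v : R -> R) : 0 < c ->
  measurable_fun (Rpos R) v -> (forall x, 0 < x -> 0 <= v x) ->
  (\int[mu]_(x in (Rpos R)) (v (c * x)^-1 / (c * x ^+ 2))%:E =
   \int[mu]_(x in (Rpos R)) (v x)%:E)%E.
Proof.
move=> c0 mv v0.
pose G (x : R) : \bar R := ((v \_ (Rpos R)) x * x)%:E.
have mvD : measurable_fun setT (v \_ (Rpos R)) by exact/(measurable_restrictT _ _).1.
have mG : measurable_fun setT G.
  by apply/measurable_EFinP; exact: measurable_funM.
have G0 x : (0 <= G x)%E.
  rewrite /G lee_fin patchE; case: ifPn => [|_]; last by rewrite mul0r.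
  by rewrite inE/= in_itv/= andbT => x0; rewrite mulr_ge0 ?v0// ltW.
have GD (x : R) : 0 < x -> G x = (v x * x)%:E.
  by move=> x0; rewrite /G patchE mem_set//= in_itv/= x0.
transitivity (\int[mu]_x ((haar_weight x)%:E * G ((c * x) `^ (-1))%R))%E.
  rewrite integral_mkcond; apply: eq_integral => x _; rewrite patchE.
  case: ifPn => [|/negP xD].
    rewrite inE/= in_itv/= andbT => x0.
    rewrite haar_weightE// powR_inv1 ?mulr_ge0 ?(ltW x0) ?(ltW c0)//.
    rewrite GD ?invr_gt0 ?mulr_gt0// -EFinM; congr EFin.
    by field; rewrite !gt_eqF.
  rewrite /haar_weight; case: ifPn => [x0|_]; last by rewrite mul0e.
  by exfalso; apply: xD; rewrite inE/= in_itv/= x0.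
rewrite (@haar_scale _ c (fun y => G (y `^ (-1)%R)))//; last first.
  exact: (measurableT_comp mG (measurable_powR (-1))).
rewrite haar_inv// [RHS]integral_mkcond; apply: eq_integral => x _; rewrite patchE.
case: ifPn => [|/negP xD].
  rewrite inE/= in_itv/= andbT => x0.
  by rewrite haar_weightE// GD// -EFinM mulrCA mulVf ?gt_eqF// mulr1.
rewrite /haar_weight; case: ifPn => [x0|_]; last by rewrite mul0e.
by exfalso; apply: xD; rewrite inE/= in_itv/= x0.
Qed.

Lemma integral_comp_inv {R : realType} (c : R) (v : R -> R) : 0 < c ->
  measurable_fun (Rpos R) v ->
  (\int[mu]_(x in (Rpos R)) (v (c * x)^-1 / (c * x ^+ 2))%:E =
   \int[mu]_(x in (Rpos R)) (v x)%:E)%E.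
Proof.
move=> c0 mv; rewrite [LHS]integralE [RHS]integralE.
have EP (g : R -> R) x : ((fun y => (g y)%:E)^\+ x = ((g^\+)%R x)%:E)%E :=
  congr1 (@^~ x) (funerpos g).
have EN (g : R -> R) x : ((fun y => (g y)%:E)^\- x = ((g^\-)%R x)%:E)%E :=
  congr1 (@^~ x) (funerneg g).
under eq_integral do rewrite EP; under [X in (_ - X)%E]eq_integral do rewrite EN.
under [in RHS]eq_integral do rewrite EP.
under [X in _ = (_ - X)%E]eq_integral do rewrite EN.
rewrite -(@ge0_integral_comp_inv _ c (v^\+)%R)//; last exact: measurable_funrpos.
rewrite -(@ge0_integral_comp_inv _ c (v^\-)%R)//; last exact: measurable_funrneg.
have q0 (x : R) : 0 < x -> 0 <= (c * x ^+ 2)^-1.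
  by move=> x0; rewrite invr_ge0 mulr_ge0 ?sqr_ge0// ltW.
congr (_ - _)%E; apply: eq_integral => x; rewrite inE/= in_itv/= andbT => /q0 {}q0.
- by rewrite /funrpos/= maxr_pMl// mul0r.
- by rewrite /funrneg/= maxr_pMl// mul0r mulNr.
Qed.

Lemma cauchy_schwarz_integral {R : realType} (A : set R) (u v : R -> R) :
  measurable A -> measurable_fun A u -> measurable_fun A v ->
  (forall x, A x -> 0 <= u x) -> (forall x, A x -> 0 <= v x) ->
  (\int[mu]_(x in A) (u x * v x)%:E <=
   poweR (\int[mu]_(x in A) (u x ^+ 2)%:E) 2^-1 *
   poweR (\int[mu]_(x in A) (v x ^+ 2)%:E) 2^-1)%E.
Proof.
move=> mA mu' mv u0 v0.
have mU : measurable_fun setT (u \_ A) by exact/(measurable_restrictT _ _).1.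
have mV : measurable_fun setT (v \_ A) by exact/(measurable_restrictT _ _).1.
have pq : (2^-1 + 2^-1 : R) = 1 by field.
have sqE (w : R -> R) : (forall x, A x -> 0 <= w x) ->
    (\int[mu]_(x in A) (w x ^+ 2)%:E =
     \int[mu]_x `|((w \_ A) x)%:E| `^ 2)%E.
  move=> w0; rewrite integral_mkcond; apply: eq_integral => x _; rewrite !patchE.
  case: ifPn => [|_]; last by rewrite abse0 poweR0r.
  by rewrite inE => /w0 wx; rewrite abse_EFin ger0_norm// poweR_EFin -powR_mulrn.
have := hoelder mu mU mV (ltr0n _ 2) (ltr0n _ 2) pq.
rewrite Lnorm1 unlock/= -!sqE//; apply: le_trans.
rewrite integral_mkcond le_eqVlt; apply/orP; left; apply/eqP.
apply: eq_integral => x _; rewrite !patchE; case: ifPn => [|_]; last first.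
  by rewrite mulr0 normr0.
by rewrite inE => xA; rewrite ger0_norm// mulr_ge0 ?u0 ?v0.
Qed.

(** * Series, Fubini and Laplace-type integrals on the half-line *)

Lemma series_dominated d (T : measurableType d) {R : realType}
    (m : {measure set T -> \bar R}) (A : set T) (f : nat -> T -> R) (F : T -> R) :
  measurable A -> (forall j, measurable_fun A (f j)) ->
  (\sum_(0 <= j <oo) \int[m]_(x in A) `|f j x|%:E < +oo)%E ->
  (forall x, A x -> series (f ^~ x) @ \oo --> F x) ->
  m.-integrable A (EFin \o F) /\
  series (fun j => \int[m]_(x in A) f j x) @ \oo --> \int[m]_(x in A) F x.
Proof.
move=> mA mf fin cv.
have mfE j : measurable_fun A (EFin \o f j) by exact/measurable_EFinP.
have mabs j : measurable_fun A (fun x => `|f j x|%:E).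
  by apply/measurable_EFinP; exact: measurableT_comp.
pose g x : \bar R := (\sum_(0 <= j <oo) `|f j x|%:E)%E.
have ig : m.-integrable A g.
  apply/integrableP; split.
    by apply: ge0_emeasurable_sum => //; move=> j x _ _; rewrite lee_fin.
  under eq_integral do rewrite gee0_abs ?nneseries_ge0//.
  by rewrite integral_nneseries.
have fi j : m.-integrable A (EFin \o f j).
  apply/integrableP; split => //; apply: le_lt_trans fin.
  have h n : (0 <= \int[m]_(x in A) `|f n x|%:E)%E.
    by apply: integral_ge0 => x _; rewrite lee_fin.
  apply: le_trans (nneseries_lim_ge j.+1 (fun n _ _ => h n)).
  by rewrite big_nat_recr//= leeDr//; apply: sume_ge0 => i _.
have mF : measurable_fun A F.
  apply: (@measurable_fun_cvg _ _ _ _ (fun n x => series (f ^~ x) n)) => //.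
  by move=> n; apply: measurable_sum => i; exact: mf.
have [] := @dominated_convergence _ _ _ m A mA (fun n x => (series (f ^~ x) n)%:E)
  (EFin \o F) g.
- move=> n; apply/measurable_EFinP; by apply: measurable_sum => i; exact: mf.
- exact/measurable_EFinP.
- by apply: aeW => x /cv xF; apply: cvg_EFin => //; apply: nearW.
- exact: ig.
- apply: aeW => x n _; apply: (@le_trans _ _ (\sum_(0 <= j < n) `|f j x|%:E)%E).
    by rewrite abse_EFin sumEFin lee_fin; exact: ler_norm_sum.
  exact: nneseries_lim_ge.
move=> iF _ cvI; split=> //.
have -> : series (fun j => \int[m]_(x in A) f j x) =
    (fun n => \int[m]_(x in A) series (f ^~ x) n).
  apply/funext => n; rewrite /series/=.
  elim: n => [|n IHn].
    rewrite big_geq//; under eq_Rintegral do rewrite big_geq//.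
    by rewrite Rintegral_cst// mul0r.
  rewrite big_nat_recr//= IHn -RintegralD//.
    by apply: eq_Rintegral => x _; rewrite big_nat_recr.
  have -> : EFin \o (fun x => \sum_(0 <= k < n) f k x) =
            (fun x => \sum_(0 <= k < n) (f k x)%:E)%E.
    by apply/funext => x /=; rewrite sumEFin.
  by apply: integrable_sum => // i _; exact: fi.
by apply: fine_cvg; rewrite fineK//; exact: integrable_fin_num.
Qed.

Lemma tonelli_kernel {R : realType} (A : set R) (k : R -> R -> R) (p w : R -> R) :
  measurable A -> measurable_fun setT (fun z : R * R => k z.1 z.2) ->
  measurable_fun A p -> measurable_fun A w ->
  (forall t x, A t -> A x -> 0 <= k t x) ->
  (forall t, A t -> 0 <= p t) -> (forall x, A x -> 0 <= w x) ->
  (\int[mu]_(t in A) \int[mu]_(x in A) (k t x * p t * w x)%:E =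
   \int[mu]_(x in A) \int[mu]_(t in A) (k t x * p t * w x)%:E)%E.
Proof.
move=> mA mk mp mw k0 p0 w0.
pose f (z : R * R) := (k z.1 z.2 * (p \_ A) z.1 * (w \_ A) z.2)%:E.
have mP : measurable_fun setT (p \_ A) by exact/(measurable_restrictT _ _).1.
have mW : measurable_fun setT (w \_ A) by exact/(measurable_restrictT _ _).1.
have mf : measurable_fun setT f.
  apply/measurable_EFinP; apply: measurable_funM; last exact: (measurableT_comp mW measurable_snd).
  by apply: measurable_funM => //; exact: (measurableT_comp mP measurable_fst).
have f0 z : (0 <= f z)%E.
  rewrite /f lee_fin !patchE; case: ifPn; last by rewrite mulr0 mul0r.
  rewrite inE => z1; case: ifPn; last by rewrite mulr0.
  by rewrite inE => z2; rewrite !mulr_ge0 ?k0 ?p0 ?w0.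
transitivity (\int[mu]_t \int[mu]_x f (t, x))%E.
  rewrite integral_mkcond; apply: eq_integral => t _; rewrite patchE.
  rewrite /f/= patchE; case: ifPn => tA; last first.
    by rewrite integral0_eq// => x _; rewrite mulr0 mul0r.
  rewrite integral_mkcond; apply: eq_integral => x _; rewrite !patchE.
  by case: ifPn => // _; rewrite mulr0.
transitivity (\int[mu]_x \int[mu]_t f (t, x))%E.
  exact: (@fubini_tonelli _ _ _ _ _ mu mu f).
rewrite [RHS]integral_mkcond; apply: eq_integral => x _; rewrite [RHS]patchE.
rewrite /f/= patchE; case: ifPn => tA; last first.
  by rewrite integral0_eq// => t _; rewrite mulr0.
rewrite [RHS]integral_mkcond; apply: eq_integral => t _; rewrite !patchE.
by case: ifPn => // _; rewrite mulr0 mul0r.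
Qed.

Lemma fubini_kernel {R : realType} (A : set R) (k : R -> R -> R) (p w : R -> R) :
  measurable A -> measurable_fun setT (fun z : R * R => k z.1 z.2) ->
  measurable_fun A p -> measurable_fun A w ->
  (forall t x, A t -> A x -> 0 <= k t x) -> (forall t, A t -> 0 <= p t) ->
  (forall t, A t -> mu.-integrable A (fun x => (k t x * w x)%:E)) ->
  (forall x, A x -> mu.-integrable A (fun t => (k t x * p t)%:E)) ->
  (\int[mu]_(t in A) \int[mu]_(x in A) (k t x * p t * `|w x|)%:E < +oo)%E ->
  \int[mu]_(t in A) (p t * \int[mu]_(x in A) (k t x * w x)) =
  \int[mu]_(x in A) (w x * \int[mu]_(t in A) (k t x * p t)).
Proof.
move=> mA mk mp mw k0 p0 ikw ikp fin.
pose f (z : R * R) := (k z.1 z.2 * (p \_ A) z.1 * (w \_ A) z.2)%:E.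
have mP : measurable_fun setT (p \_ A) by exact/(measurable_restrictT _ _).1.
have mW : measurable_fun setT (w \_ A) by exact/(measurable_restrictT _ _).1.
have mf : measurable_fun setT f.
  apply/measurable_EFinP; apply: measurable_funM; last exact: (measurableT_comp mW measurable_snd).
  by apply: measurable_funM => //; exact: (measurableT_comp mP measurable_fst).
have inf : (mu \x mu)%E.-integrable setT f.
  apply/(@integrable12ltyP _ _ _ _ _ mu mu f mf).2; move: fin; congr (_ < _)%E.
  rewrite integral_mkcond; apply: eq_integral => t _; rewrite patchE.
  rewrite /f/= [in RHS]patchE; case: ifPn => tA; last first.
    by rewrite integral0_eq// => x _; rewrite mulr0 mul0r normr0.
  rewrite integral_mkcond; apply: eq_integral => x _; rewrite !patchE.
  case: ifPn => xA; last by rewrite mulr0 normr0.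
  move: tA xA; rewrite !inE => tA xA.
  by rewrite normrM ger0_norm// mulr_ge0 ?k0 ?p0.
rewrite /Rintegral; congr fine.
transitivity (\int[mu]_t \int[mu]_x f (t, x))%E.
  rewrite integral_mkcond; apply: eq_integral => t _; rewrite patchE.
  rewrite /f/= patchE; case: ifPn => tA; last first.
    by rewrite integral0_eq// => x _; rewrite mulr0 mul0r.
  have tA' : A t by rewrite inE in tA.
  rewrite EFinM fineK; last by apply: integrable_fin_num => //; exact: ikw.
  rewrite -integralZl//; last exact: ikw.
  rewrite integral_mkcond; apply: eq_integral => x _; rewrite !patchE.
  by case: ifPn => // _; rewrite ?mulr0// -EFinM; congr EFin; ring.
transitivity (\int[mu]_x \int[mu]_t f (t, x))%E; first exact: (Fubini inf).
rewrite [RHS]integral_mkcond; apply: eq_integral => x _; rewrite [RHS]patchE.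
rewrite /f/= patchE; case: ifPn => xA; last first.
  by rewrite integral0_eq// => t _; rewrite mulr0.
have xA' : A x by rewrite inE in xA.
rewrite EFinM fineK; last by apply: integrable_fin_num => //; exact: ikp.
rewrite -integralZl//; last exact: ikp.
rewrite [RHS]integral_mkcond; apply: eq_integral => t _; rewrite !patchE.
by case: ifPn => // _; rewrite ?mulr0 ?mul0r// -EFinM; congr EFin; ring.
Qed.

Lemma integral_expRN_lty {R : realType} (c : R) : 0 < c ->
  (\int[mu]_(x in Rpos R) (expR (- c * x))%:E < +oo)%E.
Proof.
move=> c0.
have mD : measurable (Rpos R) by exact: measurable_itv.
have i1 : mu.-integrable (Rpos R) (EFin \o exponential_pdf c).
  by apply: integrableS (@integrable_exponential_pdf R c c0).
have /integrableP[_] : mu.-integrable (Rpos R) (fun x => c^-1%:E * (EFin \o exponential_pdf c) x)%E.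
  exact: integrableZl.
apply: le_lt_trans; rewrite le_eqVlt; apply/orP; left; apply/eqP.
apply: eq_integral => x; rewrite inE/= in_itv/= andbT => x0.
rewrite /= exponential_pdfE ?ltW// mulrA mulVf ?gt_eqF// mul1r.
by rewrite ger0_norm// expR_ge0.
Qed.

Lemma powRN_cvg0 {R : realType} (a : R) : 0 < a ->
  x `^ (- a) @[x --> +oo] --> (0 : R).
Proof.
move=> a0; apply/cvgrPdist_lt => e e0; near=> x.
have x0 : 0 < x by near: x; exact: nbhs_pinfty_gt.
rewrite sub0r normrN ger0_norm ?powR_ge0// /powR gt_eqF// -[ltRHS](lnK e0) ltr_expR.
have xe : expR (a^-1 * - ln e) < x by near: x; exact: nbhs_pinfty_gt.
by rewrite mulNr ltrNl -ltr_pdivrMl// -[ltLHS]expRK ltr_ln ?posrE ?expR_gt0//.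
Unshelve. all: by end_near. Qed.

Lemma integral_powRN_1y {R : realType} (a : R) : 0 < a ->
  (\int[mu]_(x in `[(1%R : R), +oo[) (x `^ (- a - 1))%:E < +oo)%E.
Proof.
move=> a0.
have dF (x : R) : 0 < x -> is_derive x 1 (fun y => - a^-1 * y `^ (- a)) (x `^ (- a - 1)).
  move=> x0; have H := is_derive1_powR (- a) x0.
  have : is_derive x 1 (- a^-1 \*: (fun y => y `^ (- a))) (- a^-1 *: (- a * x `^ (- a - 1))).
    exact: is_deriveZ.
  by rewrite /GRing.scale/= mulrA mulrNN mulVf ?gt_eqF// mul1r.
rewrite (@ge0_continuous_FTC2y _ _ (fun y : R => - a^-1 * y `^ (- a)) _ 0).
- by rewrite -EFinB ltry.
- by move=> x _; rewrite powR_ge0.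
- apply: continuous_in_subspaceT => x; rewrite inE/= in_itv/= andbT => x1.
  have x0 : 0 < x by exact: lt_le_trans x1.
  apply: differentiable_continuous; apply/derivable1_diffP.
  by have [] := is_derive1_powR (- a - 1) x0.
- rewrite -[X in _ --> X](mulr0 (- a^-1)); apply: cvgM; first exact: cvg_cst.
  exact: powRN_cvg0.
- by move=> x x1; have [] := dF x (lt_trans ltr01 x1).
- apply: cvg_at_right_filter.
  have c1 : {for (1 : R), continuous (fun y : R => - a^-1 * y `^ (- a))}.
    apply: differentiable_continuous; apply/derivable1_diffP.
    by have [] := dF 1 ltr01.
  exact: c1.
- move=> x; rewrite in_itv/= andbT => x1; rewrite derive1E.
  by have [] := dF x (lt_trans ltr01 x1).
Qed.

(* The inversion x -> 1/x moves the singularity at 0 to infinity. *)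
Lemma integral_powR_01 {R : realType} (q : R) : - 1 < q ->
  (\int[mu]_(x in `](0%R : R), 1%R]) (x `^ q)%:E < +oo)%E.
Proof.
move=> q1; have a0 : 0 < q + 1 by lra.
apply: le_lt_trans (integral_powRN_1y _ a0).
rewrite le_eqVlt; apply/orP; left; apply/eqP.
pose v : R -> R := (fun x => x `^ q) \_ `]0, 1].
have mv : measurable_fun setT v.
  apply/(measurable_restrictT _ _).1 => //; apply: measurable_funTS.
  exact: measurable_powR.
transitivity (\int[mu]_(x in Rpos R) (v x)%:E)%E.
  rewrite integral_mkcond [RHS]integral_mkcond; apply: eq_integral => x _.
  rewrite !patchE /v patchE; case: ifPn => [x01|//]; last by case: ifP.
  case: ifPn => // /negP[]; move: x01; rewrite !inE/= !in_itv/= andbT.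
  by case/andP.
rewrite -(@ge0_integral_comp_inv _ 1)//; last 2 first.
- exact: measurable_funTS.
- by move=> x _; rewrite /v patchE; case: ifP; rewrite // powR_ge0.
rewrite integral_mkcond [RHS]integral_mkcond; apply: eq_integral => x _.
rewrite !patchE /v !mul1r patchE; have [x1|x1] := leP 1 x.
  have x0 : 0 < x by exact: lt_le_trans x1.
  rewrite !mem_set//=; last 3 first.
  - by rewrite /= in_itv/= ?andbT ?invr_gt0 ?x0 ?invf_le1.
  - by rewrite /= in_itv/= ?andbT ?invr_gt0 ?x0 ?invf_le1.
  - by rewrite /= in_itv/= ?andbT ?invr_gt0 ?x0 ?invf_le1.
  congr EFin; rewrite opprD -addrA powRD; last by rewrite (gt_eqF x0) implybT.
  rewrite -powR_inv1 ?(ltW x0)// -powRrM mulN1r; congr (_ * _).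
  by rewrite -opprD powRN// -[(1 + 1)%R]/(2%:R) powR_mulrn ?(ltW x0).
have nx1 : x \notin `[1, +oo[%classic.
  by apply/negP; rewrite inE/= in_itv/= andbT => /(lt_le_trans x1); rewrite ltxx.
rewrite (negbTE nx1); case: ifPn => //; rewrite inE/= in_itv/= andbT => x0.
rewrite ifN ?mul0r//; apply/negP; rewrite inE/= in_itv/= invr_gt0 x0/=.
by rewrite invf_le1// => /(lt_le_trans x1); rewrite ltxx.
Qed.

Lemma exprn_le_expR {R : realType} (n : nat) (d : R) : 0 < d ->
  exists2 C : R, 0 < C & forall v, 0 <= v -> v ^+ n <= C * expR (d * v).
Proof.
move=> d0; exists (n.+1`!%:R / d ^+ n.+1 + 1).
  by rewrite ltr_wpDl// divr_ge0// exprn_ge0// ltW.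
move=> v v0; have dv0 : 0 <= d * v by rewrite mulr_ge0// ltW.
have e1 : 1 <= expR (d * v) by rewrite -[leLHS]expR0 ler_expR.
have [v1|v1] := leP v 1.
  apply: (@le_trans _ _ 1); first exact: exprn_ile1.
  rewrite mulrDl mul1r; apply: le_trans e1 _; rewrite lerDr.
  by rewrite mulr_ge0 ?expR_ge0// divr_ge0// exprn_ge0// ltW.
apply: (@le_trans _ _ (v ^+ n.+1)).
  by rewrite exprS ler_peMl ?exprn_ge0// ltW.
have := @expR_ge1Dxn R (d * v) n dv0; set E := expR _ => H.
have {}H : (d * v) ^+ n.+1 / n.+1`!%:R <= E by apply: le_trans H; rewrite lerDr.
rewrite ler_pdivrMr ?ltr0n ?fact_gt0// in H.
have dn0 : 0 < d ^+ n.+1 by rewrite exprn_gt0.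
rewrite exprMn -ler_pdivlMl// in H.
apply: le_trans H _; have -> : (d ^+ n.+1)^-1 * (E * (n.+1)`!%:R) = (n.+1)`!%:R / d ^+ n.+1 * E by ring.
by rewrite mulrDl lerDl mul1r expR_ge0.
Qed.

Lemma expR_ln_le {R : realType} (p d : R) : 0 < d ->
  exists2 C : R, 0 < C & forall y, 0 < y ->
    expR (p * `|ln y|) <= C * expR (d * (y + y^-1)).
Proof.
move=> d0; pose n := (Num.truncn `|p|).+1.
have [C C0 HC] := exprn_le_expR n d d0.
exists C => // y y0; have yV0 : 0 < y^-1 by rewrite invr_gt0.
apply: le_trans (HC (y + y^-1) (addr_ge0 (ltW y0) (ltW yV0))).
apply: (@le_trans _ _ (expR (n%:R * `|ln y|))).
  rewrite ler_expR ler_wpM2r//; apply: le_trans (ler_norm p) _.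
  by rewrite ltW// /n truncnS_gt.
rewrite expRM_natl lerXn2r ?nnegrE ?expR_ge0 ?addr_ge0 ?ltW//.
have [l0|l0] := leP 0 (ln y).
  by rewrite ger0_norm// lnK ?posrE// ltrDl.
by rewrite ltr0_norm// expRN lnK ?posrE// ltrDr.
Qed.

Lemma measurable_expR_ln {R : realType} (A : set R) (q : R) :
  measurable_fun A (fun x => expR (q * ln x)).
Proof.
apply: measurable_funTS; apply: measurableT_comp => //.
by apply: measurable_funM => //; exact: measurable_ln.
Qed.

Lemma measurable_exprz_pos {R : realType} (n : int) :
  measurable_fun (Rpos R) (fun x : R => x ^ n).
Proof.
apply: (eq_measurable_fun (fun x => expR (n%:~R * ln x))).
  by move=> x; rewrite inE/= in_itv/= andbT => x0; rewrite exprz_expR_ln.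
exact: measurable_expR_ln.
Qed.

Lemma measurable_expRM {R : realType} (A : set R) (c : R) :
  measurable_fun A (fun x => expR (c * x)).
Proof.
by apply: measurable_funTS; apply: measurableT_comp.
Qed.

Lemma integral_powR_expRN_lty {R : realType} (q c : R) : - 1 < q -> 0 < c ->
  (\int[mu]_(x in Rpos R) (expR (q * ln x) * expR (- c * x))%:E < +oo)%E.
Proof.
move=> q1 c0; have c20 : 0 < c / 2 by rewrite divr_gt0.
have [C C0 HC] := expR_ln_le `|q| (c / 2) c20.
pose g (x : R) : \bar R := (((fun x => x `^ q) \_ `]0, 1]) x)%:E.
pose h (x : R) : \bar R := ((C * expR (c / 2))%:E * (expR (- (c / 2) * x))%:E)%E.
have mg : measurable_fun (Rpos R) g.
  apply/measurable_EFinP; apply: measurable_funTS.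
  apply/(measurable_restrictT _ _).1 => //; apply: measurable_funTS.
  exact: measurable_powR.
have g0 x : (0 <= g x)%E by rewrite /g lee_fin patchE; case: ifP; rewrite // powR_ge0.
have h0 x : (0 <= h x)%E by rewrite /h -EFinM lee_fin !mulr_ge0 ?expR_ge0 ?ltW.
have mh : measurable_fun (Rpos R) h.
  by apply: emeasurable_funM => //; apply/measurable_EFinP; exact: measurable_expRM.
apply: (@le_lt_trans _ _ (\int[mu]_(x in Rpos R) (g x + h x))%E).
  apply: ge0_le_integral => //.
  - apply/measurable_EFinP; apply: measurable_funM; first exact: measurable_expR_ln.
    exact: measurable_expRM.
  - exact: emeasurable_funD.
  move=> x /=; rewrite in_itv/= andbT => x0.
  have [x1|x1] := leP x 1.
    apply: (@le_trans _ _ (g x)); last by rewrite leeDl.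
    rewrite /g patchE mem_set/= ?in_itv/= ?x0// lee_fin /powR gt_eqF//.
    by rewrite ler_piMr ?expR_ge0// -expR0 ler_expR mulNr oppr_le0 mulr_ge0// ltW.
  apply: (@le_trans _ _ (h x)); last by rewrite leeDr.
  rewrite /h -EFinM lee_fin.
  apply: (@le_trans _ _ (C * expR (c / 2 * (x + x^-1)) * expR (- c * x))).
    rewrite ler_wpM2r ?expR_ge0//; apply: le_trans (HC x x0).
    rewrite ler_expR.
    by apply: le_trans (ler_norm _) _; rewrite normrM.
  rewrite -!mulrA ler_wpM2l ?(ltW C0)// -!expRD ler_expR.
  have : x^-1 <= 1 by rewrite invf_le1// ltW.
  move=> xV; have : c / 2 * x^-1 <= c / 2 * 1 by rewrite ler_wpM2l// ltW.
  by lra.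
rewrite ge0_integralD//; apply: lte_add_pinfty.
  apply: le_lt_trans (integral_powR_01 q q1); rewrite le_eqVlt; apply/orP; left; apply/eqP.
  rewrite integral_mkcond [RHS]integral_mkcond; apply: eq_integral => x _.
  rewrite !patchE /g patchE; case: ifPn => [x01|xn]; first by case: ifP.
  case: ifPn => // x1; move: xn; rewrite notin_setE/= in_itv/= andbT.
  by move: x1; rewrite inE/= in_itv/= => /andP[->].
have cge : (0 <= (C * expR (c / 2))%:E)%E by rewrite lee_fin mulr_ge0 ?expR_ge0// ltW.
rewrite ge0_integralZl//.
- by apply: lte_mul_pinfty => //; exact: integral_expRN_lty.
- by apply/measurable_EFinP; exact: measurable_expRM.
Qed.

Lemma inc_gammaE {R : realType} (k : int) (X : R) : 0 < X ->
  inc_gamma (1 - k) X = X ^ (1 - k) * expR (- X) *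
    \int[mu]_(t in Rpos R) (expR (- X * t) * ((1 + t) ^ k)^-1).
Proof.
move=> X0; rewrite /inc_gamma /Rintegral.
pose F (t : R) : \bar R :=
  (((fun t => expR (-1 * t) * expR ((- k)%:~R * ln t)) \_ `[X, +oo[) t)%:E.
have mF : measurable_fun setT F.
  apply/measurable_EFinP; apply/(measurable_restrictT _ _).1 => //.
  by apply: measurable_funM; [exact: measurable_expRM|exact: measurable_expR_ln].
have F0 x : (0 <= F x)%E.
  by rewrite /F lee_fin patchE; case: ifP => // _; rewrite mulr_ge0 ?expR_ge0.
have -> : (\int[mu]_(t in `[X, +oo[) (expR (- t) * t ^ (1 - k - 1))%:E = \int[mu]_t F t)%E.
  rewrite integral_mkcond; apply: eq_integral => t _; rewrite /F !patchE.
  case: ifPn => //; rewrite inE/= in_itv/= andbT => Xt.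
  by rewrite mulN1r exprz_expR_ln ?(lt_le_trans X0 Xt)// addrAC subrr add0r.
rewrite (ge0_integral_affine X X)//.
pose g (t : R) : R := expR (- X * t) * expR ((- k)%:~R * ln (1 + t)).
have mg A : measurable_fun A g.
  apply: measurable_funM; first exact: measurable_expRM.
  apply: measurable_funTS; apply: measurableT_comp => //.
  apply: measurable_funM => //; apply: (measurableT_comp (@measurable_ln R)).
  exact: measurable_funD.
have e (x : R) : 0 < x -> ((1 + x) ^ k)^-1 = expR ((- k)%:~R * ln (1 + x)).
  by move=> x0; rewrite invr_expz exprz_expR_ln// addr_gt0.
have -> : (\int[mu]_x F (X * x + X)%R =
    \int[mu]_(x in `[0%R, +oo[) ((X ^ (- k) * expR (- X))%:E * (g x)%:E))%E.
  rewrite [RHS]integral_mkcond; apply: eq_integral => x _; rewrite /F !patchE.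
  rewrite [in LHS]mem_setE [in RHS]mem_setE !in_itv/= !andbT lerDr pmulr_rge0//.
  case: ifPn => // x0; rewrite -EFinM; congr EFin.
  rewrite exprz_expR_ln// /g (_ : X * x + X = X * (1 + x)); last by ring.
  have x10 : 0 < 1 + x by rewrite ltr_pwDl.
  rewrite lnM ?posrE// -!expRD; congr expR; ring.
rewrite -integral_itv_obnd_cbnd; last first.
  by apply: emeasurable_funM => //; apply/measurable_EFinP; exact: mg.
rewrite ge0_integralZl//; last 3 first.
- by apply/measurable_EFinP; exact: mg.
- by move=> x _; rewrite lee_fin mulr_ge0 ?expR_ge0.
- by rewrite lee_fin mulr_ge0 ?expR_ge0// exprz_ge0// ltW.
rewrite (_ : (\int[mu]_(x in Rpos R) (g x)%:E = \int[mu]_(x in Rpos R)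
   (expR (- X * x) * ((1 + x) ^ k)^-1)%:E)%E); last first.
  by apply: eq_integral => x; rewrite inE/= in_itv/= andbT => /e ->.
rewrite muleA -EFinM.
set I := (\int[mu]_(x in _) _)%E.
have -> : X * (X ^ (- k) * expR (- X)) = X ^ (1 - k) * expR (- X).
  by rewrite expfzDr ?gt_eqF// expr1z mulrA.
case: I => [r| |]//=.
- by rewrite gt0_muley ?mulr0 ?lte_fin ?mulr_gt0 ?expR_gt0 ?exprz_gt0.
- by rewrite gt0_muleNy ?mulr0 ?lte_fin ?mulr_gt0 ?expR_gt0 ?exprz_gt0.
Qed.

Lemma integrable_expRN_exprzV {R : realType} (k : int) (X : R) : 0 < X ->
  mu.-integrable (Rpos R) (fun t => (expR (- X * t) * ((1 + t) ^ k)^-1)%:E).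
Proof.
move=> X0; have X20 : 0 < X / 2 by rewrite divr_gt0.
pose q : R := (- k)%:~R.
have e (x : R) : 0 < x -> ((1 + x) ^ k)^-1 = expR (q * ln (1 + x)).
  by move=> x0; rewrite invr_expz exprz_expR_ln// addr_gt0.
have [C C0 HC] := expR_ln_le q (X / 2) X20.
have mh : measurable_fun (Rpos R) (fun t : R => ((1 + t) ^ k)^-1).
  apply: (eq_measurable_fun (fun t : R => expR (q * ln (1 + t)))).
    by move=> x; rewrite inE/= in_itv/= andbT => /e ->.
  apply: measurable_funTS; apply: measurableT_comp => //.
  apply: measurable_funM => //; apply: (measurableT_comp (@measurable_ln R)).
  exact: measurable_funD.
have mg : measurable_fun (Rpos R) (fun t : R => expR (- X * t) * ((1 + t) ^ k)^-1).
  by apply: measurable_funM => //; exact: measurable_expRM.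
apply/integrableP; split; first exact/measurable_EFinP.
pose K := C * expR X.
have K0 : 0 <= K by rewrite mulr_ge0 ?expR_ge0// ltW.
apply: (@le_lt_trans _ _ (\int[mu]_(t in Rpos R) (K%:E * (expR (- (X / 2) * t))%:E))%E).
  apply: ge0_le_integral => //.
  - by apply: measurableT_comp => //; exact/measurable_EFinP.
  - by apply: emeasurable_funM => //; apply/measurable_EFinP; exact: measurable_expRM.
  move=> t /=; rewrite in_itv/= andbT => t0.
  rewrite e// ger0_norm ?mulr_ge0 ?expR_ge0// lee_fin.
  have t10 : 0 < 1 + t by rewrite addr_gt0.
  apply: (@le_trans _ _ (expR (- X * t) * (C * expR (X / 2 * (1 + t + (1 + t)^-1))))).
    rewrite ler_wpM2l ?expR_ge0//; apply: le_trans (HC _ t10).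
    by rewrite ger0_norm// ln_ge0// lerDl ltW.
  rewrite /K [leLHS]mulrCA -[leRHS]mulrA ler_wpM2l ?(ltW C0)// -!expRD ler_expR.
  have tV : (1 + t)^-1 <= 1 by rewrite invf_le1// lerDl ltW.
  have : X / 2 * (1 + t)^-1 <= X / 2 * 1 by rewrite ler_wpM2l// ltW.
  by lra.
rewrite ge0_integralZl//.
- by apply: lte_mul_pinfty => //; exact: integral_expRN_lty.
- by apply/measurable_EFinP; exact: measurable_expRM.
Qed.

(** * Complex-valued integrals *)

Definition cmeasurable {R : realType} (A : set R) (u : R -> R[i]) : Prop :=
  measurable_fun A (fun t => complex.Re (u t)) /\
  measurable_fun A (fun t => complex.Im (u t)).

Lemma eq_cmeasurable {R : realType} (A : set R) (u v : R -> R[i]) :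
  {in A, u =1 v} -> cmeasurable A u -> cmeasurable A v.
Proof.
move=> uv [mr mi]; split.
  by apply: eq_measurable_fun mr => x xA /=; rewrite uv.
by apply: eq_measurable_fun mi => x xA /=; rewrite uv.
Qed.

Lemma cmeasurableM {R : realType} (A : set R) (u v : R -> R[i]) :
  cmeasurable A u -> cmeasurable A v -> cmeasurable A (fun t => u t * v t).
Proof.
move=> [ur ui] [vr vi]; split.
  under eq_fun do rewrite cReM.
  by apply: measurable_funB; exact: measurable_funM.
under eq_fun do rewrite cImM.
by apply: measurable_funD; exact: measurable_funM.
Qed.

Lemma cmeasurable_cst {R : realType} (A : set R) (c : R[i]) :
  cmeasurable A (fun=> c).
Proof. by split; exact: measurable_cst. Qed.

Lemma cmeasurable_real {R : realType} (A : set R) (v : R -> R) :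
  measurable_fun A v -> cmeasurable A (fun t => (v t)%:C).
Proof. by move=> mv; split => //=; exact: measurable_cst. Qed.

Lemma cmeasurable_cexp {R : realType} (A : set R) (u : R -> R[i]) :
  measurable A -> cmeasurable A u -> cmeasurable A (fun t => cexp (u t)).
Proof.
move=> mA [ur ui].
have mexp : measurable_fun A (fun t => expR (complex.Re (u t))) by exact: measurableT_comp.
split=> /=; apply: measurable_funM => //.
- by apply: (measurableT_comp _ ui); apply: continuous_measurable_fun; exact: continuous_cos.
- by apply: (measurableT_comp _ ui); apply: continuous_measurable_fun; exact: continuous_sin.
Qed.

Lemma measurable_cnorm {R : realType} (A : set R) (u : R -> R[i]) :
  cmeasurable A u -> measurable_fun A (fun t => cnorm (u t)).
Proof.
move=> [ur ui].
have -> : (fun t => cnorm (u t)) =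
    (fun t => Num.sqrt (complex.Re (u t) ^+ 2 + complex.Im (u t) ^+ 2)).
  by apply/funext => t; case: (u t).
apply: (measurableT_comp (continuous_measurable_fun (@sqrt_continuous R))).
by apply: measurable_funD; exact: measurable_funX.
Qed.

Lemma cintegrable_lty {R : realType} (A : set R) (u : R -> R[i]) :
  measurable A -> cmeasurable A u ->
  (\int[mu]_(x in A) (cnorm (u x))%:E < +oo)%E -> cintegrable A u.
Proof.
move=> mA mu' fin; have mn := measurable_cnorm _ _ mu'; have [ur ui] := mu'.
split; apply/integrableP; split; try exact/measurable_EFinP.
  apply: le_lt_trans fin; apply: ge0_le_integral => //.
  - by apply: measurableT_comp => //; exact/measurable_EFinP.
  - exact/measurable_EFinP.
  - by move=> x _; rewrite abse_EFin lee_fin Re_le_cnorm.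
apply: le_lt_trans fin; apply: ge0_le_integral => //.
- by apply: measurableT_comp => //; exact/measurable_EFinP.
- exact/measurable_EFinP.
- by move=> x _; rewrite abse_EFin lee_fin Im_le_cnorm.
Qed.

Lemma cintegrable_bound {R : realType} (A : set R) (u : R -> R[i]) (v : R -> R) :
  measurable A -> cmeasurable A u -> measurable_fun A v ->
  (forall x, A x -> cnorm (u x) <= v x) ->
  (\int[mu]_(x in A) (v x)%:E < +oo)%E -> cintegrable A u.
Proof.
move=> mA mu' mv uv; move=> fin; apply: cintegrable_lty => //.
apply: le_lt_trans fin; apply: ge0_le_integral => //.
- by move=> x _; rewrite lee_fin cnorm_ge0.
- by apply/measurable_EFinP; exact: measurable_cnorm.
- exact/measurable_EFinP.
Qed.

Lemma cintegrable_cmeasurable {R : realType} (A : set R) (u : R -> R[i]) :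
  cintegrable A u -> cmeasurable A u.
Proof.
by move=> [/integrableP[/measurable_EFinP ur _] /integrableP[/measurable_EFinP ui _]].
Qed.

Lemma cintegrable_cnorm {R : realType} (A : set R) (u : R -> R[i]) :
  measurable A -> cintegrable A u ->
  (\int[mu]_(x in A) (cnorm (u x))%:E < +oo)%E.
Proof.
move=> mA iu; have [ur ui] := cintegrable_cmeasurable _ _ iu.
have mn := measurable_cnorm _ _ (conj ur ui).
case: iu => /integrableP[_ fr] /integrableP[_ fi].
apply: (@le_lt_trans _ _ (\int[mu]_(x in A)
    (`|(complex.Re (u x))%:E| + `|(complex.Im (u x))%:E|))%E).
  apply: ge0_le_integral => //.
  - by move=> x _; rewrite lee_fin cnorm_ge0.
  - exact/measurable_EFinP.
  - apply: emeasurable_funD; apply: measurableT_comp => //; exact/measurable_EFinP.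
  - by move=> x _; rewrite !abse_EFin -EFinD lee_fin cnorm_le.
rewrite ge0_integralD//.
- exact: lte_add_pinfty.
- by apply: measurableT_comp => //; exact/measurable_EFinP.
- by apply: measurableT_comp => //; exact/measurable_EFinP.
Qed.

Lemma eq_cintegral {R : realType} (A : set R) (u v : R -> R[i]) :
  {in A, u =1 v} -> cintegral A u = cintegral A v.
Proof.
move=> uv; rewrite /cintegral; apply: cpx_eqP => /=.
  by apply: eq_Rintegral => x xA; rewrite uv.
by apply: eq_Rintegral => x xA; rewrite uv.
Qed.

Lemma cintegralZl {R : realType} (A : set R) (c : R[i]) (u : R -> R[i]) :
  measurable A -> cintegrable A u ->
  cintegral A (fun x => c * u x) = c * cintegral A u.
Proof.
move=> mA [ir ii]; have irZ r : mu.-integrable A (EFin \o (fun x => r * complex.Re (u x))).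
  by have -> : EFin \o (fun x => r * complex.Re (u x)) =
     (fun x => r%:E * (complex.Re (u x))%:E)%E by []; exact: integrableZl.
have iiZ r : mu.-integrable A (EFin \o (fun x => r * complex.Im (u x))).
  by have -> : EFin \o (fun x => r * complex.Im (u x)) =
     (fun x => r%:E * (complex.Im (u x))%:E)%E by []; exact: integrableZl.
apply: cpx_eqP; rewrite ?cReM ?cImM /=.
  under eq_Rintegral do rewrite cReM.
  by rewrite RintegralB// !RintegralZl.
under eq_Rintegral do rewrite cImM.
by rewrite RintegralD// !RintegralZl.
Qed.

Lemma cintegralD {R : realType} (A : set R) (u v : R -> R[i]) :
  measurable A -> cintegrable A u -> cintegrable A v ->
  cintegral A (fun x => u x + v x) = cintegral A u + cintegral A v.
Proof.
move=> mA [ur ui] [vr vi]; apply: cpx_eqP; rewrite ?cReD ?cImD /=.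
  by under eq_Rintegral do rewrite cReD; rewrite RintegralD.
by under eq_Rintegral do rewrite cImD; rewrite RintegralD.
Qed.

Lemma cintegrableZl {R : realType} (A : set R) (c : R[i]) (u : R -> R[i]) :
  measurable A -> cintegrable A u -> cintegrable A (fun x => c * u x).
Proof.
move=> mA iu; have mu' := cintegrable_cmeasurable _ _ iu.
have mn := measurable_cnorm _ _ mu'.
apply: (@cintegrable_bound _ _ _ (fun x => cnorm c * cnorm (u x))) => //.
- by apply: cmeasurableM => //; exact: cmeasurable_cst.
- exact: measurable_funM.
- by move=> x _; rewrite cnormM.
under eq_integral do rewrite EFinM.
rewrite ge0_integralZl ?lee_fin ?cnorm_ge0//.
- by apply: lte_mul_pinfty; rewrite ?lee_fin ?cnorm_ge0//; exact: cintegrable_cnorm.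
- exact/measurable_EFinP.
- by move=> x _; rewrite lee_fin cnorm_ge0.
Qed.

Lemma cintegrableD {R : realType} (A : set R) (u v : R -> R[i]) :
  measurable A -> cintegrable A u -> cintegrable A v ->
  cintegrable A (fun x => u x + v x).
Proof.
move=> mA [ur ui] [vr vi]; split.
  have -> : (fun x => (complex.Re (u x + v x))%:E) =
    ((fun x => (complex.Re (u x))%:E) \+ (fun x => (complex.Re (v x))%:E))%E.
    by apply/funext => x; rewrite cReD.
  exact: integrableD.
have -> : (fun x => (complex.Im (u x + v x))%:E) =
  ((fun x => (complex.Im (u x))%:E) \+ (fun x => (complex.Im (v x))%:E))%E.
  by apply/funext => x; rewrite cImD.
exact: integrableD.
Qed.

Lemma cnorm_cintegral_le {R : realType} (A : set R) (u : R -> R[i]) (v : R -> R) :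
  measurable A -> cintegrable A u -> measurable_fun A v ->
  (forall x, A x -> cnorm (u x) <= v x) ->
  (\int[mu]_(x in A) (v x)%:E < +oo)%E ->
  cnorm (cintegral A u) <= 2 * \int[mu]_(x in A) v x.
Proof.
move=> mA [ur ui] mv uv fin.
have v0 x : A x -> 0 <= v x by move=> /uv; apply: le_trans; exact: cnorm_ge0.
have iv : mu.-integrable A (EFin \o v).
  apply/integrableP; split; first exact/measurable_EFinP.
  rewrite (_ : (\int[mu]_(x in A) `|(EFin \o v) x| = \int[mu]_(x in A) (v x)%:E)%E)//.
  by apply: eq_integral => x; rewrite inE => /v0 x0; rewrite /= ger0_norm.
have h (w : R -> R) : mu.-integrable A (EFin \o w) ->
    (forall x, A x -> `|w x| <= v x) ->
    `|\int[mu]_(x in A) w x| <= \int[mu]_(x in A) v x.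
  move=> iw wv; apply: (@le_trans _ _ (\int[mu]_(x in A) `|w x|)).
    exact: le_normr_Rintegral.
  apply: le_Rintegral => //.
  by have := integrable_norm iw.
apply: le_trans (cnorm_le _) _; rewrite mulr2n mulrDl mul1r; apply: lerD.
  by apply: h => // x /uv; apply: le_trans; exact: Re_le_cnorm.
by apply: h => // x /uv; apply: le_trans; exact: Im_le_cnorm.
Qed.

Lemma cseries_dominated {R : realType} (A : set R) (f : nat -> R -> R[i])
    (F : R -> R[i]) :
  measurable A -> (forall j, cmeasurable A (f j)) ->
  (\sum_(0 <= j <oo) \int[mu]_(x in A) (cnorm (f j x))%:E < +oo)%E ->
  (forall x, A x -> (series (f ^~ x) : nat -> R[i]^o) @ \oo --> (F x : R[i]^o)) ->
  cintegrable A F /\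
  ((series (fun j => cintegral A (f j)) : nat -> R[i]^o) @ \oo -->
    (cintegral A F : R[i]^o)).
Proof.
move=> mA mf fin cv.
have h (p : R[i] -> R) (w : nat -> R -> R) : (forall j x, w j x = p (f j x)) ->
    (forall z, `|p z| <= cnorm z) -> (forall j, measurable_fun A (w j)) ->
    (\sum_(0 <= j <oo) \int[mu]_(x in A) `|w j x|%:E < +oo)%E.
  move=> wE pz mw; apply: le_lt_trans fin; apply: lee_nneseries => [j _ _|j _].
    by apply: integral_ge0 => x _; rewrite lee_fin.
  have mnw : measurable_fun A (fun x : R => `|w j x|) by exact: measurableT_comp.
  apply: ge0_le_integral => //.
  - exact/measurable_EFinP.
  - by apply/measurable_EFinP; exact: measurable_cnorm.
  - by move=> x _; rewrite lee_fin wE pz.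
have sRe (g : nat -> R[i]) :
    (fun n => complex.Re (series g n)) = series (fun j => complex.Re (g j)).
  by apply/funext => n; rewrite /series/= Re_sum.
have sIm (g : nat -> R[i]) :
    (fun n => complex.Im (series g n)) = series (fun j => complex.Im (g j)).
  by apply/funext => n; rewrite /series/= Im_sum.
have [iR cR] := @series_dominated _ _ _ mu A (fun j x => complex.Re (f j x))
  (fun x => complex.Re (F x)) mA (fun j => (mf j).1)
  (h _ _ (fun _ _ => erefl) (@Re_le_cnorm R) (fun j => (mf j).1))
  (fun x xA => eq_ind _ (fun s => s @ \oo --> _) (cvg_Re _ _ _ _ (cv x xA)) _ (sRe _)).
have [iI cI] := @series_dominated _ _ _ mu A (fun j x => complex.Im (f j x))
  (fun x => complex.Im (F x)) mA (fun j => (mf j).2)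
  (h _ _ (fun _ _ => erefl) (@Im_le_cnorm R) (fun j => (mf j).2))
  (fun x xA => eq_ind _ (fun s => s @ \oo --> _) (cvg_Im _ _ _ _ (cv x xA)) _ (sIm _)).
by split=> //; apply: cvg_complex; rewrite ?sRe ?sIm.
Qed.

(** * Analyticity of Mellin-type integrals *)

Lemma le_norm_sub_derive {R : realType} (f df : R -> R) (b M : R) :
  (forall x : R, is_derive x 1 f (df x)) ->
  (forall x : R, `|x| <= `|b| -> `|df x| <= M) ->
  `|f b - f 0| <= M * `|b|.
Proof.
move=> fdf dfM.
have cf a c : {within `[a, c], continuous f}.
  apply: continuous_subspaceT => x; apply: differentiable_continuous.
  by apply/derivable1_diffP; have [] := fdf x.
have [b0|b0] := leP 0 b.
  have [c + ->] := MVT_segment b0 (fun x _ => fdf x) (cf 0 b).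
  rewrite in_itv/= => /andP[c0 cb]; rewrite subr0 normrM ler_wpM2r// dfM//.
  by rewrite !ger0_norm// (le_trans c0).
have [c + E] := MVT_segment (ltW b0) (fun x _ => fdf x) (cf b 0).
rewrite in_itv/= => /andP[bc c0]; rewrite distrC E sub0r normrM normrN ler_wpM2r//.
by rewrite dfM// !ler0_norm// ?lerN2// (le_trans bc).
Qed.

Lemma norm_cosB1_le {R : realType} (b : R) : `|cos b - 1| <= `|b|.
Proof.
rewrite -(@cos0 R) -[leRHS]mul1r.
apply: (@le_norm_sub_derive _ _ (fun x => - sin x)) => x _.
by rewrite normrN sin_max.
Qed.

Lemma norm_sin_le {R : realType} (b : R) : `|sin b| <= `|b|.
Proof.
have := @le_norm_sub_derive _ sin cos b 1 (@is_derive_sin R) (fun x _ => cos_max x).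
by rewrite sin0 subr0 mul1r.
Qed.

Lemma norm_cosB1_le_sqr {R : realType} (b : R) : `|cos b - 1| <= b ^+ 2.
Proof.
rewrite -(@cos0 R) -real_normK ?num_real// expr2.
apply: (@le_norm_sub_derive _ _ (fun x => - sin x)) => x xb.
by rewrite normrN (le_trans (norm_sin_le x)).
Qed.

Lemma norm_sinB_le {R : realType} (b : R) : `|sin b - b| <= b ^+ 2.
Proof.
have dE (x : R) : is_derive x 1 (fun y => sin y - y) (cos x - 1).
  by apply: is_deriveB.
have := @le_norm_sub_derive _ _ (fun x => cos x - 1) b `|b| dE.
rewrite sin0 !subr0 -expr2 real_normK ?num_real//; apply => x xb.
exact: le_trans (norm_cosB1_le x) xb.
Qed.

Lemma norm_expRB1_le {R : realType} (a : R) : `|expR a - 1| <= `|a| * expR `|a|.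
Proof.
have e1 := expR_ge1Dx a; have e2 := expR_ge1Dx (- a).
have E : expR a * expR (- a) = 1 by rewrite -expRD subrr expR0.
have a0 := expR_gt0 a.
have [a_ge|a_lt] := leP 0 a.
  rewrite (ger0_norm a_ge) ger0_norm; last by lra.
  have : expR a * (1 + - a) <= expR a * expR (- a) by rewrite ler_pM2l.
  by rewrite E; lra.
rewrite (ltr0_norm a_lt) ler0_norm; last by rewrite subr_le0 -expR0 ler_expR ltW.
have : 1 <= expR (- a) by rewrite -[leLHS]expR0 ler_expR; lra.
move=> H; apply: (@le_trans _ _ (- a * 1)); first by lra.
by rewrite ler_wpM2l//; lra.
Qed.

Lemma norm_expRB1B_le {R : realType} (a : R) :
  `|expR a - 1 - a| <= a ^+ 2 * expR `|a|.
Proof.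
have e1 := expR_ge1Dx a; have e2 := expR_ge1Dx (- a).
have E : expR a * expR (- a) = 1 by rewrite -expRD subrr expR0.
have a0 := expR_gt0 a.
have H : expR a - 1 <= a * expR a.
  have : expR a * (1 + - a) <= expR a * expR (- a) by rewrite ler_pM2l.
  by rewrite E; lra.
rewrite ger0_norm; last by lra.
apply: (@le_trans _ _ (a * (expR a - 1))); first by lra.
apply: le_trans (ler_norm _) _; rewrite normrM -real_normK ?num_real// expr2 -mulrA.
by rewrite ler_wpM2l// norm_expRB1_le.
Qed.

Lemma cnorm_cexpB1B_le {R : realType} (w : R[i]) :
  cnorm (cexp w - 1 - w) <= 4 * cnorm w ^+ 2 * expR (cnorm w).
Proof.
have ra := Re_le_cnorm w; have rb := Im_le_cnorm w.
move: (cnorm w) (cnorm_ge0 w) ra rb => r r0; case: w => a b ra rb; rewrite /= in ra rb.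
apply: le_trans (cnorm_le _) _; rewrite /= oppr0 addr0.
have ea : expR a <= expR r by rewrite ler_expR (le_trans (ler_norm a)).
have ea' : expR `|a| <= expR r by rewrite ler_expR.
have a2 : a ^+ 2 <= r ^+ 2 by rewrite -real_normK ?num_real// lerXn2r// nnegrE.
have b2 : b ^+ 2 <= r ^+ 2 by rewrite -real_normK ?num_real// lerXn2r// nnegrE.
have -> : expR a * cos b - 1 - a = (expR a - 1 - a) + expR a * (cos b - 1) by ring.
have -> : expR a * sin b - b = expR a * (sin b - b) + b * (expR a - 1) by ring.
have h1 : `|expR a - 1 - a| <= r ^+ 2 * expR r.
  apply: le_trans (norm_expRB1B_le a) _.
  by apply: ler_pM; rewrite ?sqr_ge0 ?expR_ge0.
have h2 : `|expR a * (cos b - 1)| <= r ^+ 2 * expR r.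
  rewrite normrM mulrC; apply: ler_pM => //.
    exact: le_trans (norm_cosB1_le_sqr b) _.
  by rewrite ger0_norm ?expR_ge0.
have h3 : `|expR a * (sin b - b)| <= r ^+ 2 * expR r.
  rewrite normrM mulrC; apply: ler_pM => //.
    exact: le_trans (norm_sinB_le b) _.
  by rewrite ger0_norm ?expR_ge0.
have h4 : `|b * (expR a - 1)| <= r ^+ 2 * expR r.
  rewrite normrM expr2 -mulrA; apply: ler_pM => //.
  apply: le_trans (norm_expRB1_le a) _.
  by apply: ler_pM; rewrite ?expR_ge0.
have := ler_normD (expR a - 1 - a) (expR a * (cos b - 1)).
have := ler_normD (expR a * (sin b - b)) (b * (expR a - 1)).
lra.
Qed.

Lemma near_dnbhs_cnorm {R : realType} (e : R) : 0 < e ->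
  \forall h \near (0 : R[i]^o)^', h != 0 /\ cnorm h < e.
Proof.
move=> e0; near=> h; split; first by near: h; exact: (@nbhs_dnbhs_neq R[i]^o 0).
have : `|h| < e%:C.
  by near: h; apply: nbhs_dnbhs; apply: (@nbhs0_lt _ R[i]^o); rewrite ltcR.
by rewrite norm_cnormE ltcR.
Unshelve. all: by end_near. Qed.

Lemma cvg_cnorm_dnbhs0 {R : realType} :
  cnorm h @[h --> (0 : R[i]^o)^'] --> (0 : R).
Proof.
apply/cvgrPdist_lt => e e0; have := near_dnbhs_cnorm e e0; apply: filterS => h [_ he].
by rewrite sub0r normrN ger0_norm// cnorm_ge0.
Qed.

Lemma derivable_cvgP {R : realType} (F : R[i] -> R[i]) (z G : R[i]) (K : R) :
  (forall h, h != 0 -> cnorm h < 1 ->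
    cnorm ((F (h + z) - F z) / h - G) <= K * cnorm h) ->
  derivable (F : R[i]^o -> R[i]^o) z 1.
Proof.
move=> H; apply/cvg_ex; exists (G : R[i]^o); apply/cvg_cnormP.
apply: (@squeeze_cvgr _ (0 : R[i]^o)^' _ _ (fun=> 0) (fun h => K * cnorm h)).
- near=> h.
  have [h0 h1] : h != 0 /\ cnorm h < 1 by near: h; exact: near_dnbhs_cnorm.
  rewrite cnorm_ge0/=; have := H h h0 h1.
  by rewrite /GRing.scale/= mulr1 mulrC.
- exact: cvg_cst.
- by rewrite -(mulr0 K); apply: cvgM; [exact: cvg_cst|exact: cvg_cnorm_dnbhs0].
Unshelve. all: by end_near. Qed.

(* Differentiation under the integral sign, with the remainder of the
   exponential bounded uniformly for |h| < 1. *)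
Lemma entire_mellin {R : realType} (A : set R) (u : R -> R[i]) (l : R -> R) :
  measurable A -> cmeasurable A u -> measurable_fun A l ->
  (forall p : R, (\int[mu]_(x in A) (cnorm (u x) * expR (p * `|l x|))%:E < +oo)%E) ->
  entire (fun s => cintegral A (fun x => u x * cexp (s * (l x)%:C))).
Proof.
move=> mA mu' ml fin z.
have mln : measurable_fun A (fun x => `|l x|) by exact: measurableT_comp.
have mn := measurable_cnorm _ _ mu'.
have mv (c p : R) : measurable_fun A (fun x => c * (cnorm (u x) * expR (p * `|l x|))).
  apply: measurable_funM => //; apply: measurable_funM => //.
  by apply: measurableT_comp => //; exact: measurable_funM.
have finc (c p : R) : 0 <= c ->
    (\int[mu]_(x in A) (c * (cnorm (u x) * expR (p * `|l x|)))%:E < +oo)%E.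
  move=> c0; under eq_integral do rewrite EFinM.
  rewrite ge0_integralZl ?lee_fin//.
  - exact: lte_mul_pinfty.
  - by apply/measurable_EFinP; have := mv 1 p; under eq_fun do rewrite mul1r.
  - by move=> x _; rewrite lee_fin mulr_ge0 ?cnorm_ge0 ?expR_ge0.
have ml' := cmeasurable_real _ _ ml.
have me s : cmeasurable A (fun x => cexp (s * (l x)%:C)).
  by apply: cmeasurable_cexp => //; apply: cmeasurableM => //; exact: cmeasurable_cst.
have ne (s : R[i]) x : cnorm (cexp (s * (l x)%:C)) <= expR (`|complex.Re s| * `|l x|).
  by rewrite cnorm_cexp cReM /= mulr0 subr0 ler_expR -normrM ler_norm.
have iu s : cintegrable A (fun x => u x * cexp (s * (l x)%:C)).
  apply: (@cintegrable_bound _ _ _ (fun x => 1 * (cnorm (u x) * expR (`|complex.Re s| * `|l x|)))) => //.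
  - exact: cmeasurableM.
  - by move=> x _; rewrite mul1r cnormM ler_wpM2l ?cnorm_ge0.
  - exact: finc.
have ler1 (y : R) : 0 <= y -> y <= expR y.
  by move=> y0; have := expR_ge1Dx y; lra.
have il : cintegrable A (fun x => u x * cexp (z * (l x)%:C) * (l x)%:C).
  apply: (@cintegrable_bound _ _ _
    (fun x => 1 * (cnorm (u x) * expR ((`|complex.Re z| + 1) * `|l x|)))) => //.
  - by do 2 apply: cmeasurableM => //.
  - move=> x _; rewrite mul1r !cnormM -mulrA ler_wpM2l ?cnorm_ge0//.
    rewrite mulrDl mul1r expRD cnormR; apply: ler_pM => //; rewrite ?cnorm_ge0//.
    exact: ler1.
  - exact: finc.
pose v x : R := 4 * (cnorm (u x) * expR ((`|complex.Re z| + 3) * `|l x|)).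
apply: (@derivable_cvgP _ _ _ (cintegral A (fun x => u x * cexp (z * (l x)%:C) * (l x)%:C))
  (2 * \int[mu]_(x in A) v x)) => h h0 h1.
pose w (h : R[i]) x := h^-1 * (u x * cexp ((h + z) * (l x)%:C)) +
  (- h^-1 * (u x * cexp (z * (l x)%:C)) +
   - 1 * (u x * cexp (z * (l x)%:C) * (l x)%:C)).
have iw : cintegrable A (w h).
  apply: cintegrableD => //; first exact: cintegrableZl.
  by apply: cintegrableD => //; exact: cintegrableZl.
have -> : (cintegral A (fun x => u x * cexp ((h + z) * (l x)%:C)) -
    cintegral A (fun x => u x * cexp (z * (l x)%:C))) / h -
    cintegral A (fun x => u x * cexp (z * (l x)%:C) * (l x)%:C) = cintegral A (w h).
  rewrite /w cintegralD//; first last.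
  - by apply: cintegrableD => //; exact: cintegrableZl.
  - exact: cintegrableZl.
  rewrite cintegralD//; try exact: cintegrableZl.
  by rewrite !cintegralZl//; ring.
have wv x : cnorm (w h x) <= v x * cnorm h.
  have -> : w h x = h^-1 * (u x * cexp (z * (l x)%:C) *
      (cexp (h * (l x)%:C) - 1 - h * (l x)%:C)).
    by rewrite /w mulrDl cexpD; field.
  have := cnorm_cexpB1B_le (h * (l x)%:C); rewrite cnormM cnormR => H.
  have hn0 : 0 < cnorm h by rewrite lt_def cnorm_eq0 h0 cnorm_ge0.
  rewrite !cnormM cnormV ler_pdivrMl// /v.
  have l0 : 0 <= `|l x| by [].
  have el : (cnorm h * `|l x|) ^+ 2 * expR (cnorm h * `|l x|) <=
       cnorm h ^+ 2 * expR (3 * `|l x|).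
    rewrite exprMn -mulrA ler_wpM2l ?sqr_ge0//.
    have -> : 3 * `|l x| = `|l x| *+ 2 + `|l x| by rewrite -mulr_natl; ring.
    rewrite expRD; apply: ler_pM; rewrite ?sqr_ge0 ?expR_ge0//.
      by rewrite -mulr_natl expRM_natl lerXn2r ?nnegrE ?expR_ge0// ler1.
    by rewrite ler_expR ler_piMl// ltW.
  apply: (@le_trans _ _ (cnorm (u x) * expR (`|complex.Re z| * `|l x|) *
      (4 * (cnorm h ^+ 2 * expR (3 * `|l x|))))).
    apply: ler_pM => //; rewrite ?mulr_ge0 ?cnorm_ge0//.
      by rewrite ler_wpM2l ?cnorm_ge0.
    by apply: le_trans H _; rewrite -mulrA ler_wpM2l.
  have -> : expR ((`|complex.Re z| + 3) * `|l x|) =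
      expR (`|complex.Re z| * `|l x|) * expR (3 * `|l x|) by rewrite mulrDl expRD.
  by rewrite le_eqVlt; apply/orP; left; apply/eqP; ring.
apply: le_trans (@cnorm_cintegral_le _ A (w h) (fun x => v x * cnorm h) mA iw _ _ _) _.
- by apply: measurable_funM => //; exact: mv.
- by move=> x _; exact: wv.
- have c0 : 0 <= 4 * cnorm h by rewrite mulr_ge0 ?cnorm_ge0.
  apply: le_lt_trans (finc _ (`|complex.Re z| + 3) c0); rewrite le_eqVlt.
  by apply/orP; left; apply/eqP; apply: eq_integral => x _; congr EFin; rewrite /v; ring.
rewrite RintegralZr ?mulrA//; apply/integrableP; split.
  by apply/measurable_EFinP; exact: mv.
apply: le_lt_trans (finc 4 (`|complex.Re z| + 3) _) => //.
rewrite le_eqVlt; apply/orP; left; apply/eqP; apply: eq_integral => x _.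
by rewrite /= ger0_norm// /v !mulr_ge0 ?cnorm_ge0 ?expR_ge0.
Qed.

(** * The incomplete gamma function under the Laplace transform *)

Definition gamma_kernel {R : realType} (k : int) (c y : R) : R :=
  \int[mu]_(t in Rpos R) (expR (- (c * (2 * t + 1)) * y) * ((1 + t) ^ k)^-1).

Lemma in_Rpos {R : realType} (x : R) : Rpos R x = (0 < x).
Proof. by rewrite /= in_itv/= andbT. Qed.

Lemma measurable_oneD_exprzV {R : realType} (k : int) :
  measurable_fun (Rpos R) (fun t : R => ((1 + t) ^ k)^-1).
Proof.
apply: (eq_measurable_fun (fun t : R => expR ((- k)%:~R * ln (1 + t)))).
  move=> x; rewrite inE in_Rpos => x0.
  by rewrite invr_expz exprz_expR_ln// addr_gt0.
apply: measurable_funTS; apply: measurableT_comp => //.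
apply: measurable_funM => //; apply: (measurableT_comp (@measurable_ln R)).
exact: measurable_funD.
Qed.

Lemma integrable_gamma_kernel {R : realType} (k : int) (c y : R) : 0 < c -> 0 < y ->
  mu.-integrable (Rpos R)
    (fun t => (expR (- (c * (2 * t + 1)) * y) * ((1 + t) ^ k)^-1)%:E).
Proof.
move=> c0 y0; have X0 : 0 < 2 * c * y by rewrite !mulr_gt0.
rewrite (_ : (fun t => _) = (fun t => (expR (- (c * y)))%:E *
    (expR (- (2 * c * y) * t) * ((1 + t) ^ k)^-1)%:E)%E).
  by apply: integrableZl => //; exact: integrable_expRN_exprzV.
apply/funext => t; rewrite -EFinM mulrA -expRD; congr ((expR _ * _)%:E); ring.
Qed.

Lemma gamma_kernel_ge0 {R : realType} (k : int) (c y : R) : 0 <= gamma_kernel k c y.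
Proof.
apply: Rintegral_ge0 => t; rewrite in_Rpos => t0.
by rewrite mulr_ge0 ?expR_ge0// invr_ge0 exprz_ge0// addr_ge0// ltW.
Qed.

Lemma inc_gamma_expR {R : realType} (k : int) (c y : R) : 0 < c -> 0 < y ->
  inc_gamma (1 - k) (2 * c * y) * expR (c * y) =
  (2 * c) ^ (1 - k) * (y ^ (1 - k) * gamma_kernel k c y).
Proof.
move=> c0 y0; have X0 : 0 < 2 * c * y by rewrite !mulr_gt0.
rewrite inc_gammaE// expfzMl /gamma_kernel.
have -> : \int[mu]_(t in Rpos R) (expR (- (c * (2 * t + 1)) * y) * ((1 + t) ^ k)^-1) =
    expR (- (c * y)) * \int[mu]_(t in Rpos R) (expR (- (2 * c * y) * t) * ((1 + t) ^ k)^-1).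
  rewrite -RintegralZl//; last exact: integrable_expRN_exprzV.
  apply: eq_Rintegral => t _; rewrite mulrA -expRD; congr (expR _ * _); ring.
have -> : expR (- (2 * c * y)) = expR (- (c * y)) * expR (- (c * y)).
  by rewrite -expRD; congr expR; ring.
have E : expR (- (c * y)) * expR (c * y) = 1 by rewrite -expRD addNr expR0.
set e := expR (- (c * y)) in E *; set e' := expR (c * y) in E *.
set I := \int[_]_(_ in _) _.
transitivity ((2 * c) ^ (1 - k) * y ^ (1 - k) * e * (e * e') * I); first ring.
rewrite E; ring.
Qed.

Lemma measurable_gamma_integrand {R : realType} (c : R) :
  measurable_fun setT (fun z : R * R => expR (- (c * (2 * z.1 + 1)) * z.2)).
Proof.
apply: measurableT_comp => //; apply: measurable_funM; last exact: measurable_snd.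
apply: measurableT_comp => //; apply: measurable_funM => //.
apply: measurable_funD => //; apply: measurable_funM => //.
Qed.

Lemma measurable_gamma_kernel {R : realType} (k : int) (c : R) :
  measurable_fun setT (gamma_kernel k c).
Proof.
pose p : R -> R := (fun t => ((1 + t) ^ k)^-1) \_ (Rpos R).
have mp : measurable_fun setT p.
  by apply/(measurable_restrictT _ _).1 => //; exact: measurable_oneD_exprzV.
pose f (z : R * R) := (expR (- (c * (2 * z.1 + 1)) * z.2) * p z.1)%:E.
have mf : measurable_fun setT f.
  apply/measurable_EFinP; apply: measurable_funM.
    exact: measurable_gamma_integrand.
  exact: (measurableT_comp mp measurable_fst).
have f0 z : (0 <= f z)%E.
  rewrite /f lee_fin mulr_ge0 ?expR_ge0// /p patchE; case: ifPn => //.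
  by rewrite inE in_Rpos => z0; rewrite invr_ge0 exprz_ge0// addr_ge0// ltW.
have -> : gamma_kernel k c = fine \o (fubini_G mu f).
  apply/funext => y; rewrite /gamma_kernel /Rintegral /fubini_G/=; congr fine.
  rewrite integral_mkcond; apply: eq_integral => t _; rewrite /f /p/= !patchE.
  by case: ifP => //; rewrite mulr0.
apply: (measurableT_comp (fine_measurable _)) => //.
exact: measurable_fun_fubini_tonelli_G.
Qed.

Lemma tonelli_gamma_kernel {R : realType} (k : int) (c : R) (w : R -> R) : 0 < c ->
  measurable_fun (Rpos R) w -> (forall x, 0 < x -> 0 <= w x) ->
  (\int[mu]_(t in Rpos R)
     (laplace_nng w (c * (2 * t + 1))%R * ((1 + t) ^ k)^-1%:E) =
   \int[mu]_(y in Rpos R) (w y * gamma_kernel k c y)%:E)%E.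
Proof.
move=> c0 mw w0.
transitivity (\int[mu]_(t in Rpos R) \int[mu]_(x in Rpos R)
    (expR (- (c * (2 * t + 1)) * x) * ((1 + t) ^ k)^-1 * w x)%:E)%E.
  apply: eq_integral => t; rewrite inE in_Rpos => t0.
  have p0 : 0 <= ((1 + t) ^ k)^-1 by rewrite invr_ge0 exprz_ge0// addr_ge0// ltW.
  rewrite /laplace_nng muleC -ge0_integralZl//.
  - by apply: eq_integral => x _; rewrite -EFinM; congr EFin; ring.
  - apply/measurable_EFinP; apply: measurable_funM => //; exact: measurable_expRM.
  - move=> x; rewrite in_Rpos => x0.
    by rewrite lee_fin mulr_ge0 ?expR_ge0 ?w0.
rewrite (@tonelli_kernel _ _ (fun t x => expR (- (c * (2 * t + 1)) * x))
    (fun t => ((1 + t) ^ k)^-1) w)//; last first.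
- by move=> x; rewrite in_Rpos => /w0.
- by move=> t; rewrite in_Rpos => t0; rewrite invr_ge0 exprz_ge0// addr_ge0// ltW.
- exact: measurable_oneD_exprzV.
- exact: measurable_gamma_integrand.
apply: eq_integral => x; rewrite inE in_Rpos => x0.
have ik := integrable_gamma_kernel k c x c0 x0.
rewrite EFinM /gamma_kernel /Rintegral fineK; last exact: integrable_fin_num.
rewrite -integralZl//; apply: eq_integral => t _; rewrite -EFinM; congr EFin; ring.
Qed.

Lemma fubini_gamma_kernel {R : realType} (k : int) (c : R) (w : R -> R) : 0 < c ->
  measurable_fun (Rpos R) w ->
  (forall s, 0 < s -> mu.-integrable (Rpos R) (fun x => (expR (- s * x) * w x)%:E)) ->
  (\int[mu]_(y in Rpos R) (`|w y| * gamma_kernel k c y)%:E < +oo)%E ->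
  \int[mu]_(t in Rpos R) (((1 + t) ^ k)^-1 *
     \int[mu]_(x in Rpos R) (expR (- (c * (2 * t + 1)) * x) * w x)) =
  \int[mu]_(y in Rpos R) (w y * gamma_kernel k c y).
Proof.
move=> c0 mw iw fin.
have mn : measurable_fun (Rpos R) (fun x => `|w x|) by exact: measurableT_comp.
rewrite (@fubini_kernel _ _ (fun t x => expR (- (c * (2 * t + 1)) * x))
    (fun t => ((1 + t) ^ k)^-1) w)//.
- exact: measurable_gamma_integrand.
- exact: measurable_oneD_exprzV.
- by move=> t; rewrite in_Rpos => t0; rewrite invr_ge0 exprz_ge0// addr_ge0// ltW.
- move=> t; rewrite in_Rpos => t0; apply: iw.
  by rewrite mulr_gt0// addr_gt0// mulr_gt0.
- by move=> x; rewrite in_Rpos => x0; exact: integrable_gamma_kernel.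
- move: fin; rewrite -(tonelli_gamma_kernel k c)//; apply: le_lt_trans.
  rewrite le_eqVlt; apply/orP; left; apply/eqP.
  apply: eq_integral => t; rewrite inE in_Rpos => t0.
  have p0 : 0 <= ((1 + t) ^ k)^-1 by rewrite invr_ge0 exprz_ge0// addr_ge0// ltW.
  rewrite /laplace_nng muleC -ge0_integralZl//.
  + by apply: eq_integral => x _; rewrite -EFinM; congr EFin; ring.
  + apply/measurable_EFinP; apply: measurable_funM => //; exact: measurable_expRM.
Qed.

Lemma laplaceR {R : realType} (phi : R -> R[i]) (s : R) :
  laplace phi s%:C =
    (\int[mu]_(x in Rpos R) (expR (- s * x) * complex.Re (phi x))) +i*
    (\int[mu]_(x in Rpos R) (expR (- s * x) * complex.Im (phi x))).
Proof.
rewrite /laplace /cintegral; apply: cpx_eqP => /=; apply: eq_Rintegral => x _.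
  by rewrite -rmorphN -rmorphM cexpR Re_mulC.
by rewrite -rmorphN -rmorphM cexpR Im_mulC.
Qed.

Lemma cintegral_gamma_kernel {R : realType} (k : int) (c : R) (w : R -> R[i]) :
  0 < c -> (forall s, 0 < complex.Re s -> laplace_cvg w s) ->
  cmeasurable (Rpos R) w ->
  (\int[mu]_(y in Rpos R) (cnorm (w y) * gamma_kernel k c y)%:E < +oo)%E ->
  cintegral (Rpos R) (fun t => laplace w (c * (2 * t + 1))%:C / ((1 + t) ^ k)%:C) =
  cintegral (Rpos R) (fun y => (gamma_kernel k c y)%:C * w y).
Proof.
move=> c0 lw [mr mi] fin.
have mn := measurable_cnorm _ _ (conj mr mi).
have mJ := measurable_gamma_kernel k c.
have h (v : R -> R) : (forall x, `|v x| <= cnorm (w x)) ->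
    measurable_fun (Rpos R) v ->
    (\int[mu]_(y in Rpos R) (`|v y| * gamma_kernel k c y)%:E < +oo)%E.
  move=> vw mv; apply: le_lt_trans fin.
  have mnv : measurable_fun (Rpos R) (fun y => `|v y|) by exact: measurableT_comp.
  apply: ge0_le_integral => //.
  - by move=> x _; rewrite lee_fin mulr_ge0 ?gamma_kernel_ge0.
  - by apply/measurable_EFinP; apply: measurable_funM => //; exact: measurable_funTS.
  - by apply/measurable_EFinP; apply: measurable_funM => //; exact: measurable_funTS.
  - by move=> x _; rewrite lee_fin ler_wpM2r ?gamma_kernel_ge0.
have iw (v : R -> R) (p : R[i] -> R) : (forall (x : R) z, p (x%:C * z) = x * p z) ->
    (forall s : R[i], 0 < complex.Re s ->
      mu.-integrable (Rpos R) (fun x => (p (cexp (- s * x%:C) * w x))%:E)) ->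
    (forall x, v x = p (w x)) ->
    forall s, 0 < s -> mu.-integrable (Rpos R) (fun x => (expR (- s * x) * v x)%:E).
  move=> pl ip vE s s0; have := ip s%:C s0; congr (integrable _ _ _).
  by apply/funext => x; rewrite -rmorphN -rmorphM cexpR pl vE.
rewrite /cintegral; congr (_ +i* _).
  under [RHS]eq_Rintegral do rewrite Re_mulC mulrC.
  rewrite -(@fubini_gamma_kernel _ k c (fun x => complex.Re (w x)))//; last first.
  - by apply: h => // x; exact: Re_le_cnorm.
  - apply: (iw _ (@complex.Re R)) => //; first exact: Re_mulC.
    by move=> s s0; have [] := lw s s0.
  apply: eq_Rintegral => t _.
  by rewrite laplaceR -fmorphV mulrC Re_mulC.
under [RHS]eq_Rintegral do rewrite Im_mulC mulrC.
rewrite -(@fubini_gamma_kernel _ k c (fun x => complex.Im (w x)))//; last first.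
- by apply: h => // x; exact: Im_le_cnorm.
- apply: (iw _ (@complex.Im R)) => //; first exact: Im_mulC.
  by move=> s s0; have [] := lw s s0.
apply: eq_Rintegral => t _.
by rewrite laplaceR -fmorphV mulrC Im_mulC.
Qed.

(** * The L-map as an integral along the imaginary axis *)

Lemma exp_term_imag {R : realType} (n : int) (y : R) :
  exp_term n (y *i) = (expR (- (2 * pi * n%:~R) * y))%:C.
Proof.
rewrite -cexpR /exp_term; congr cexp; rewrite intC [2]natC -!rmorphM.
by apply: cpx_eqP; rewrite ?cReM ?cImM /=; ring.
Qed.

Lemma idx_negE {R : realType} (j : nat) : (idx_neg j)%:~R = - (j.+1%:R : R).
Proof. by rewrite /idx_neg mulrNz. Qed.

Lemma series_shift0 {V : zmodType} (w : nat -> V) (d n : nat) :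
  (forall i, (i < d)%N -> w i = 0) ->
  series w (n + d)%N = series (fun i => w (i + d)%N) n.
Proof.
move=> w0; rewrite /series/= (@big_cat_nat _ _ _ d)//=; last exact: leq_addl.
rewrite big_nat big1 => [|i /andP[_ /w0]//]; rewrite add0r.
by rewrite -{1}(add0n d) big_addn addnK.
Qed.

Lemma series_idx_ge {R : realType} (w : int -> R[i]) (p q : nat) (A : R[i]) :
  (forall n, n < - p%:Z -> w n = 0) -> (forall n, n < - q%:Z -> w n = 0) ->
  (series (fun j => w (idx_ge p j)) : nat -> R[i]^o) @ \oo --> (A : R[i]^o) ->
  (series (fun j => w (idx_ge q j)) : nat -> R[i]^o) @ \oo --> (A : R[i]^o).
Proof.
move=> wp wq cv.
have E (m d n : nat) : (forall n, n < - m%:Z -> w n = 0) ->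
    series (fun j => w (idx_ge (m + d) j)) (n + d)%N =
    series (fun j => w (idx_ge m j)) n.
  move=> w0; rewrite series_shift0 => [|i id].
    congr (series _ n); apply/funext => i; congr w.
    by rewrite /idx_ge !PoszD; ring.
  have id' : (i%:Z < d%:Z)%R by rewrite ltz_nat.
  by apply: w0; rewrite /idx_ge !PoszD; lra.
have cvN : (series (fun j => w (idx_ge (p + q) j)) : nat -> R[i]^o) @ \oo --> (A : R[i]^o).
  rewrite -(cvg_shiftn q); apply: cvg_trans cv; apply: near_eq_cvg; apply: nearW => n /=.
  by rewrite E.
rewrite addnC in cvN; move: cvN; rewrite -(cvg_shiftn p); apply: cvg_trans.
by apply: near_eq_cvg; apply: nearW => n /=; rewrite E.
Qed.

Lemma fourier_expansion_shift {R : realType} (k : int) (p q : nat)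
    (a b : int -> R[i]) (h : R[i] -> R[i]) :
  fourier_expansion k p a b h -> (forall n, n < - q%:Z -> a n = 0) ->
  fourier_expansion k q a b h.
Proof.
move=> [ap hh] aq; split; first exact: aq.
move=> z /hh[A [B [cA cB hAB]]]; exists A, B; split; [|exact: cB|exact: hAB].
apply: (series_idx_ge (fun n => a n * exp_term n z) p q A _ _ cA).
  by move=> n /ap ->; rewrite mul0r.
by move=> n /aq ->; rewrite mul0r.
Qed.

Lemma complex_hausdorff {R : realType} : hausdorff_space (R[i]^o : topologicalType).
Proof. exact: norm_hausdorff. Qed.

Lemma eq_cintegrable {R : realType} (A : set R) (u v : R -> R[i]) :
  measurable A -> {in A, u =1 v} -> cintegrable A u -> cintegrable A v.
Proof.
move=> mA uv [ur ui]; split.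
  by apply: eq_integrable ur => // x xA; rewrite uv.
by apply: eq_integrable ui => // x xA; rewrite uv.
Qed.

Lemma Lmap_eq {R : realType} (k : int) (n0 : nat) (a b : int -> R[i])
    (h : R[i] -> R[i]) (phi : R -> R[i]) :
  fourier_expansion k n0 a b h -> test_fun k n0 a b phi ->
  cintegrable (Rpos R) (fun y => h (y *i) * phi y) /\
  Lmap k n0 a b phi = cintegral (Rpos R) (fun y => h (y *i) * phi y).
Proof.
move=> [_ hh] [_ lphi lw fin].
have mD : measurable (Rpos R) by exact: measurable_itv.
have mphi : cmeasurable (Rpos R) phi.
  have /cintegrable_cmeasurable : laplace_cvg phi 0.
    by apply: lphi; rewrite /= !mulNr oppr_le0 !mulr_ge0 ?pi_ge0.
  by apply: eq_cmeasurable => x _; rewrite oppr0 mul0r cexp0 mul1r.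
pose w := twist phi (2 - k)%:~R.
have wE y : 0 < y -> w y = (y ^ (1 - k))%:C * phi y.
  move=> y0; rewrite /w /twist mulrC; congr (_ * _).
  rewrite -cpow_int//; congr cpow; rewrite -[1]/(1%:~R) -intrB; congr (_%:~R); ring.
have mw : cmeasurable (Rpos R) w.
  apply: (@eq_cmeasurable _ _ (fun y => (y ^ (1 - k))%:C * phi y)).
    by move=> y; rewrite inE in_Rpos => /wE ->.
  by apply: cmeasurableM => //; apply: cmeasurable_real; exact: measurable_exprz_pos.
pose c j : R := 2 * pi * j.+1%:R.
have c0 j : 0 < c j by rewrite !mulr_gt0// pi_gt0.
pose sa j : R := 2 * pi * (idx_ge n0 j)%:~R.
have sa_ge j : - 2 * pi * n0%:R <= complex.Re (sa j)%:C.
  rewrite /= /sa !mulNr -mulrN ler_wpM2l ?mulr_ge0 ?pi_ge0//.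
  by rewrite /idx_ge intrB lerDr.
pose fa j y := a (idx_ge n0 j) * (cexp (- (sa j)%:C * y%:C) * phi y).
pose fb j y := b (idx_neg j) * ((2 * c j) ^ (1 - k))%:C *
  ((gamma_kernel k (c j) y)%:C * w y).
pose Sa y := limn (series (fun j => a (idx_ge n0 j) * exp_term (idx_ge n0 j) (y *i)) : nat -> R[i]^o).
pose Sb y := limn (series (fun j => b (idx_neg j) *
            (inc_gamma (1 - k) (- 4 * pi * (idx_neg j)%:~R * complex.Im (y *i)))%:C *
            exp_term (idx_neg j) (y *i)) : nat -> R[i]^o).
have hS y : 0 < y -> [/\
   (series (fun j => a (idx_ge n0 j) * exp_term (idx_ge n0 j) (y *i)) : nat -> R[i]^o) @ \oo --> (Sa y : R[i]^o),
   (series (fun j => b (idx_neg j) *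
            (inc_gamma (1 - k) (- 4 * pi * (idx_neg j)%:~R * complex.Im (y *i)))%:C *
            exp_term (idx_neg j) (y *i)) : nat -> R[i]^o) @ \oo --> (Sb y : R[i]^o) &
   h (y *i) = Sa y + Sb y].
  move=> y0; have [//|A [B [cA cB hAB]]] := hh (y *i).
  rewrite /Sa /Sb (cvg_lim (@complex_hausdorff R) cA) (cvg_lim (@complex_hausdorff R) cB).
  by split; [exact: cA|exact: cB|exact: hAB].
have seriesMr (u : nat -> R[i]) (S v : R[i]) :
    (series u : nat -> R[i]^o) @ \oo --> (S : R[i]^o) ->
    (series (fun j => u j * v) : nat -> R[i]^o) @ \oo --> (S * v : R[i]^o).
  move=> uS; have -> : series (fun j => u j * v) = (fun n => series u n * v).
    by apply/funext => n; rewrite /series/= mulr_suml.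
  by apply: (@cvgMl _ _ _ _ (series u : nat -> R[i]^o)).
have lapl_nngE (u : R -> R[i]) s :
    (\int[mu]_(y in Rpos R) (cnorm (cexp (- s%:C * y%:C) * u y))%:E =
     laplace_nng (fun y => cnorm (u y)) s)%E.
  by apply: eq_integral => y _; rewrite cnormM cnorm_cexp -rmorphN -rmorphM.
move: fin; rewrite /Lmap_abs; set S1 := (\sum_(_ <= _ <oo) _)%E.
set S2 := (\sum_(_ <= _ <oo) _)%E => fin.
have gk0 j y : 0 <= gamma_kernel k (c j) y by exact: gamma_kernel_ge0.
have mgk j : measurable_fun (Rpos R) (gamma_kernel k (c j)).
  by apply: measurable_funTS; exact: measurable_gamma_kernel.
have lnng0 (u : R -> R[i]) s : (0 <= laplace_nng (fun y => cnorm (u y)) s)%E.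
  by apply: integral_ge0 => y _; rewrite lee_fin mulr_ge0 ?expR_ge0 ?cnorm_ge0.
have S1_ge0 : (0 <= S1)%E.
  by apply: nneseries_ge0 => j _ _; rewrite mule_ge0 ?lee_fin ?cnorm_ge0.
have coef0 j : 0 <= (- 4 * pi * (idx_neg j)%:~R : R) ^ (1 - k).
  by rewrite exprz_ge0// idx_negE mulrN !mulNr opprK !mulr_ge0 ?pi_ge0.
have S2_ge0 : (0 <= S2)%E.
  apply: nneseries_ge0 => j _ _; rewrite mule_ge0 ?lee_fin ?mulr_ge0 ?cnorm_ge0//.
  apply: integral_ge0 => t; rewrite in_Rpos => t0.
  by rewrite mule_ge0// lee_fin invr_ge0 exprz_ge0// addr_ge0// ltW.
have fin1 : (S1 < +oo)%E by apply: le_lt_trans fin; rewrite leeDl.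
have fin2 : (S2 < +oo)%E by apply: le_lt_trans fin; rewrite leeDr.
have cE j : - 4 * pi * (idx_neg j)%:~R = 2 * c j :> R.
  by rewrite idx_negE /c; ring.
have cE' j t : - 2 * pi * (idx_neg j)%:~R * (2 * t + 1) = c j * (2 * t + 1) :> R.
  by rewrite idx_negE /c; ring.
have mw' := measurable_cnorm _ _ mw.
have bterm_nng j : (\int[mu]_(y in Rpos R) (cnorm (fb j y))%:E =
    (cnorm (b (idx_neg j)) * (- 4 * pi * (idx_neg j)%:~R) ^ (1 - k))%:E *
      \int[mu]_(t in Rpos R)
        (laplace_nng (fun x => cnorm (w x))
           (- 2 * pi * (idx_neg j)%:~R * (2 * t + 1))%R * ((1 + t) ^ k)^-1%:E))%E.
  under [in RHS]eq_integral do rewrite cE'.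
  rewrite tonelli_gamma_kernel//; last by move=> x _; exact: cnorm_ge0.
  have mm : measurable_fun (Rpos R) (fun y : R => cnorm (w y) * gamma_kernel k (c j) y).
    by apply: measurable_funM; [exact: mw'|exact: mgk].
  rewrite -ge0_integralZl//.
  - apply: eq_integral => y _; rewrite -EFinM /fb !cnormM !cnormR cE.
    rewrite (ger0_norm (gk0 j y)) ger0_norm; last by rewrite exprz_ge0// mulr_ge0// ltW.
    congr EFin; ring.
  - exact/measurable_EFinP.
  - by move=> y _; rewrite lee_fin mulr_ge0 ?cnorm_ge0.
  - by rewrite lee_fin mulr_ge0 ?cnorm_ge0.
have mfa j : cmeasurable (Rpos R) (fa j).
  apply: cmeasurableM; first exact: cmeasurable_cst.
  apply: cmeasurableM => //; apply: cmeasurable_cexp => //.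
  apply: cmeasurableM; first exact: cmeasurable_cst.
  by apply: cmeasurable_real; exact: measurable_id.
have mfb j : cmeasurable (Rpos R) (fb j).
  apply: cmeasurableM; first exact: cmeasurable_cst.
  by apply: cmeasurableM => //; exact: cmeasurable_real.
have [iA cA] : cintegrable (Rpos R) (fun y => Sa y * phi y) /\
   ((series (fun j => cintegral (Rpos R) (fa j)) : nat -> R[i]^o) @ \oo -->
    (cintegral (Rpos R) (fun y => Sa y * phi y) : R[i]^o)).
  apply: cseries_dominated; [exact: mD|by []| |].
    move: fin1; congr (_ < _)%E; apply: eq_eseriesr => j _.
    rewrite /fa; under [in RHS]eq_integral do rewrite cnormM EFinM.
    rewrite ge0_integralZl ?lee_fin ?cnorm_ge0//.
    - by rewrite lapl_nngE.
    - apply/measurable_EFinP; apply: measurable_cnorm; apply: cmeasurableM => //.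
      apply: cmeasurable_cexp => //; apply: cmeasurableM; first exact: cmeasurable_cst.
      by apply: cmeasurable_real; exact: measurable_id.
    - by move=> x _; rewrite lee_fin cnorm_ge0.
  move=> y; rewrite in_Rpos => /hS[cA _ _].
  have -> : (fa ^~ y) =
      (fun j => a (idx_ge n0 j) * exp_term (idx_ge n0 j) (y *i) * phi y).
    apply/funext => j; rewrite /fa exp_term_imag -mulrA; congr (_ * (_ * _)).
    by rewrite -rmorphN -rmorphM cexpR.
  exact: (seriesMr _ _ (phi y) cA).
have [iB cB] : cintegrable (Rpos R) (fun y => Sb y * phi y) /\
   ((series (fun j => cintegral (Rpos R) (fb j)) : nat -> R[i]^o) @ \oo -->
    (cintegral (Rpos R) (fun y => Sb y * phi y) : R[i]^o)).
  apply: cseries_dominated; [exact: mD|by []| |].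
    by move: fin2; congr (_ < _)%E; apply: eq_eseriesr => j _; rewrite bterm_nng.
  move=> y; rewrite in_Rpos => y0; have [_ cB _] := hS y y0.
  have -> : (fb ^~ y) = (fun j => b (idx_neg j) *
            (inc_gamma (1 - k) (- 4 * pi * (idx_neg j)%:~R * complex.Im (y *i)))%:C *
            exp_term (idx_neg j) (y *i) * phi y); last exact: (seriesMr _ _ (phi y) cB).
  apply/funext => j; rewrite /fb exp_term_imag wE// cE [complex.Im _]/=.
  have -> : - (2 * pi * (idx_neg j)%:~R) = c j :> R by rewrite idx_negE /c; ring.
  have H : (inc_gamma (1 - k) (2 * c j * y))%:C * (expR (c j * y))%:C =
      ((2 * c j) ^ (1 - k))%:C * ((y ^ (1 - k))%:C * (gamma_kernel k (c j) y)%:C).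
    by rewrite -!rmorphM inc_gamma_expR.
  rewrite -[in RHS](mulrA (b _)) H; ring.
split.
  have := cintegrableD _ _ _ mD iA iB.
  by apply: (eq_cintegrable _ _ _ mD) => y; rewrite inE in_Rpos => /hS[_ _ ->]; rewrite mulrDl.
rewrite (@eq_cintegral _ _ _ (fun y => Sa y * phi y + Sb y * phi y)); last first.
  by move=> y; rewrite inE in_Rpos => /hS[_ _ ->]; rewrite mulrDl.
rewrite cintegralD// /Lmap; congr (_ + _).
  rewrite -(cvg_lim (@complex_hausdorff R) cA); apply: (congr1 (fun u : nat -> R[i]^o => limn (series u))); apply/funext => j.
  rewrite /fa cintegralZl//; exact: lphi.
rewrite -(cvg_lim (@complex_hausdorff R) cB); apply: (congr1 (fun u : nat -> R[i]^o => limn (series u))); apply/funext => j.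
have [b0|b0] := eqVneq (b (idx_neg j)) 0.
  rewrite b0 !mul0r; rewrite (@eq_cintegral _ _ _ (fun=> 0 * 0)).
    rewrite cintegralZl ?mul0r//.
    by split; rewrite /=; exact: integrable0.
  by move=> y _; rewrite /fb b0 !mul0r.
have ifb : cintegrable (Rpos R) (fb j).
  apply: cintegrable_lty => //; rewrite bterm_nng; apply: le_lt_trans fin2.
  apply: le_trans (nneseries_lim_ge j.+1 _).
    rewrite big_nat_recr//= leeDr//; apply: sume_ge0 => i _.
    rewrite mule_ge0 ?lee_fin ?mulr_ge0 ?cnorm_ge0//.
    apply: integral_ge0 => t; rewrite in_Rpos => t0.
    by rewrite mule_ge0// lee_fin invr_ge0 exprz_ge0// addr_ge0// ltW.
  move=> i _ _; rewrite mule_ge0 ?lee_fin ?mulr_ge0 ?cnorm_ge0//.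
  apply: integral_ge0 => t; rewrite in_Rpos => t0.
  by rewrite mule_ge0// lee_fin invr_ge0 exprz_ge0// addr_ge0// ltW.
pose C := b (idx_neg j) * ((2 * c j) ^ (1 - k))%:C.
have C0 : C != 0.
  by rewrite mulf_neq0// (inj_eq (@complexI R)) gt_eqF// exprz_gt0// mulr_gt0.
have igk : cintegrable (Rpos R) (fun y => (gamma_kernel k (c j) y)%:C * w y).
  have := cintegrableZl _ C^-1 _ mD ifb.
  by apply: (eq_cintegrable _ _ _ mD) => y _; rewrite /fb mulKf.
rewrite [RHS]/cintegral -/(cintegral _ (fb j)) /fb cintegralZl// cE; congr (_ * _).
transitivity (cintegral (Rpos R) (fun t =>
    laplace w (c j * (2 * t + 1))%:C / ((1 + t) ^ k)%:C)).
  by apply: eq_cintegral => t _; rewrite cE'.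
apply: cintegral_gamma_kernel => //.
have := cintegrable_cnorm _ _ mD igk.
by congr (_ < _)%E; apply: eq_integral => y _; rewrite cnormM cnormR ger0_norm// mulrC.
Qed.

(** * Vanishing of coefficients below the growth order *)

Lemma sum_half_le1 {R : realType} (n : nat) : \sum_(0 <= j < n) (2^-1 ^+ j.+1 : R) <= 1.
Proof.
have -> : \sum_(0 <= j < n) (2^-1 ^+ j.+1 : R) = 1 - 2^-1 ^+ n.
  elim: n => [|n IHn]; first by rewrite big_geq// expr0 subrr.
  rewrite big_nat_recr//= IHn exprS; lra.
by rewrite gerBl exprn_ge0.
Qed.

Lemma cnorm_series_le {R : realType} (u : nat -> R[i]) (n : nat) :
  cnorm (series u n) <= \sum_(0 <= j < n) cnorm (u j).
Proof.
rewrite /series/=; elim: n => [|n IHn]; first by rewrite !big_geq// cnorm0.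
by rewrite !big_nat_recr//=; apply: le_trans (cnormD _ _) _; rewrite lerD2r.
Qed.

Lemma cnorm_series_geometric {R : realType} (u : nat -> R[i]) (U : R[i]) (K : R) :
  0 <= K -> (forall j, cnorm (u j) <= K * 2^-1 ^+ j.+1) ->
  (series u : nat -> R[i]^o) @ \oo --> (U : R[i]^o) -> cnorm U <= K.
Proof.
move=> K0 uK /cvg_cnormP cv; apply/ler_addgt0Pr => e e0.
have /cvgrPdist_lt/(_ e e0) [n _ H] := cv.
have {}H := H n (leqnn n); rewrite sub0r normrN ger0_norm ?cnorm_ge0// in H.
have -> : U = series u n + - (series u n - U) by ring.
apply: le_trans (cnormD _ _) _; rewrite cnormN; apply: lerD; last exact: ltW.
apply: le_trans (cnorm_series_le _ _) _.
apply: (@le_trans _ _ (K * \sum_(0 <= j < n) 2^-1 ^+ j.+1)).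
  by rewrite mulr_sumr; apply: ler_sum => j _.
by rewrite ler_piMr// sum_half_le1.
Qed.

Lemma cseries_bounded {R : realType} (u : nat -> R[i]) (U : R[i]) :
  (series u : nat -> R[i]^o) @ \oo --> (U : R[i]^o) ->
  exists2 M : R, 0 < M & forall j, cnorm (u j) <= M.
Proof.
move=> /cvg_cnormP/cvgrPdist_lt/(_ 1 ltr01) [N _ H].
have {}H n : (N <= n)%N -> cnorm (series u n - U) < 1.
  by move=> /H; rewrite sub0r normrN ger0_norm ?cnorm_ge0.
exists (2 + \sum_(0 <= j < N) cnorm (u j)).
  by rewrite ltr_wpDr// sumr_ge0// => j _; exact: cnorm_ge0.
move=> j; have [jN|jN] := ltnP j N.
  rewrite ler_wpDl// big_mkord (bigD1 (Ordinal jN))//= lerDl sumr_ge0// => i _.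
  exact: cnorm_ge0.
rewrite ler_wpDr//; first by rewrite sumr_ge0// => i _; exact: cnorm_ge0.
have -> : u j = (series u j.+1 - U) + - (series u j - U).
  by rewrite /series/= big_nat_recr//=; ring.
apply: le_trans (cnormD _ _) _; rewrite cnormN -[2]/(1 + 1).
by apply: lerD; apply: ltW; apply: H => //; exact: leqW.
Qed.

Lemma cvg_series_drop_term {R : realType} (u : nat -> R[i]) (A c : R[i]) (i : nat) :
  (series u : nat -> R[i]^o) @ \oo --> (A : R[i]^o) ->
  (series (fun j => if j == i then 0 else c * u j) : nat -> R[i]^o) @ \oo -->
    (c * A - c * u i : R[i]^o).
Proof.
move=> cA.
have c1 : ((fun n => c * series u n - c * u i) : nat -> R[i]^o) @ \oo -->
    (c * A - c * u i : R[i]^o).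
  apply: (@cvgB _ R[i]^o); last exact: cvg_cst.
  exact: (@cvgMr _ _ _ _ (series u : nat -> R[i]^o)).
apply: cvg_trans c1; apply: near_eq_cvg; near=> n.
have ni : (i < n)%N by near: n; exact: nbhs_infty_gt.
rewrite /series/= mulr_sumr !big_mkord [in LHS](bigD1 (Ordinal ni))//=.
rewrite [in RHS](bigD1 (Ordinal ni))//= eqxx add0r addrAC subrr add0r.
by apply: eq_bigr => j ji; rewrite ifN.
Unshelve. all: by end_near. Qed.

Lemma expRN_le_half {R : realType} (n : nat) (x : R) : n%:R <= x ->
  expR (- x) <= 2^-1 ^+ n.
Proof.
move=> nx; apply: (@le_trans _ _ (expR (- n%:R))); first by rewrite ler_expR lerN2.
rewrite -[n%:R]mulr1 -mulrN expRM_natl expRN lerXn2r ?nnegrE ?invr_ge0 ?expR_ge0//.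
by rewrite lef_pV2 ?posrE ?expR_gt0//; have := @expR_ge1Dx R 1; lra.
Qed.

Lemma gamma_kernel_decay {R : realType} (k : int) (c y : R) : 0 < c -> 2^-1 <= y ->
  gamma_kernel k c y <= expR (- (c * (y - 2^-1))) * gamma_kernel k c 2^-1.
Proof.
move=> c0 y12; have y0 : 0 < y by lra.
have h0 : 0 < (2^-1 : R) by lra.
have mD : measurable (Rpos R) by exact: measurable_itv.
have i1 := integrable_gamma_kernel k c y c0 y0.
have i2 := integrable_gamma_kernel k c _ c0 h0.
rewrite /gamma_kernel -RintegralZl//; apply: le_Rintegral => //.
  rewrite (_ : EFin \o _ = (fun t : R => (expR (- (c * (y - 2^-1))))%:E *
    (expR (- (c * (2 * t + 1)) / 2) * ((1 + t) ^ k)^-1)%:E)%E)//.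
  exact: integrableZl.
move=> t; rewrite in_Rpos => t0.
rewrite mulrA -expRD ler_wpM2r//.
  by rewrite invr_ge0 exprz_ge0// addr_ge0// ltW.
rewrite ler_expR.
have : 0 <= c * t * (y - 2^-1) by rewrite !mulr_ge0 ?subr_ge0 ?(ltW c0) ?(ltW t0).
lra.
Qed.

(* The first nonzero coefficient a(m) is the limit of h(iy) exp(2 pi m y) as
   y -> oo, which is 0 when m < - n0. *)
Lemma coef_vanish {R : realType} (k : int) (p n0 : nat) (a b : int -> R[i])
    (h : R[i] -> R[i]) :
  fourier_expansion k p a b h -> exp_bigO (2 * pi * n0%:R) h ->
  forall n, n < - n0%:Z -> a n = 0.
Proof.
move=> [ap hh] [M0 [Y hO]].
suff H i : idx_ge p i < - n0%:Z -> a (idx_ge p i) = 0.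
  move=> n nn0; have [np|np] := ltP n (- p%:Z); first exact: ap.
  have E : n = idx_ge p (absz (n + p%:Z)).
    by rewrite /idx_ge gez0_abs; [ring|lra].
  by rewrite E; apply: H; rewrite -E.
elim/ltn_ind: i => i IH im.
have pi1 : (1 : R) <= pi by have := @pi_ge2 R; lra.
pose c j : R := 2 * pi * j.+1%:R.
have c0 j : 0 < c j by rewrite !mulr_gt0// pi_gt0.
have z12 : 0 < complex.Im ((2^-1 : R) *i) by rewrite /=; lra.
have [A1 [B1 [cA1 cB1 _]]] := hh _ z12.
have [MA MA0 hMA] := cseries_bounded _ _ cA1.
have [MB MB0 hMB] := cseries_bounded _ _ cB1.
have Bterm j (y : R) : 0 < y -> cnorm (b (idx_neg j) *
    (inc_gamma (1 - k) (- 4 * pi * (idx_neg j)%:~R * complex.Im (y *i)))%:C *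
    exp_term (idx_neg j) (y *i)) =
    cnorm (b (idx_neg j)) * (2 * c j) ^ (1 - k) * (y ^ (1 - k) * gamma_kernel k (c j) y).
  move=> y0; rewrite exp_term_imag [complex.Im _]/=.
  have -> : - (2 * pi * (idx_neg j)%:~R) = c j :> R by rewrite idx_negE /c; ring.
  have -> : - 4 * pi * (idx_neg j)%:~R = 2 * c j :> R by rewrite idx_negE /c; ring.
  have h1 : 0 <= (2 * c j) ^ (1 - k) by rewrite exprz_ge0// mulr_ge0// ltW.
  have h2 : 0 <= y ^ (1 - k) by rewrite exprz_ge0// ltW.
  have h3 := gamma_kernel_ge0 k (c j) y.
  rewrite -mulrA cnormM -rmorphM inc_gamma_expR// cnormR ger0_norm.
    by rewrite -[RHS]mulrA.
  by rewrite mulr_ge0// mulr_ge0.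
pose m : int := idx_ge p i.
have m1 : (m%:~R : R) <= - n0%:R - 1.
  have : m + 1 <= - n0%:Z by rewrite lezD1.
  by rewrite -(ler_int R) intrD mulrNz; lra.
pose n1 := `|1 - k|%N.
have [C C0 hC] := @exprn_le_expR R n1 1 ltr01.
pose K := `|M0| + MB * 2 ^+ n1 * C * 2 ^+ n1 + MA * expR (pi * m%:~R) * 2 ^+ i.+1 * expR (2 * pi).
have main (y : R) : 1 <= y -> Y < y -> cnorm (a m) <= K * expR (- y).
  move=> y1 Yy; have y0 : 0 < y by lra.
  have [A [B [cA cB hAB]]] := hh (y *i) y0.
  pose E := expR (2 * pi * m%:~R * y).
  have E0 : 0 < E by exact: expR_gt0.
  have hB : cnorm B <= MB * (2 * y) ^ (1 - k).
    apply: (cnorm_series_geometric _ _ _ _ _ cB) => [|j].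
      by rewrite mulr_ge0 ?exprz_ge0 ?mulr_ge0// ltW.
    rewrite Bterm//; have := hMB j; rewrite Bterm; last by lra.
    have G := gamma_kernel_decay k (c j) y (c0 j) _.
    have {}G : gamma_kernel k (c j) y <= 2^-1 ^+ j.+1 * gamma_kernel k (c j) 2^-1.
      apply: le_trans (G _) _; first by lra.
      rewrite ler_wpM2r ?gamma_kernel_ge0//; apply: expRN_le_half.
      rewrite /c; have j0 : 0 <= (j.+1%:R : R) by [].
      have : 0 <= (j.+1%:R : R) * (pi - 1) by rewrite mulr_ge0// subr_ge0.
      have : 0 <= pi * (j.+1%:R : R) * (y - 1) by rewrite !mulr_ge0 ?pi_ge0 ?subr_ge0.
      lra.
    set g := gamma_kernel k (c j) 2^-1 in G *; set q := 2^-1 ^+ j.+1 in G *.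
    set bc := cnorm _ * _ => H.
    have bc0 : 0 <= bc by rewrite mulr_ge0 ?cnorm_ge0// exprz_ge0// mulr_ge0// ltW.
    have q0 : 0 <= q by rewrite exprn_ge0.
    apply: (@le_trans _ _ (bc * (y ^ (1 - k) * (q * g)))).
      by rewrite ler_wpM2l// ler_wpM2l// exprz_ge0// ltW.
    have -> : y ^ (1 - k) = (2 * y) ^ (1 - k) * 2^-1 ^ (1 - k).
      by rewrite -expfzMl mulrAC divff ?mul1r// pnatr_eq0.
    apply: (@le_trans _ _ ((2 * y) ^ (1 - k) * q * MB)); last first.
      by rewrite le_eqVlt; apply/orP; left; apply/eqP; ring.
    have -> : bc * ((2 * y) ^ (1 - k) * 2^-1 ^ (1 - k) * (q * g)) =
      ((2 * y) ^ (1 - k) * q) * (bc * (2^-1 ^ (1 - k) * g)) by ring.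
    by rewrite ler_wpM2l// mulr_ge0// exprz_ge0// mulr_ge0// ltW.
  have hy : (2 * y) ^ (1 - k) <= 2 ^+ n1 * C * expR y.
    have y21 : 1 <= 2 * y by lra.
    apply: (@le_trans _ _ ((2 * y) ^+ n1)).
      rewrite /n1; case: (1 - k) => q /=; first by [].
      rewrite NegzE -exprnN; apply: (@le_trans _ _ 1); last exact: exprn_ege1.
      by rewrite invf_le1 ?exprn_gt0 ?exprn_ege1//; lra.
    rewrite exprMn -mulrA ler_wpM2l ?exprn_ge0//.
    by apply: le_trans (hC y (ltW y0)) _; rewrite mul1r.
  pose u' j := if j == i then 0 else
     E%:C * (a (idx_ge p j) * exp_term (idx_ge p j) (y *i)).
  have EE : E * expR (- (2 * pi * m%:~R) * y) = 1.
    by rewrite /E -expRD -[RHS]expR0; congr expR; ring.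
  have cu' : (series u' : nat -> R[i]^o) @ \oo --> (E%:C * A - a m : R[i]^o).
    have := cvg_series_drop_term _ _ E%:C i cA.
    by rewrite exp_term_imag -/m mulrCA -rmorphM EE mulr1.
  have hu' j : cnorm (u' j) <=
      MA * expR (pi * m%:~R) * 2 ^+ i.+1 * expR (2 * pi) * expR (- (2 * pi * y)) * 2^-1 ^+ j.+1.
    have r0 : 0 <= MA * expR (pi * m%:~R) * 2 ^+ i.+1 * expR (2 * pi) * expR (- (2 * pi * y)) * 2^-1 ^+ j.+1.
      by rewrite !mulr_ge0 ?exprn_ge0 ?expR_ge0 ?(ltW MA0).
    rewrite /u'; case: ifPn => [_|ji]; first by rewrite cnorm0.
    have [ij|ij] := ltnP i j; last first.
      rewrite IH ?mul0r ?mulr0 ?cnorm0// ?ltn_neqAle ?ji//.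
      apply: le_lt_trans im; rewrite /idx_ge lerB// lez_nat//.
    have := hMA j; rewrite !exp_term_imag !cnormM !cnormR.
    rewrite !(ger0_norm (expR_ge0 _)) => H.
    have jE : j = (i + (j - i.+1).+1)%N by rewrite addnS -addSn subnKC.
    set l := (j - i.+1).+1 in jE *.
    have l1 : 1 <= (l%:R : R) by rewrite ler1n.
    have idxE : (idx_ge p j)%:~R = m%:~R + l%:R :> R.
      by rewrite jE /m /idx_ge !intrD PoszD intrD; ring.
    rewrite idxE in H *.
    have hal : cnorm (a (idx_ge p j)) <= MA * expR (pi * (m%:~R + l%:R)).
      have e0 : expR (- (2 * pi * (m%:~R + l%:R)) * 2^-1) * expR (pi * (m%:~R + l%:R)) = 1 :> R.
        by rewrite -expRD -[RHS]expR0; congr expR; field.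
      apply: le_trans (ler_wpM2r (expR_ge0 (pi * (m%:~R + l%:R))) H).
      by rewrite -[leRHS]mulrA e0 mulr1.
    apply: (@le_trans _ _ (E * ((MA * expR (pi * (m%:~R + l%:R))) * expR (- (2 * pi * (m%:~R + l%:R)) * y)))).
      by rewrite ler_wpM2l ?(ltW E0)// ler_wpM2r ?expR_ge0.
    have e2 : expR (- (pi * l%:R)) <= 2^-1 ^+ l :> R.
      apply: expRN_le_half; rewrite ler_peMl//; lra.
    have -> : 2^-1 ^+ j.+1 = 2^-1 ^+ i.+1 * 2^-1 ^+ l :> R.
      by rewrite -exprD addSn -jE.
    have e3 : E * (MA * expR (pi * (m%:~R + l%:R)) * expR (- (2 * pi * (m%:~R + l%:R)) * y)) =
      MA * expR (pi * m%:~R) * (expR (- (2 * pi * l%:R * (y - 1))) * expR (- (pi * l%:R))).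
      rewrite /E [LHS]mulrCA -!mulrA; congr (MA * _).
      by rewrite -!expRD; congr expR; ring.
    rewrite e3.
    have e4 : expR (- (2 * pi * l%:R * (y - 1))) <= expR (2 * pi) * expR (- (2 * pi * y)).
      rewrite -expRD ler_expR.
      have : 0 <= 2 * pi * (y - 1) * (l%:R - 1) by rewrite !mulr_ge0 ?pi_ge0 ?subr_ge0.
      lra.
    have e5 : 2 ^+ i.+1 * 2^-1 ^+ i.+1 = 1 :> R.
      by rewrite -exprMn divff ?expr1n// pnatr_eq0.
    have -> : MA * expR (pi * m%:~R) * 2 ^+ i.+1 * expR (2 * pi) * expR (- (2 * pi * y)) *
      (2^-1 ^+ i.+1 * 2^-1 ^+ l) = MA * expR (pi * m%:~R) * (expR (2 * pi) * expR (- (2 * pi * y)) *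
      2^-1 ^+ l) * (2 ^+ i.+1 * 2^-1 ^+ i.+1) by ring.
    rewrite e5 mulr1 ler_wpM2l ?mulr_ge0 ?expR_ge0 ?(ltW MA0)//.
    by apply: ler_pM => //; exact: expR_ge0.
  have hS := cnorm_series_geometric _ _ _ _ hu' cu'.
  have {}hS : cnorm (E%:C * A - a m) <=
     MA * expR (pi * m%:~R) * 2 ^+ i.+1 * expR (2 * pi) * expR (- (2 * pi * y)).
    by apply: hS; rewrite !mulr_ge0 ?exprn_ge0 ?expR_ge0 ?(ltW MA0).
  have -> : a m = E%:C * h (y *i) + (- (E%:C * B) + - (E%:C * A - a m)).
    by rewrite hAB; ring.
  have hOy := hO (y *i) Yy; rewrite [complex.Im _]/= in hOy.
  have e2y : E <= expR (- (2 * pi * n0%:R) * y - 2 * pi * y).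
    rewrite /E ler_expR.
    have : 0 <= 2 * pi * y * (- n0%:R - 1 - m%:~R).
      by rewrite !mulr_ge0 ?pi_ge0 ?(ltW y0) ?subr_ge0.
    lra.
  have e2y' : E <= expR (- (2 * pi * y)).
    apply: le_trans e2y _; rewrite ler_expR.
    have : 0 <= 2 * pi * n0%:R * y by rewrite !mulr_ge0 ?pi_ge0 ?(ltW y0).
    lra.
  have ey : expR (- (2 * pi * y)) <= expR (- y) * expR (- y).
    rewrite -expRD ler_expR; have : 0 <= (pi - 1) * y by rewrite mulr_ge0 ?subr_ge0 ?(ltW y0).
    lra.
  have ey1 : expR (- y) <= 1 by rewrite -expR0 ler_expR; lra.
  have ey' : expR (- (2 * pi * y)) <= expR (- y).
    by apply: le_trans ey _; rewrite ler_piMl ?expR_ge0.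
  have p1 : cnorm (E%:C * h (y *i)) <= `|M0| * expR (- y).
    rewrite cnormM cnormR (ger0_norm (ltW E0)).
    apply: (@le_trans _ _ (expR (- (2 * pi * n0%:R) * y - 2 * pi * y) *
       (`|M0| * expR (2 * pi * n0%:R * y)))).
      apply: ler_pM; rewrite ?cnorm_ge0 ?(ltW E0)//.
      by apply: le_trans hOy _; rewrite ler_wpM2r ?expR_ge0 ?ler_norm.
    rewrite mulrCA -expRD ler_wpM2l//; apply: le_trans ey'.
    by rewrite ler_expR; lra.
  have p2 : cnorm (- (E%:C * B)) <= MB * 2 ^+ n1 * C * 2 ^+ n1 * expR (- y).
    rewrite cnormN cnormM cnormR (ger0_norm (ltW E0)).
    apply: (@le_trans _ _ (expR (- y) * expR (- y) * (MB * (2 ^+ n1 * C * expR y)))).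
      apply: ler_pM; rewrite ?cnorm_ge0 ?(ltW E0)//; first exact: le_trans e2y' ey.
      by apply: le_trans hB _; rewrite ler_wpM2l// ltW.
    have E1 : expR (- y) * expR y = 1 by rewrite -expRD addNr expR0.
    have -> : expR (- y) * expR (- y) * (MB * (2 ^+ n1 * C * expR y)) =
      MB * 2 ^+ n1 * C * expR (- y) * (expR (- y) * expR y) by ring.
    rewrite E1 mulr1 ler_wpM2r ?expR_ge0// ler_peMr ?exprn_ege1 ?ler1n//.
    by rewrite !mulr_ge0 ?exprn_ge0 ?(ltW C0) ?(ltW MB0).
  have p3 : cnorm (- (E%:C * A - a m)) <=
     MA * expR (pi * m%:~R) * 2 ^+ i.+1 * expR (2 * pi) * expR (- y).
    rewrite cnormN; apply: le_trans hS _; rewrite ler_wpM2l//.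
    by rewrite !mulr_ge0 ?exprn_ge0 ?expR_ge0 ?(ltW MA0).
  apply: le_trans (cnormD _ _) _.
  apply: le_trans (lerD p1 (le_trans (cnormD _ _) (lerD p2 p3))) _.
  by rewrite le_eqVlt; apply/orP; left; apply/eqP; rewrite /K; ring.
apply/eqP; rewrite -cnorm_eq0 eq_le cnorm_ge0 andbT; apply/ler_addgt0Pr => e e0.
rewrite add0r -/m.
pose y := Num.max 1 (Num.max (Y + 1) (K / e)).
have y1 : 1 <= y by rewrite /y le_max lexx.
have yY : Y < y by rewrite /y !lt_max ltrDl ltr01 orbT.
have yK : K / e <= y by rewrite /y !le_max lexx !orbT.
have y0 : 0 < y by lra.
apply: le_trans (main y y1 yY) _.
rewrite expRN ler_pdivrMr ?expR_gt0// mulrC -ler_pdivrMr//.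
by apply: le_trans yK _; have := expR_ge1Dx y; lra.
Qed.

(** * Piecewise smooth functions *)

Fixpoint cdiff_n {R : realType} (n : nat) (U : set R) (u : R -> R[i]) : Prop :=
  (forall x, U x -> cderivable u x) /\
  (if n is n'.+1 then cdiff_n n' U (cderive1 u) else True).

Lemma smooth_on_cdiff_n {R : realType} (U : set R) (u : R -> R[i]) :
  smooth_on U u <-> forall n, cdiff_n n U u.
Proof.
split=> [h n|h n].
  elim: n u h => [|n IHn] u h /=; split=> //; try exact: (h 0%N).
  by apply: IHn => m x Ux; have := h m.+1 x Ux; rewrite iterSr.
elim: n u h => [|n IHn] u h x Ux /=; first by case: (h 0%N) => du _; exact: du.
by rewrite -iterS iterSr; apply: IHn => // m; case: (h m.+1).
Qed.

Lemma eq_cderive_open {R : realType} (U : set R) (u v : R -> R[i]) x :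
  open U -> {in U, u =1 v} -> U x ->
  (cderivable u x -> cderivable v x) /\ cderive1 u x = cderive1 v x.
Proof.
move=> oU uv Ux.
have nUx : nbhs x U by exact: open_nbhs_nbhs.
have nR : \near x, complex.Re (u x) = complex.Re (v x).
  by apply: filterS nUx => y Uy; rewrite uv ?inE.
have nI : \near x, complex.Im (u x) = complex.Im (v x).
  by apply: filterS nUx => y Uy; rewrite uv ?inE.
split.
  by move=> [dr di]; split; [apply: near_eq_derivable nR dr|apply: near_eq_derivable nI di]; rewrite ?oner_neq0.
by apply: cpx_eqP; rewrite /= !derive1E; apply: near_eq_derive; rewrite ?oner_neq0.
Qed.

Lemma eq_cdiff_n {R : realType} (n : nat) (U : set R) (u v : R -> R[i]) :
  open U -> {in U, u =1 v} -> cdiff_n n U u -> cdiff_n n U v.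
Proof.
move=> oU; elim: n u v => [|n IHn] u v uv [du D].
  by split=> [x Ux|]; [exact: (eq_cderive_open _ _ _ x oU uv Ux).1 (du x Ux)|].
split=> [x Ux|]; first exact: (eq_cderive_open _ _ _ x oU uv Ux).1 (du x Ux).
by apply: IHn D => x; rewrite inE => Ux; exact: (eq_cderive_open _ _ _ x oU uv Ux).2.
Qed.

Lemma cdiff_nS {R : realType} (n : nat) (U : set R) (u : R -> R[i]) :
  cdiff_n n.+1 U u -> cdiff_n n U u.
Proof.
elim: n u => [|n IHn] u; first by move=> [du _].
by move=> [du D]; split => //; exact: IHn.
Qed.

Lemma rderiveD {R : realType} (f g : R -> R) (x : R) :
  derivable f x 1 -> derivable g x 1 ->
  derivable (fun t => f t + g t) x 1 /\
  derive1 (fun t => f t + g t) x = derive1 f x + derive1 g x.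
Proof.
move=> df dg; rewrite !derive1E.
split; [exact: (derivableD df dg)|exact: (deriveD df dg)].
Qed.

Lemma rderiveB {R : realType} (f g : R -> R) (x : R) :
  derivable f x 1 -> derivable g x 1 ->
  derivable (fun t => f t - g t) x 1 /\
  derive1 (fun t => f t - g t) x = derive1 f x - derive1 g x.
Proof.
move=> df dg; rewrite !derive1E.
split; [exact: (derivableB df dg)|exact: (deriveB df dg)].
Qed.

Lemma rderiveM {R : realType} (f g : R -> R) (x : R) :
  derivable f x 1 -> derivable g x 1 ->
  derivable (fun t => f t * g t) x 1 /\
  derive1 (fun t => f t * g t) x = derive1 f x * g x + f x * derive1 g x.
Proof.
move=> df dg; rewrite !derive1E; split; first exact: (derivableM df dg).
by rewrite (deriveM df dg) /GRing.scale/= addrC mulrC.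
Qed.

Lemma cderiveD {R : realType} (u v : R -> R[i]) x :
  cderivable u x -> cderivable v x ->
  cderivable (fun t => u t + v t) x /\
  cderive1 (fun t => u t + v t) x = cderive1 u x + cderive1 v x.
Proof.
move=> [ur ui] [vr vi]; rewrite /cderivable /cderive1.
have -> : (fun t => complex.Re (u t + v t)) = (fun t => complex.Re (u t) + complex.Re (v t)).
  by apply/funext => t; rewrite cReD.
have -> : (fun t => complex.Im (u t + v t)) = (fun t => complex.Im (u t) + complex.Im (v t)).
  by apply/funext => t; rewrite cImD.
have [r1 r2] := rderiveD _ _ x ur vr; have [i1 i2] := rderiveD _ _ x ui vi.
by split; [split; [exact: r1|exact: i1]|rewrite r2 i2].
Qed.

Lemma cderiveM {R : realType} (u v : R -> R[i]) x :
  cderivable u x -> cderivable v x ->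
  cderivable (fun t => u t * v t) x /\
  cderive1 (fun t => u t * v t) x = cderive1 u x * v x + u x * cderive1 v x.
Proof.
move=> [ur ui] [vr vi]; rewrite /cderivable /cderive1.
have -> : (fun t => complex.Re (u t * v t)) =
    (fun t => complex.Re (u t) * complex.Re (v t) - complex.Im (u t) * complex.Im (v t)).
  by apply/funext => t; rewrite cReM.
have -> : (fun t => complex.Im (u t * v t)) =
    (fun t => complex.Re (u t) * complex.Im (v t) + complex.Im (u t) * complex.Re (v t)).
  by apply/funext => t; rewrite cImM.
have [rr1 rr2] := rderiveM _ _ x ur vr; have [ii1 ii2] := rderiveM _ _ x ui vi.
have [ri1 ri2] := rderiveM _ _ x ur vi; have [ir1 ir2] := rderiveM _ _ x ui vr.
have [r1 r2] := rderiveB _ _ x rr1 ii1; have [i1 i2] := rderiveD _ _ x ri1 ir1.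
split; first by split; [exact: r1|exact: i1].
by rewrite r2 i2 rr2 ii2 ri2 ir2; apply: cpx_eqP; rewrite ?cReD ?cImD ?cReM ?cImM /=; ring.
Qed.

Lemma cdiff_nD {R : realType} (n : nat) (U : set R) (u v : R -> R[i]) :
  open U -> cdiff_n n U u -> cdiff_n n U v -> cdiff_n n U (fun t => u t + v t).
Proof.
move=> oU; elim: n u v => [|n IHn] u v [du Du] [dv Dv].
  split; last by [].
  by move=> x Ux; exact: (cderiveD _ _ _ (du x Ux) (dv x Ux)).1.
split; first by move=> x Ux; exact: (cderiveD _ _ _ (du x Ux) (dv x Ux)).1.
apply: (eq_cdiff_n _ _ (fun t => cderive1 u t + cderive1 v t)) => //.
  by move=> x; rewrite inE => Ux; rewrite (cderiveD _ _ _ (du x Ux) (dv x Ux)).2.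
exact: IHn.
Qed.

Lemma cdiff_nM {R : realType} (n : nat) (U : set R) (u v : R -> R[i]) :
  open U -> cdiff_n n U u -> cdiff_n n U v -> cdiff_n n U (fun t => u t * v t).
Proof.
move=> oU; elim: n u v => [|n IHn] u v Cu Cv.
  case: Cu Cv => [du Du] [dv Dv].
  split; last by [].
  by move=> x Ux; exact: (cderiveM _ _ _ (du x Ux) (dv x Ux)).1.
have Cu' := cdiff_nS _ _ _ Cu; have Cv' := cdiff_nS _ _ _ Cv.
case: Cu Cv => [du Du] [dv Dv].
split; first by move=> x Ux; exact: (cderiveM _ _ _ (du x Ux) (dv x Ux)).1.
apply: (eq_cdiff_n _ _ (fun t => cderive1 u t * v t + u t * cderive1 v t)) => //.
  by move=> x; rewrite inE => Ux; rewrite (cderiveM _ _ _ (du x Ux) (dv x Ux)).2.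
by apply: cdiff_nD => //; exact: IHn.
Qed.

Lemma cdiff_n_cst {R : realType} (n : nat) (U : set R) (c : R[i]) :
  cdiff_n n U (fun=> c).
Proof.
elim: n c => [|n IHn] c; split => //; try by move=> x _; split; exact: derivable_cst.
suff -> : cderive1 (fun=> c) = (fun=> 0) by exact: IHn.
by apply/funext => x; apply: cpx_eqP; rewrite /= derive1_cst.
Qed.

Lemma cderive_cpow {R : realType} (s : R[i]) (x : R) : 0 < x ->
  cderivable (fun t => cpow t s) x /\
  cderive1 (fun t => cpow t s) x = s * cpow x (s - 1).
Proof.
move=> x0; case: s => sr si.
have dl := is_derive1_ln x0.
have dm (c : R) : is_derive x 1 (fun t : R => c * ln t) (c * x^-1).
  exact: (is_deriveZ _ dl).
have de : is_derive x 1 (fun t : R => expR (sr * ln t)) (expR (sr * ln x) * (sr * x^-1)).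
  exact: (@is_derive1_comp _ expR (fun t => sr * ln t)).
have dc : is_derive x 1 (fun t : R => cos (si * ln t)) (- sin (si * ln x) * (si * x^-1)).
  exact: (@is_derive1_comp _ cos (fun t => si * ln t)).
have ds : is_derive x 1 (fun t : R => sin (si * ln t)) (cos (si * ln x) * (si * x^-1)).
  exact: (@is_derive1_comp _ sin (fun t => si * ln t)).
have eR : (fun t => complex.Re (cpow t (sr +i* si))) =
    (fun t : R => expR (sr * ln t)) * (fun t : R => cos (si * ln t)).
  by apply/funext => t; rewrite /cpow /cexp /= !mulr0 subr0 add0r.
have eI : (fun t => complex.Im (cpow t (sr +i* si))) =
    (fun t : R => expR (sr * ln t)) * (fun t : R => sin (si * ln t)).
  by apply/funext => t; rewrite /cpow /cexp /= !mulr0 subr0 add0r.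
have dR := is_deriveM de dc; have dI := is_deriveM de ds.
have ex : expR ((sr - 1) * ln x) = expR (sr * ln x) * x^-1.
  by rewrite mulrBl mul1r expRB lnK ?posrE.
split; first by split; rewrite ?eR ?eI; exact: ex_derive.
apply: cpx_eqP; rewrite ?cReM ?cImM /= ?eR ?eI !derive1E derive_val /GRing.scale/=.
  by rewrite !mulr0 !subr0 !add0r ex; ring.
by rewrite !mulr0 !subr0 !add0r ex; ring.
Qed.

Lemma open_Rpos {R : realType} : open (Rpos R).
Proof. exact: interval_open. Qed.

Lemma cdiff_n_cpow {R : realType} (n : nat) (s : R[i]) :
  cdiff_n n (Rpos R) (fun t => cpow t s).
Proof.
elim: n s => [|n IHn] s; split => //.
- by move=> x; rewrite /= in_itv/= andbT => /(cderive_cpow s)[].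
- by move=> x; rewrite /= in_itv/= andbT => /(cderive_cpow s)[].
- apply: (eq_cdiff_n _ _ (fun t => s * cpow t (s - 1))).
  + exact: open_Rpos.
  + by move=> x; rewrite inE/= in_itv/= andbT => /(cderive_cpow s)[_ ->].
  + by apply: cdiff_nM; [exact: open_Rpos|exact: cdiff_n_cst|exact: IHn].
Qed.

Lemma cdiff_n_subset {R : realType} (n : nat) (U V : set R) (u : R -> R[i]) :
  V `<=` U -> cdiff_n n U u -> cdiff_n n V u.
Proof.
move=> VU; elim: n u => [|n IHn] u [du D]; (split; first by move=> x /VU; exact: du).
  by [].
exact: IHn.
Qed.

Lemma piecewise_smooth_twist {R : realType} (phi : R -> R[i]) (s : R[i]) :
  piecewise_smooth phi -> piecewise_smooth (twist phi s).
Proof.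
move=> ps a b a0 ab; have [m [t [t0 tm H]]] := ps a b a0 ab.
exists m, t; split => // i im; have [tt [u [U [oU IU su uphi]]]] := H i im.
have tpos j : (j <= m)%N -> 0 < t j.
  elim: j => [|j IHj] jm; first by rewrite t0.
  by have [h _] := H j jm; apply: lt_trans h; apply: IHj; exact: ltnW.
split => //; exists (fun x => u x * cpow x (s - 1)), (U `&` Rpos R); split.
- by apply: openI => //; exact: open_Rpos.
- move=> x xI; split; first exact: IU.
  by move: xI; rewrite /= !in_itv/= andbT => /andP[tx _]; apply: lt_le_trans tx; exact/tpos/ltnW.
- apply/smooth_on_cdiff_n => n.
  have oV : open (U `&` Rpos R) by apply: openI => //; exact: open_Rpos.
  apply: cdiff_nM; first exact: oV.
    by apply: (@cdiff_n_subset _ _ U); [exact: subIsetl|exact: (smooth_on_cdiff_n U u).1].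
  by apply: (@cdiff_n_subset _ _ (Rpos R)); [exact: subIsetr|exact: cdiff_n_cpow].
- by move=> x xI; rewrite /twist uphi.
Qed.

Lemma smooth_on_continuous {R : realType} (U : set R) (u : R -> R[i]) x :
  smooth_on U u -> U x ->
  {for x, continuous (fun t => complex.Re (u t))} /\
  {for x, continuous (fun t => complex.Im (u t))}.
Proof.
move=> su Ux; have [dr di] := su 0%N x Ux.
by split; apply: differentiable_continuous; exact/derivable1_diffP.
Qed.

Lemma piecewise_smooth_bounded {R : realType} (phi : R -> R[i]) (a b : R) :
  piecewise_smooth phi -> 0 < a -> a < b ->
  exists C : R, forall x, x \in `[a, b] -> cnorm (phi x) <= C.
Proof.
move=> ps a0 ab; have [m [t [t0 tm H]]] := ps a b a0 ab.
suff P j : (j <= m)%N -> exists C : R, forall x, x \in `[t 0%N, t j] -> cnorm (phi x) <= C.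
  by rewrite -t0 -tm; exact: P.
elim: j => [|j IHj] jm.
  exists (cnorm (phi (t 0%N))) => x; rewrite in_itv/= => xt.
  by rewrite (_ : x = t 0%N)//; apply/eqP; rewrite eq_le andbC.
have [C1 hC1] := IHj (ltnW jm).
have [tt [u [U [oU IU su uphi]]]] := H j jm.
pose f x := `|complex.Re (u x)| + `|complex.Im (u x)|.
have cf : {within `[t j, t j.+1], continuous f}.
  apply: continuous_in_subspaceT => x; rewrite inE => /IU Ux.
  have [cr ci] := smooth_on_continuous _ _ _ su Ux.
  by apply: cvgD; exact: cvg_norm.
have [c _ hc] := EVT_max (ltW tt) cf.
exists (Num.max C1 (Num.max (f c) (cnorm (phi (t j.+1))))) => x.
rewrite in_itv/= => /andP[x0 x1]; rewrite !le_max.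
have [xj|xj] := leP x (t j); first by rewrite hC1// in_itv/= x0 xj.
move: x1; rewrite le_eqVlt => /predU1P[->|x1]; first by rewrite lexx !orbT.
rewrite (_ : cnorm (phi x) <= f c) ?orbT// uphi ?in_itv/= ?xj//.
apply: le_trans (cnorm_le _) _; apply: hc.
by rewrite in_itv/= !ltW.
Qed.

Lemma piecewise_smooth_cmeasurable {R : realType} (phi : R -> R[i]) :
  piecewise_smooth phi -> cmeasurable (Rpos R) phi.
Proof.
move=> ps.
have h (a b : R) : 0 < a -> a < b -> cmeasurable `[a, b] phi.
  move=> a0 ab; have [m [t [t0 tm H]]] := ps a b a0 ab.
  suff P j : (j <= m)%N -> t 0%N <= t j /\ cmeasurable `[t 0%N, t j] phi.
    by rewrite -t0 -tm; exact: (P m (leqnn m)).2.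
  elim: j => [|j IHj] jm.
    by split => //; rewrite set_itv1; split; exact: measurable_fun_set1.
  have [t0j [mr mi]] := IHj (ltnW jm).
  have [tt [u [U [oU IU su uphi]]]] := H j jm.
  split; first exact: le_trans t0j (ltW tt).
  have E : `[t 0%N, t j.+1]%classic =
      (`[t 0%N, t j] `|` `]t j, t j.+1[) `|` [set t j.+1].
    apply/seteqP; split => x /=; rewrite !in_itv/=.
      move=> /andP[x0 x1]; have [xj|xj] := leP x (t j); first by left; left; rewrite x0.
      by move: x1; rewrite le_eqVlt => /predU1P[->|x1]; [right|left; right].
    move=> [[/andP[-> x1]|/andP[x0 x1]]|->]; first by rewrite (le_trans x1)// ltW.
      by rewrite (le_trans t0j (ltW x0)) ltW.
    by rewrite lexx (le_trans t0j (ltW tt)).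
  have mo : cmeasurable `]t j, t j.+1[ phi.
    apply: (@eq_cmeasurable _ _ u); first by move=> x; rewrite inE => /uphi ->.
    split; apply: open_continuous_measurable_fun => // x; rewrite inE => xI.
      have Ux : U x by apply: IU; exact: subset_itv_oo_cc xI.
      by have [] := smooth_on_continuous _ _ _ su Ux.
    have Ux : U x by apply: IU; exact: subset_itv_oo_cc xI.
    by have [] := smooth_on_continuous _ _ _ su Ux.
  case: mo => mor moi; rewrite E.
  split; apply/measurable_funU => //; try exact: measurableU; split;
    try exact: measurable_fun_set1; by apply/measurable_funU.
have E : Rpos R = \bigcup_n `[(n.+2%:R^-1 : R), n.+2%:R]%classic.
  apply/seteqP; split => x /=; rewrite ?in_itv/= ?andbT.
    move=> x0; pose n := (Num.truncn (x + x^-1)); exists n => //=.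
    have : x + x^-1 < n.+1%:R by exact: truncnS_gt.
    have xV : 0 < x^-1 by rewrite invr_gt0.
    rewrite -[n.+2%:R]natr1 => hn; rewrite in_itv/=; apply/andP; split; last by lra.
    by rewrite -[leRHS]invrK lef_pV2 ?posrE//; lra.
  by move=> [n _] /=; rewrite in_itv/= => /andP[+ _]; apply: lt_le_trans; rewrite invr_gt0.
have h' n : cmeasurable `[(n.+2%:R^-1 : R), n.+2%:R] phi.
  apply: h; first by rewrite invr_gt0.
  apply: (@lt_trans _ _ 1); last by rewrite ltr1n.
  by rewrite invf_lt1// ltr1n.
by rewrite E; split; apply/measurable_fun_bigcup => // n; have [] := h' n.
Qed.

(** * Growth bounds *)

Lemma exp_littleo_le {R : realType} (c : R) (phi : R -> R[i]) :
  exp_littleo c phi -> exists X : R, forall x, X < x -> cnorm (phi x) <= expR (- c * x).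
Proof.
move=> /cvgrPdist_lt/(_ 1 ltr01)[X [_ H]]; exists X => x /H.
rewrite sub0r normrN ger0_norm ?divr_ge0 ?cnorm_ge0 ?expR_ge0//.
by rewrite ltr_pdivrMr ?expR_gt0// mul1r => /ltW.
Qed.

Lemma exp_decay {R : realType} (c : R) (phi : R -> R[i]) : 0 < c ->
  piecewise_smooth phi -> exp_littleo c phi -> exp_littleo c (fun x => phi x^-1) ->
  exists2 C : R, 0 < C & forall x, 0 < x -> cnorm (phi x) <= C * expR (- (c * (x + x^-1))).
Proof.
move=> c0 ps /exp_littleo_le[X1 H1] /exp_littleo_le[X2 H2].
pose X := Num.max 2 (Num.max (X1 + 1) (X2 + 1)).
have X2' : 2 <= X by rewrite /X le_max lexx.
have X0 : 0 < X by lra.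
have XX1 : X1 < X by rewrite /X !lt_max ltrDl ltr01 orbT.
have XX2 : X2 < X by rewrite /X !lt_max ltrDl ltr01 !orbT.
have XV : X^-1 < X.
  by apply: (@lt_trans _ _ 1); [rewrite invf_lt1//|]; lra.
have [C0 HC0] := piecewise_smooth_bounded _ _ _ ps (etrans (invr_gt0 X) X0) XV.
exists (expR c + `|C0| * expR (c * (X + X))).
  by rewrite ltr_pwDl ?expR_gt0// mulr_ge0 ?expR_ge0.
move=> x x0; have xV0 : 0 < x^-1 by rewrite invr_gt0.
have ge0 (d : R) : 0 <= expR d by exact: expR_ge0.
have h1 (A B E : R) : 0 <= A -> 0 <= B -> 0 <= E -> A * E <= (A + B) * E.
  by move=> A0 B0 E0; rewrite mulrDl lerDl mulr_ge0.
have [xX|xX] := leP X x.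
  apply: (@le_trans _ _ (expR c * expR (- (c * (x + x^-1))))); last first.
    by rewrite h1// mulr_ge0.
  apply: le_trans (H1 x (lt_le_trans XX1 xX)) _.
  rewrite -expRD ler_expR.
  have : x^-1 <= 1 by rewrite invf_le1//; lra.
  rewrite -subr_ge0 => h; have := mulr_ge0 (ltW c0) h; lra.
have [xV|xV] := leP X x^-1.
  apply: (@le_trans _ _ (expR c * expR (- (c * (x + x^-1))))); last first.
    by rewrite h1// mulr_ge0.
  have := H2 _ (lt_le_trans XX2 xV); rewrite invrK => /le_trans; apply.
  rewrite -expRD ler_expR.
  have : x <= 1 by rewrite -[x]invrK invf_le1 ?invr_gt0//; lra.
  rewrite -subr_ge0 => h; have := mulr_ge0 (ltW c0) h; lra.
have xI : x \in `[X^-1, X].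
  by rewrite in_itv/= (ltW xX) andbT -[leRHS]invrK lef_pV2 ?posrE// ltW.
apply: le_trans (HC0 x xI) _; apply: le_trans (ler_norm _) _.
apply: (@le_trans _ _ (`|C0| * expR (c * (X + X)) * expR (- (c * (x + x^-1))))); last first.
  by rewrite mulrDl lerDr mulr_ge0.
rewrite -mulrA -expRD ler_peMr// -[leLHS]expR0 ler_expR.
by rewrite subr_ge0 ler_wpM2l ?(ltW c0)// lerD// ltW.
Qed.

Lemma slash_W_imag {R : realType} (k : int) (N : nat) (f : R[i] -> R[i]) (u : R) :
  (0 < N)%N -> 0 < u ->
  slash k (W_mx R N) f (u *i) =
  ((Num.sqrt N%:R * u)%:C * 'i%C) ^ (- k) * f ((N%:R * u)^-1 *i).
Proof.
move=> N0 u0; rewrite /slash /W_mx !mxE /=.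
have NR : 0 < (N%:R : R) by rewrite ltr0n.
have s0 : 0 < Num.sqrt (N%:R : R) by rewrite sqrtr_gt0.
have ss : Num.sqrt (N%:R : R) * Num.sqrt N%:R = N%:R by rewrite -expr2 sqr_sqrtr ?ltW.
have jE : (Num.sqrt N%:R)%:C * u *i + 0%:C = (Num.sqrt N%:R * u)%:C * 'i%C :> R[i].
  by apply: cpx_eqP; rewrite ?cReM ?cImM /=; ring.
rewrite jE; congr (_ * f _).
have j0 : (Num.sqrt N%:R * u)%:C * 'i%C != 0 :> R[i].
  rewrite mulf_neq0//; last by rewrite -cnorm_eq0 /cnorm /= expr0n /= add0r expr1n sqrtr1 oner_eq0.
  by rewrite -cnorm_eq0 cnormR normr_eq0 mulf_neq0// gt_eqF.
apply: (mulIf j0); rewrite mulfVK//.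
apply: cpx_eqP; rewrite ?cReM ?cImM /=.
  rewrite !(mul0r, mulr0, mulr1, subr0, addr0, add0r, sub0r).
  by rewrite -{2}ss; field; rewrite !gt_eqF.
by ring.
Qed.

Lemma imag_path_continuous {R : realType} (f : R[i] -> R[i]) (y : R) :
  smooth_upper_half f -> 0 < y ->
  {for y, continuous (fun t => complex.Re (f (t *i)))} /\
  {for y, continuous (fun t => complex.Im (f (t *i)))}.
Proof.
move=> sf y0; have [_ _ cf] := sf [::] (y *i) y0.
have cp : ((fun t : R => t *i) : R -> R[i]^o) @ y --> (y *i : R[i]^o).
  by apply: cvg_complex => /=; [exact: cvg_cst|exact: cvg_id].
have cc : ((fun t : R => f (t *i)) : R -> R[i]^o) @ y --> (f (y *i) : R[i]^o).
  exact: cvg_comp cp cf.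
by split; [exact: cvg_Re cc|exact: cvg_Im cc].
Qed.

Lemma imag_path_cmeasurable {R : realType} (f : R[i] -> R[i]) :
  smooth_upper_half f -> cmeasurable (Rpos R) (fun t => f (t *i)).
Proof.
move=> sf; split; apply: open_continuous_measurable_fun; try exact: open_Rpos.
  by move=> x; rewrite inE in_Rpos => /(imag_path_continuous _ _ sf)[].
by move=> x; rewrite inE in_Rpos => /(imag_path_continuous _ _ sf)[].
Qed.

Lemma form_growth {R : realType} (k : int) (N : nat) (n0 : nat) (f : R[i] -> R[i]) :
  (0 < N)%N -> smooth_upper_half f ->
  exp_bigO (2 * pi * n0%:R) f -> exp_bigO (2 * pi * n0%:R) (slash k (W_mx R N) f) ->
  exists C q : R, 0 <= C /\ forall y, 0 < y ->
    cnorm (f (y *i)) <= C * expR (q * `|ln y|) * expR (2 * pi * n0%:R * (y + y^-1)).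
Proof.
move=> N0 sf [M1 [Y1 H1]] [M2 [Y2 H2]].
have NR : 0 < (N%:R : R) by rewrite ltr0n.
have N1 : 1 <= (N%:R : R) by rewrite ler1n.
pose X := Num.max 2 (Num.max (Y1 + 1) (Y2 + 1)).
have X2' : 2 <= X by rewrite /X le_max lexx.
have X0 : 0 < X by lra.
have XX1 : Y1 < X by rewrite /X !lt_max ltrDl ltr01 orbT.
have XX2 : Y2 < X by rewrite /X !lt_max ltrDl ltr01 !orbT.
pose a := (N%:R * X)^-1.
have NX : X <= N%:R * X by rewrite ler_peMl// ltW.
have a0 : 0 < a by rewrite invr_gt0 mulr_gt0.
have aX : a < X.
  by apply: (@lt_trans _ _ 1); [rewrite invf_lt1 ?mulr_gt0//|]; lra.
pose g y := `|complex.Re (f (y *i))| + `|complex.Im (f (y *i))|.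
have cg : {within `[a, X], continuous g}.
  apply: continuous_in_subspaceT => y; rewrite inE/= in_itv/= => /andP[ay _].
  have [cr ci] := imag_path_continuous _ _ sf (lt_le_trans a0 ay).
  by apply: cvgD; exact: cvg_norm.
have [y1 _ hy1] := EVT_max (ltW aX) cg.
have g0 : 0 <= g y1 by rewrite addr_ge0.
pose s := Num.sqrt (N%:R : R).
have s0 : 0 < s by rewrite sqrtr_gt0.
have ss : s * s = N%:R by rewrite -expr2 sqr_sqrtr ?ltW.
pose q : R := `|k%:~R|.
have q0 : 0 <= q by exact: normr_ge0.
pose B := expR (q * `|ln s|).
have B1 : 1 <= B by rewrite /B -[leLHS]expR0 ler_expR mulr_ge0.
have P0 : 0 <= 2 * pi * n0%:R :> R by rewrite !mulr_ge0 ?pi_ge0.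
exists (`|M1| + `|M2| * B + g y1), q; split.
  by rewrite !addr_ge0// mulr_ge0// (le_trans _ B1).
move=> y y0; have yV0 : 0 < y^-1 by rewrite invr_gt0.
set E1 := expR (q * _); set E2 := expR (2 * pi * _ * _).
have E11 : 1 <= E1 by rewrite /E1 -[leLHS]expR0 ler_expR mulr_ge0.
have E21 : 1 <= E2 by rewrite /E2 -[leLHS]expR0 ler_expR mulr_ge0// addr_ge0// ltW.
have E12 : 1 <= E1 * E2 by rewrite -[1]mulr1; apply: ler_pM.
have M20 : 0 <= `|M2| * B by rewrite mulr_ge0// (le_trans _ B1).
have [yX|yX] := ltP X y.
  apply: (@le_trans _ _ (`|M1| * E1 * E2)); last first.
    rewrite -!mulrA ler_wpM2r ?(le_trans _ E12)//.
    by rewrite -addrA lerDl addr_ge0.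
  have := H1 (y *i) (lt_trans XX1 yX); rewrite [complex.Im _]/= => /le_trans; apply.
  apply: (@le_trans _ _ (`|M1| * expR (2 * pi * n0%:R * y))).
    by rewrite ler_wpM2r ?expR_ge0// ler_norm.
  rewrite -[leRHS]mulrA ler_wpM2l//; apply: (@le_trans _ _ (1 * E2)).
    by rewrite mul1r ler_expR ler_wpM2l// lerDl ltW.
  by rewrite ler_wpM2r// expR_ge0.
have [ya|ya] := leP a y.
  apply: (@le_trans _ _ (g y1 * E1 * E2)); last first.
    rewrite -!mulrA ler_wpM2r ?(le_trans _ E12)//.
    by rewrite lerDr addr_ge0.
  apply: (@le_trans _ _ (g y1)); last by rewrite -[leRHS]mulrA ler_peMr.
  apply: le_trans (cnorm_le _) _; apply: hy1.
  by rewrite in_itv/= ya.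
pose u := (N%:R * y)^-1.
have u0 : 0 < u by rewrite invr_gt0 mulr_gt0.
have uX : X < u.
  rewrite /u -[ltLHS]invrK ltf_pV2 ?posrE ?invr_gt0 ?mulr_gt0//.
  by move: ya; rewrite /a invfM -ltr_pdivlMl ?invr_gt0// invrK.
have uy : u <= y^-1.
  by rewrite /u lef_pV2 ?posrE ?mulr_gt0// ler_peMl// ltW.
have := H2 (u *i) (lt_trans XX2 uX); rewrite slash_W_imag// -/s.
have -> : (N%:R * u)^-1 = y by rewrite /u invfM invrK mulrA mulVf ?mul1r// gt_eqF.
have ni : cnorm ('i%C : R[i]) = 1.
  by rewrite /cnorm /= expr0n /= add0r expr1n sqrtr1.
rewrite cnormM cnormXz cnormM ni mulr1 cnormR ger0_norm ?mulr_ge0 ?(ltW s0) ?(ltW u0)//.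
rewrite [complex.Im _]/= => H.
have su0 : 0 < s * u by rewrite mulr_gt0.
have {}H : cnorm (f (y *i)) <= (s * u) ^ k * (M2 * expR (2 * pi * n0%:R * u)).
  rewrite -ler_pdivrMl ?exprz_gt0//; apply: le_trans H.
  by rewrite invr_expz.
apply: le_trans H _.
have suE : s * u = (s * y)^-1.
  by rewrite /u -ss; field; rewrite !gt_eqF.
have h1 : (s * u) ^ k <= B * E1.
  rewrite exprz_expR_ln// suE lnV ?posrE ?mulr_gt0// lnM ?posrE//.
  rewrite -expRD ler_expR -mulrDr; apply: le_trans (ler_norm _) _.
  by rewrite normrM normrN ler_wpM2l// ler_normD.
have h2 : M2 * expR (2 * pi * n0%:R * u) <= `|M2| * E2.
  apply: (@le_trans _ _ (`|M2| * expR (2 * pi * n0%:R * u))).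
    by rewrite ler_wpM2r ?expR_ge0// ler_norm.
  by rewrite ler_wpM2l// ler_expR ler_wpM2l// (le_trans uy)// lerDr ltW.
apply: (@le_trans _ _ ((B * E1) * (`|M2| * E2))).
  apply: (@le_trans _ _ ((s * u) ^ k * (`|M2| * E2))).
    by rewrite ler_wpM2l// exprz_ge0// ltW.
  by rewrite ler_wpM2r// mulr_ge0// expR_ge0.
have -> : B * E1 * (`|M2| * E2) = (`|M2| * B) * (E1 * E2) by ring.
rewrite -[leRHS]mulrA ler_wpM2r ?(le_trans _ E12)//.
by rewrite -addrA addrCA lerDl addr_ge0.
Qed.

Lemma integral_expR_lnN_lty {R : realType} (C p d : R) : 0 < d -> 0 <= C ->
  (\int[mu]_(x in Rpos R) (C * (expR (p * `|ln x|) * expR (- (d * (x + x^-1)))))%:E < +oo)%E.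
Proof.
move=> d0 C0; have d2 : 0 < d / 2 by rewrite divr_gt0.
have [K K0 HK] := expR_ln_le p (d / 2) d2.
have mexp : measurable_fun (Rpos R) (fun x : R => expR (- (d / 2) * x)) by exact: measurable_expRM.
have mV : measurable_fun (Rpos R) (fun x : R => x^-1) := measurable_exprz_pos (-1).
apply: (@le_lt_trans _ _ (\int[mu]_(x in Rpos R) ((C * K)%:E * (expR (- (d / 2) * x))%:E))%E).
  apply: ge0_le_integral => //.
  - by move=> x _; rewrite lee_fin !mulr_ge0 ?expR_ge0.
  - apply/measurable_EFinP; apply: measurable_funM => //; apply: measurable_funM.
      apply: measurableT_comp => //; apply: measurable_funM => //.
      apply: measurableT_comp => //; apply: measurable_funTS; exact: measurable_ln.
    apply: measurableT_comp => //; apply: measurableT_comp => //.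
    by apply: measurable_funM => //; exact: measurable_funD.
  - by apply: emeasurable_funM => //; exact/measurable_EFinP.
  move=> x; rewrite in_Rpos => x0; rewrite -EFinM lee_fin -[leRHS]mulrA ler_wpM2l//.
  apply: (@le_trans _ _ (K * expR (d / 2 * (x + x^-1)) * expR (- (d * (x + x^-1))))).
    by rewrite ler_wpM2r ?expR_ge0// HK.
  rewrite -[leLHS]mulrA ler_wpM2l ?(ltW K0)// -expRD ler_expR.
  have : 0 <= d / 2 * x^-1 by rewrite mulr_ge0 ?invr_ge0 ?(ltW d2) ?(ltW x0).
  lra.
rewrite ge0_integralZl//.
- by apply: lte_mul_pinfty; rewrite ?lee_fin ?mulr_ge0 ?(ltW K0)//; exact: integral_expRN_lty.
- exact/measurable_EFinP.
- by rewrite lee_fin mulr_ge0// ltW.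
Qed.

Lemma twist_cmeasurable {R : realType} (phi : R -> R[i]) (s : R[i]) :
  cmeasurable (Rpos R) phi -> cmeasurable (Rpos R) (twist phi s).
Proof.
move=> mphi; apply: cmeasurableM => //; apply: cmeasurable_cexp => //.
apply: cmeasurableM; first exact: cmeasurable_cst.
by apply: cmeasurable_real; apply: measurable_funTS; exact: measurable_ln.
Qed.

Lemma cnorm_twist_le {R : realType} (phi : R -> R[i]) (s : R[i]) (C p q d x : R) :
  cnorm (phi x) <= C * (expR (p * `|ln x|) * expR d) -> `|complex.Re s - 1| <= q ->
  cnorm (twist phi s x) <= C * (expR ((p + q) * `|ln x|) * expR d).
Proof.
move=> h sq; rewrite /twist cnormM cnorm_cpow.
have -> : C * (expR ((p + q) * `|ln x|) * expR d) =
   C * (expR (p * `|ln x|) * expR d) * expR (q * `|ln x|).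
  by rewrite mulrDl expRD; ring.
apply: ler_pM => //; rewrite ?cnorm_ge0 ?expR_ge0// ler_expR cReD cReN.
apply: le_trans (ler_norm _) _; rewrite normrM ler_wpM2r//.
Qed.

Lemma laplace_cvg_decay {R : realType} (phi : R -> R[i]) (C p d e : R) (z : R[i]) :
  0 < e -> 0 <= C -> cmeasurable (Rpos R) phi -> - d <= complex.Re z -> 0 <= d ->
  (forall x, 0 < x -> cnorm (phi x) <=
     C * (expR (p * `|ln x|) * expR (- ((d + e) * (x + x^-1))))) ->
  laplace_cvg phi z.
Proof.
move=> e0 C0 mphi zd d0 H.
have mV : measurable_fun (Rpos R) (fun x : R => x^-1) := measurable_exprz_pos (-1).
apply: (@cintegrable_bound _ _ _
    (fun x => C * (expR (p * `|ln x|) * expR (- (e * (x + x^-1)))))) => //.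
- apply: cmeasurableM => //; apply: cmeasurable_cexp => //.
  apply: cmeasurableM; first exact: cmeasurable_cst.
  by apply: cmeasurable_real; exact: measurable_id.
- apply: measurable_funM => //; apply: measurable_funM.
    apply: measurableT_comp => //; apply: measurable_funM => //.
    apply: measurableT_comp => //; apply: measurable_funTS; exact: measurable_ln.
  apply: measurableT_comp => //; apply: measurableT_comp => //.
  by apply: measurable_funM => //; exact: measurable_funD.
- move=> x; rewrite in_Rpos => x0; rewrite cnormM cnorm_cexp cReM /= mulr0 subr0 cReN.
  apply: (@le_trans _ _ (expR (d * x) *
      (C * (expR (p * `|ln x|) * expR (- ((d + e) * (x + x^-1))))))).
    apply: ler_pM; rewrite ?expR_ge0 ?cnorm_ge0 ?H//.
    by rewrite ler_expR ler_wpM2r ?(ltW x0)// lerNl.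
  rewrite mulrCA ler_wpM2l// mulrCA ler_wpM2l ?expR_ge0// -expRD ler_expR.
  have : 0 <= d * x^-1 by rewrite mulr_ge0 ?invr_ge0 ?(ltW x0).
  lra.
- exact: integral_expR_lnN_lty.
Qed.

Lemma measurable_laplace_nng {R : realType} (w : R -> R) (c : R) :
  measurable_fun (Rpos R) w -> (forall x, 0 < x -> 0 <= w x) ->
  measurable_fun setT (fun t : R => laplace_nng w (c * (2 * t + 1))).
Proof.
move=> mw w0.
have mW : measurable_fun setT (w \_ (Rpos R)) by exact/(measurable_restrictT _ _).1.
pose f (z : R * R) := (expR (- (c * (2 * z.1 + 1)) * z.2) * (w \_ (Rpos R)) z.2)%:E.
have mf : measurable_fun setT f.
  apply/measurable_EFinP; apply: measurable_funM; first exact: measurable_gamma_integrand.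
  exact: (measurableT_comp mW measurable_snd).
have f0 z : (0 <= f z)%E.
  rewrite /f lee_fin mulr_ge0 ?expR_ge0// patchE; case: ifPn => //.
  by rewrite inE in_Rpos => /w0.
have -> : (fun t : R => laplace_nng w (c * (2 * t + 1))) = fubini_F mu f.
  apply/funext => t; rewrite /laplace_nng /fubini_F/= [LHS]integral_mkcond.
  apply: eq_integral => x _; rewrite /f/= !patchE; case: ifP => // _.
  by rewrite mulr0.
exact: measurable_fun_fubini_tonelli_F.
Qed.

Lemma laplace_nng_cauchy_schwarz {R : realType} (phi : R -> R[i]) (s : R[i]) (r r0 : R) :
  cmeasurable (Rpos R) phi -> r0 <= r ->
  (laplace_nng (fun x => cnorm (twist phi s x)) r <=
   poweR (laplace_nng (fun x => cnorm (phi x) ^+ 2)%R r) 2^-1 *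
   poweR (\int[mu]_(x in Rpos R)
     (expR ((2 * (complex.Re s - 1)) * ln x) * expR (- r0 * x))%R%:E) 2^-1)%E.
Proof.
move=> mphi rr0; set sg := complex.Re s - 1.
have mn := measurable_cnorm _ _ mphi.
have mu1 : measurable_fun (Rpos R) (fun x => cnorm (phi x) * expR (- (r / 2) * x)).
  by apply: measurable_funM => //; exact: measurable_expRM.
have mv1 : measurable_fun (Rpos R) (fun x => expR (sg * ln x) * expR (- (r / 2) * x)).
  by apply: measurable_funM; [exact: measurable_expR_ln|exact: measurable_expRM].
have mD : measurable (Rpos R) by exact: measurable_itv.
have e2 (x : R) : expR (- (r / 2) * x) * expR (- (r / 2) * x) = expR (- r * x).
  by rewrite -expRD; congr expR; field.
have e3 (x : R) : expR (sg * ln x) * expR (sg * ln x) = expR ((2 * sg) * ln x).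
  by rewrite -expRD; congr expR; ring.
have h : (laplace_nng (fun x => cnorm (twist phi s x)) r <=
   poweR (laplace_nng (fun x => cnorm (phi x) ^+ 2)%R r) 2^-1 *
   poweR (\int[mu]_(x in Rpos R)
     (expR ((2 * sg) * ln x) * expR (- r * x))%:E) 2^-1)%E.
  have -> : laplace_nng (fun x => cnorm (twist phi s x)) r =
    (\int[mu]_(x in Rpos R) ((cnorm (phi x) * expR (- (r / 2) * x)) *
      (expR (sg * ln x) * expR (- (r / 2) * x)))%:E)%E.
    apply: eq_integral => x _; congr EFin.
    rewrite /twist cnormM cnorm_cpow cReD cReN -/sg -e2 /=; ring.
  have -> : laplace_nng (fun x => cnorm (phi x) ^+ 2) r =
    (\int[mu]_(x in Rpos R) ((cnorm (phi x) * expR (- (r / 2) * x)) ^+ 2)%:E)%E.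
    by apply: eq_integral => x _; congr EFin; rewrite -e2; ring.
  have -> : (\int[mu]_(x in Rpos R) (expR ((2 * sg) * ln x) * expR (- r * x))%:E =
    \int[mu]_(x in Rpos R) ((expR (sg * ln x) * expR (- (r / 2) * x)) ^+ 2)%:E)%E.
    by apply: eq_integral => x _; congr EFin; rewrite -e2 -e3; ring.
  apply: cauchy_schwarz_integral => // x _.
  by rewrite mulr_ge0 ?cnorm_ge0 ?expR_ge0.
apply: le_trans h _; apply: lee_wpmul2l; first exact: poweR_ge0.
have I0 (q : R) : (0 <= \int[mu]_(x in Rpos R)
     (expR ((2 * sg) * ln x) * expR (- q * x))%R%:E)%E.
  by apply: integral_ge0 => x _; rewrite lee_fin mulr_ge0 ?expR_ge0.
apply: gt0_ler_poweR; [by rewrite invr_ge0|by rewrite in_itv/= I0 leey|by rewrite in_itv/= I0 leey|].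
apply: ge0_le_integral => //.
- apply/measurable_EFinP; apply: measurable_funM; [exact: measurable_expR_ln|exact: measurable_expRM].
- apply/measurable_EFinP; apply: measurable_funM; [exact: measurable_expR_ln|exact: measurable_expRM].
move=> x; rewrite in_Rpos => x0; rewrite lee_fin ler_wpM2l ?expR_ge0// ler_expR.
by rewrite ler_wpM2r ?(ltW x0)// lerN2.
Qed.

Lemma nneseries_tail_le {R : realType} (u v : nat -> \bar R) (K : \bar R) (m : nat) :
  (forall j, 0 <= u j)%E -> (forall j, 0 <= v j)%E ->
  (forall j, (j < m)%N -> u j < +oo)%E -> (0 <= K)%E -> K \is a fin_num ->
  (forall j, (m <= j)%N -> u j <= K * v j)%E ->
  (\sum_(0 <= j <oo) v j < +oo)%E -> (\sum_(0 <= j <oo) u j < +oo)%E.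
Proof.
move=> u0 v0 um K0 Kf uv fin.
rewrite (nneseries_split 0 m); last by move=> j _; exact: u0.
rewrite add0n; apply: lte_add_pinfty.
  by rewrite big_mkord; apply: lte_sum_pinfty => i _; exact: um.
apply: (@le_lt_trans _ _ (\sum_(m <= j <oo) (K * v j))%E).
  rewrite -nneseries_addn// -[leRHS]nneseries_addn; last by move=> j; rewrite mule_ge0.
  by apply: lee_nneseries => [j _ _|j _]; [exact: u0|rewrite uv// leq_addl].
case: K K0 Kf {uv} => // K K0 _; rewrite nneseriesZl//.
apply: lte_mul_pinfty => //; apply: le_lt_trans fin.
rewrite [leRHS](nneseries_split 0 m); last by move=> j _; exact: v0.
by rewrite add0n leeDr// sume_ge0.
Qed.

(* Cauchy-Schwarz against x^(2 Re s - 2) exp(- 2 pi x), which is integrable at 0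
   because Re s > 1/2, handles the terms with |n| >= 1 uniformly in n; the
   finitely many terms with - n0 <= n <= 0 are finite by the decay of phi. *)
Lemma test_fun_twist {R : realType} (k : int) (n0 : nat) (a b : int -> R[i])
    (phi : R -> R[i]) (C e : R) (s : R[i]) :
  0 < e -> 0 <= C -> piecewise_smooth phi ->
  (forall x, 0 < x -> cnorm (phi x) <=
     C * expR (- ((2 * pi * n0%:R + e) * (x + x^-1)))) ->
  (Lsq_abs k n0 a b phi < +oo)%E -> 2^-1 < complex.Re s ->
  test_fun k n0 a b (twist phi s).
Proof.
move=> e0 C0 ps dec fin s12.
have mD : measurable (Rpos R) by exact: measurable_itv.
have mphi := piecewise_smooth_cmeasurable _ ps.
have mtw := twist_cmeasurable _ s mphi.
have d0 : 0 <= 2 * pi * n0%:R :> R by rewrite !mulr_ge0 ?pi_ge0.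
have dec0 x : 0 < x -> cnorm (phi x) <=
    C * (expR (0 * `|ln x|) * expR (- ((2 * pi * n0%:R + e) * (x + x^-1)))).
  by move=> x0; rewrite mul0r expR0 mul1r dec.
have dec1 x : 0 < x -> cnorm (twist phi s x) <=
    C * (expR ((0 + `|complex.Re s - 1|) * `|ln x|) * expR (- ((2 * pi * n0%:R + e) * (x + x^-1)))).
  by move=> x0; apply: cnorm_twist_le; [exact: dec0|].
have dec2 x : 0 < x -> cnorm (twist (twist phi s) (2 - k)%:~R x) <=
    C * (expR ((0 + `|complex.Re s - 1| + `|complex.Re ((2 - k)%:~R : R[i]) - 1|) * `|ln x|) *
      expR (- ((2 * pi * n0%:R + e) * (x + x^-1)))).
  by move=> x0; apply: cnorm_twist_le; [exact: dec1|].
have lap1 (z : R[i]) : - 2 * pi * n0%:R <= complex.Re z -> laplace_cvg (twist phi s) z.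
  move=> hz; apply: (laplace_cvg_decay _ C _ (2 * pi * n0%:R) e) dec1 => //.
  by rewrite -!mulNr.
have lap2 (z : R[i]) : 0 < complex.Re z -> laplace_cvg (twist (twist phi s) (2 - k)%:~R) z.
  move=> hz; apply: (laplace_cvg_decay _ C _ (2 * pi * n0%:R) e) dec2 => //.
    exact: twist_cmeasurable.
  by apply: le_trans (ltW hz); rewrite oppr_le0.
split; [exact: piecewise_smooth_twist|exact: lap1|exact: lap2|].
pose K : \bar R := (poweR (\int[mu]_(x in Rpos R)
     (expR ((2 * (complex.Re s - 1)) * ln x) * expR (- (2 * pi) * x))%:E) 2^-1)%E.
have K0 : (0 <= K)%E by exact: poweR_ge0.
have Kf : K \is a fin_num.
  have sg1 : - 1 < 2 * (complex.Re s - 1) by lra.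
  have pi20 : 0 < 2 * pi :> R by rewrite mulr_gt0// pi_gt0.
  have := integral_powR_expRN_lty _ _ sg1 pi20.
  rewrite /K; set I := (\int[_]_(_ in _) _)%E => Ify.
  have I0 : (0 <= I)%E by apply: integral_ge0 => x _; rewrite lee_fin mulr_ge0 ?expR_ge0.
  have If : I \is a fin_num by rewrite ge0_fin_numE.
  by rewrite -(fineK If) poweR_EFin.
have nng0 (v : R -> R) r : (forall x, 0 <= v x) -> (0 <= laplace_nng v r)%E.
  by move=> v0; apply: integral_ge0 => y _; rewrite lee_fin mulr_ge0 ?expR_ge0.
have sqr0 (u : R -> R[i]) x : 0 <= cnorm (u x) ^+ 2 by exact: sqr_ge0.
move: fin; rewrite /Lsq_abs /Lmap_abs.
set Q1 := (\sum_(_ <= _ <oo) _)%E; set Q2 := (\sum_(_ <= _ <oo) _)%E => fin.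
have p0 t : Rpos R t -> 0 <= ((1 + t) ^ k)^-1.
  by rewrite in_Rpos => t0; rewrite invr_ge0 exprz_ge0// addr_ge0// ltW.
have coefE j : (- 4 * pi * (idx_neg j)%:~R : R) = 4 * pi * j.+1%:R.
  by rewrite idx_negE; ring.
have coefE' j : `|4 * pi * (idx_neg j)%:~R : R| = 4 * pi * j.+1%:R.
  by rewrite idx_negE mulrN normrN ger0_norm// !mulr_ge0 ?pi_ge0.
have coef0 j : 0 <= (4 * pi * j.+1%:R : R) ^ (1 - k).
  by rewrite exprz_ge0// !mulr_ge0 ?pi_ge0.
have Q1_ge0 : (0 <= Q1)%E.
  by apply: nneseries_ge0 => j _ _; rewrite mule_ge0 ?lee_fin ?cnorm_ge0 ?poweR_ge0.
have Q2_ge0 : (0 <= Q2)%E.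
  apply: nneseries_ge0 => j _ _; rewrite mule_ge0 ?lee_fin ?mulr_ge0 ?cnorm_ge0 ?coefE'//.
  by apply: integral_ge0 => t tD; rewrite mule_ge0 ?poweR_ge0// lee_fin p0.
have fin1 : (Q1 < +oo)%E by apply: le_lt_trans fin; rewrite leeDl.
have fin2 : (Q2 < +oo)%E by apply: le_lt_trans fin; rewrite leeDr.
apply: lte_add_pinfty.
  apply: (@nneseries_tail_le _ _ _ K n0.+1 _ _ _ K0 Kf _ fin1) => j.
  - by rewrite mule_ge0 ?lee_fin ?cnorm_ge0// nng0// => x; exact: cnorm_ge0.
  - by rewrite mule_ge0 ?lee_fin ?cnorm_ge0 ?poweR_ge0.
  - move=> jn; apply: lte_mul_pinfty; rewrite ?lee_fin ?cnorm_ge0//.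
    have /lap1/(cintegrable_cnorm _ _ mD) :
        - 2 * pi * n0%:R <= complex.Re ((2 * pi * (idx_ge n0 j)%:~R)%:C : R[i]).
      by rewrite /= !mulNr -mulrN ler_wpM2l ?mulr_ge0 ?pi_ge0// /idx_ge intrB lerDr.
    congr (_ < _)%E; apply: eq_integral => x _.
    by rewrite cnormM cnorm_cexp -rmorphN -rmorphM.
  - move=> jn; rewrite muleCA lee_wpmul2l ?lee_fin ?cnorm_ge0// muleC.
    apply: laplace_nng_cauchy_schwarz => //.
    rewrite ler_peMr ?mulr_ge0 ?pi_ge0// /idx_ge intrB.
    have : (n0.+1%:R : R) <= j%:R by rewrite ler_nat.
    by rewrite -[n0.+1%:R]natr1 -!pmulrn; lra.
apply: (@nneseries_tail_le _ _ _ K 0 _ _ _ K0 Kf _ fin2) => j //.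
- rewrite mule_ge0 ?lee_fin ?mulr_ge0 ?cnorm_ge0 ?coefE//.
  apply: integral_ge0 => t tD; rewrite mule_ge0 ?lee_fin ?p0// nng0// => x.
  exact: cnorm_ge0.
- rewrite mule_ge0 ?lee_fin ?mulr_ge0 ?cnorm_ge0 ?coefE'//.
  by apply: integral_ge0 => t tD; rewrite mule_ge0 ?poweR_ge0// lee_fin p0.
move=> _; rewrite coefE coefE' muleCA lee_wpmul2l ?lee_fin ?mulr_ge0 ?cnorm_ge0//.
have cE t : - 2 * pi * (idx_neg j)%:~R * (2 * t + 1) = 2 * pi * j.+1%:R * (2 * t + 1) :> R.
  by rewrite idx_negE; ring.
under eq_integral do rewrite cE.
under [in leRHS]eq_integral do rewrite cE.
have mp : measurable_fun (Rpos R) (fun t : R => (((1 + t) ^ k)^-1)%:E).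
  by apply/measurable_EFinP; exact: measurable_oneD_exprzV.
have mphik := twist_cmeasurable _ ((2 - k)%:~R : R[i]) mphi.
have mq : measurable_fun (Rpos R) (fun t : R =>
   (poweR (laplace_nng (fun x => cnorm (twist phi (2 - k)%:~R x) ^+ 2)%R
                  (2 * pi * j.+1%:R * (2 * t + 1))%R) 2^-1 * ((1 + t) ^ k)^-1%:E)%E).
  apply: emeasurable_funM => //; apply: measurable_funTS.
  apply: (measurableT_comp (measurable_poweR _)).
  apply: measurable_laplace_nng => //.
  by apply: measurable_funX; exact: measurable_cnorm.
rewrite -ge0_integralZl//; last first.
  by move=> t tD; rewrite mule_ge0 ?poweR_ge0// lee_fin p0.
apply: ge0_le_integral => //.
- move=> t tD; rewrite mule_ge0 ?lee_fin ?p0// nng0// => x; exact: cnorm_ge0.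
- apply: emeasurable_funM => //; apply: measurable_funTS.
  apply: measurable_laplace_nng => //; last by move=> x _; exact: cnorm_ge0.
  by apply: measurable_cnorm; exact: twist_cmeasurable.
- by apply: emeasurable_funM => //; exact: measurable_cst.
move=> t tD; rewrite muleA lee_wpmul2r ?lee_fin ?p0//.
have -> : laplace_nng (fun x => cnorm (twist (twist phi s) (2 - k)%:~R x)) =
    laplace_nng (fun x => cnorm (twist (twist phi (2 - k)%:~R) s x)).
  by congr laplace_nng; apply/funext => x; congr cnorm; rewrite /twist mulrAC.
rewrite muleC; apply: laplace_nng_cauchy_schwarz => //.
move: tD; rewrite in_Rpos => t0; rewrite -mulrA ler_peMr ?mulr_ge0 ?pi_ge0//.
have j1 : 1 <= (j.+1%:R : R) by rewrite ler1n.
by rewrite mulr_ege1//; lra.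
Qed.

(** * The functional equation *)

Lemma cintegral_comp_inv {R : realType} (c : R) (v : R -> R[i]) : 0 < c ->
  cmeasurable (Rpos R) v ->
  cintegral (Rpos R) (fun y => ((c * y ^+ 2)^-1)%:C * v (c * y)^-1) =
  cintegral (Rpos R) v.
Proof.
move=> c0 [mr mi]; rewrite /cintegral; congr (_ +i* _).
  rewrite /Rintegral -(integral_comp_inv c _ c0 mr); congr fine.
  by apply: eq_integral => y _; rewrite Re_mulC mulrC.
rewrite /Rintegral -(integral_comp_inv c _ c0 mi); congr fine.
by apply: eq_integral => y _; rewrite Im_mulC mulrC.
Qed.

Lemma cpow0 {R : realType} (x : R) : cpow x (0 : R[i]) = 1.
Proof. by rewrite /cpow mul0r cexp0. Qed.

Lemma cpow1 {R : realType} (x : R) : 0 < x -> cpow x (1 : R[i]) = x%:C.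
Proof. by move=> x0; have := @cpow_int _ x 1 x0; rewrite expr1z. Qed.

Lemma cpow_sqrt {R : realType} (x : R) (n : int) : 0 < x ->
  cpow x (n%:~R / 2) = (Num.sqrt x ^ n)%:C.
Proof.
move=> x0; have s0 : 0 < Num.sqrt x by rewrite sqrtr_gt0.
have -> : (n%:~R / 2 : R[i]) = (n%:~R / 2 : R)%:C.
  by rewrite rmorphM fmorphV rmorph_int rmorph_nat.
rewrite exprz_expR_ln// /cpow -rmorphM cexpR; congr ((expR _)%:C).
have -> : ln x = 2 * ln (Num.sqrt x).
  by rewrite -{1}[x]sqr_sqrtr ?(ltW x0)// lnXn// mulr_natl.
by field.
Qed.

Lemma mellin_lty {R : realType} (f : R[i] -> R[i]) (phi : R -> R[i])
    (Cf q C d e : R) : 0 < e -> 0 <= C -> 0 <= Cf ->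
  cmeasurable (Rpos R) (fun y => f (y *i)) -> cmeasurable (Rpos R) phi ->
  (forall y, 0 < y ->
    cnorm (f (y *i)) <= Cf * expR (q * `|ln y|) * expR (d * (y + y^-1))) ->
  (forall x, 0 < x -> cnorm (phi x) <= C * expR (- ((d + e) * (x + x^-1)))) ->
  forall p : R,
    (\int[mu]_(y in Rpos R) (cnorm (f (y *i) * phi y) * expR (p * `|ln y|))%:E < +oo)%E.
Proof.
move=> e0 C0 Cf0 mf mphi hf hphi p.
apply: le_lt_trans (integral_expR_lnN_lty (Cf * C) (q + p) e e0 (mulr_ge0 Cf0 C0)).
have mV : measurable_fun (Rpos R) (fun x : R => x^-1) := measurable_exprz_pos (-1).
have mln c : measurable_fun (Rpos R) (fun x : R => expR (c * `|ln x|)).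
  apply: measurableT_comp => //; apply: measurable_funM => //.
  by apply: measurableT_comp => //; apply: measurable_funTS; exact: measurable_ln.
have me : measurable_fun (Rpos R) (fun x : R => expR (- (e * (x + x^-1)))).
  apply: measurableT_comp => //; apply: measurableT_comp => //.
  by apply: measurable_funM => //; exact: measurable_funD.
have mle : measurable_fun (Rpos R)
    (fun x : R => expR ((q + p) * `|ln x|) * expR (- (e * (x + x^-1)))).
  exact: measurable_funM.
apply: ge0_le_integral => //.
- by move=> y _; rewrite lee_fin mulr_ge0 ?cnorm_ge0 ?expR_ge0.
- apply/measurable_EFinP; apply: measurable_funM; last exact: mln.
  by apply: measurable_cnorm; exact: cmeasurableM.
- apply/measurable_EFinP; exact: (measurable_funM (@measurable_cst _ _ _ _ _ (Cf * C)) mle).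
move=> y; rewrite in_Rpos => y0; rewrite lee_fin cnormM.
apply: (@le_trans _ _ ((Cf * expR (q * `|ln y|) * expR (d * (y + y^-1))) *
   (C * expR (- ((d + e) * (y + y^-1)))) * expR (p * `|ln y|))).
  rewrite ler_wpM2r ?expR_ge0//; apply: ler_pM; rewrite ?cnorm_ge0 ?hf ?hphi//.
have -> : expR (- (e * (y + y^-1))) =
    expR (d * (y + y^-1)) * expR (- ((d + e) * (y + y^-1))).
  by rewrite -expRD; congr expR; ring.
have -> : expR ((q + p) * `|ln y|) = expR (q * `|ln y|) * expR (p * `|ln y|).
  by rewrite mulrDl expRD.
by rewrite le_eqVlt; apply/orP; left; apply/eqP; ring.
Qed.

Theorem theorem4p6 (R : realType) (k : int) (N : nat) (hN : (0 < N)%N)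
    (psi : int -> R[i]) (hpsi : dirichlet_character N psi)
    (f : R[i] -> R[i]) (hf : harmonic_form k N psi f)
    (n0' : nat) (a b : int -> R[i]) (hab : fourier_expansion k n0' a b f)
    (n0 : nat)
    (hf0 : exp_bigO (2 * pi * n0%:R) f)
    (hg0 : exp_bigO (2 * pi * n0%:R) (slash k (W_mx R N) f))
    (phi : R -> R[i]) (hphi : piecewise_smooth phi)
    (hphi0 : exists2 x : R, 0 < x & phi x != 0)
    (hdecay : exists eps : R, [/\ 0 < eps,
        exp_littleo (2 * pi * (n0%:R + eps)) phi &
        exp_littleo (2 * pi * (n0%:R + eps)) (fun x => phi x^-1)])
    (hcvg : (Lsq_abs k n0 a b phi < +oo)%E) :
  exists Lf : R[i] -> R[i],
    [/\ forall s : R[i], 2^-1 < complex.Re s -> test_fun k n0 a b (twist phi s),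
        continues_L k n0 a b phi Lf &
        forall (n1 : nat) (c d : int -> R[i]),
          fourier_expansion k n1 c d (slash k (W_mx R N) f) ->
          exists Lg : R[i] -> R[i],
            continues_L k n0 c d (slashW (1 - k) N phi) Lg /\
            forall s : R[i],
              Lf s = cpow N%:R (- s - k%:~R / 2 + 1) * 'i%C ^ k * Lg (1 - s)].
Proof.
have [eps [eps0 lo1 lo2]] := hdecay.
have [smf _ _ _] := hf.
have mD : measurable (Rpos R) by exact: measurable_itv.
have NR : 0 < (N%:R : R) by rewrite ltr0n.
have pi0 := @pi_gt0 R.
have e0 : 0 < 2 * pi * eps by rewrite !mulr_gt0.
have cc0 : 0 < 2 * pi * (n0%:R + eps) by rewrite !mulr_gt0// ltr_wpDl.
have [C C0 hC] := exp_decay _ _ cc0 hphi lo1 lo2.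
have {}hC x : 0 < x -> cnorm (phi x) <=
    C * expR (- ((2 * pi * n0%:R + 2 * pi * eps) * (x + x^-1))).
  by move=> /hC; rewrite (mulrDr (2 * pi)).
have [Cf [q [Cf0 hCf]]] := form_growth k N n0 f hN smf hf0 hg0.
have mphi := piecewise_smooth_cmeasurable _ hphi.
have mf := imag_path_cmeasurable _ smf.
have fin := mellin_lty _ _ _ _ _ _ _ e0 (ltW C0) Cf0 mf mphi hCf hC.
have mcpow s : cmeasurable (Rpos R) (fun y => cpow y s).
  apply: cmeasurable_cexp => //; apply: cmeasurableM; first exact: cmeasurable_cst.
  by apply: cmeasurable_real; apply: measurable_funTS; exact: measurable_ln.
have mln : measurable_fun (Rpos R) (@ln R).
  by apply: measurable_funTS; exact: measurable_ln.
have mnfp p : measurable_fun (Rpos R)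
    (fun y : R => cnorm (f (y *i) * phi y) * expR (p * `|ln y|)).
  apply: measurable_funM; first by apply: measurable_cnorm; exact: cmeasurableM.
  apply: measurableT_comp => //; apply: measurable_funM => //.
  exact: measurableT_comp.
have fin' (K p : R) (F : R -> R) : 0 <= K -> measurable_fun (Rpos R) F ->
    (forall y, 0 < y -> 0 <= F y <= K * (cnorm (f (y *i) * phi y) * expR (p * `|ln y|))) ->
    (\int[mu]_(y in Rpos R) (F y)%:E < +oo)%E.
  move=> K0 mF hF; apply: (@le_lt_trans _ _ (\int[mu]_(y in Rpos R) (K%:E *
      (cnorm (f (y *i) * phi y) * expR (p * `|ln y|))%:E))%E).
    apply: ge0_le_integral => //.
    - by move=> y; rewrite in_Rpos => /hF/andP[].
    - exact/measurable_EFinP.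
    - by apply: emeasurable_funM => //; apply/measurable_EFinP; exact: mnfp.
    - by move=> y; rewrite in_Rpos => /hF/andP[_]; rewrite -EFinM lee_fin.
  rewrite ge0_integralZl//.
  - by apply: lte_mul_pinfty => //; exact: fin.
  - by apply/measurable_EFinP; exact: mnfp.
  - by move=> y _; rewrite lee_fin mulr_ge0 ?cnorm_ge0 ?expR_ge0.
pose u y := f (y *i) * phi y * cpow y (- 1).
have mu_ : cmeasurable (Rpos R) u by apply: cmeasurableM => //; exact: cmeasurableM.
pose Lf s := cintegral (Rpos R) (fun y => u y * cexp (s * (ln y)%:C)).
have LfE s : Lf s = cintegral (Rpos R) (fun y => f (y *i) * twist phi s y).
  apply: eq_cintegral => y _; rewrite /u /twist -/(cpow y s) -!mulrA.
  by rewrite -cpowD addrC.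
have iL s : cintegrable (Rpos R) (fun y => u y * cexp (s * (ln y)%:C)).
  apply: cintegrable_lty => //; first by apply: cmeasurableM => //; exact: mcpow.
  apply: (fin' 1 (1 + `|complex.Re s|)) => //.
    by apply: measurable_cnorm; apply: cmeasurableM => //; exact: mcpow.
  move=> y y0; rewrite cnorm_ge0/= mul1r /u 2!cnormM -mulrA ler_wpM2l ?cnorm_ge0//.
  rewrite -/(cpow y s) !cnorm_cpow -expRD ler_expR mulrDl mul1r.
  apply: lerD; last by apply: le_trans (ler_norm _) _; rewrite normrM.
  by rewrite /= mulN1r; apply: le_trans (ler_norm _) _; rewrite normrN.
have an0 := coef_vanish k n0' n0 a b f hab hf0.
have hab0 := fourier_expansion_shift _ _ _ _ _ _ hab an0.
exists Lf; split.
- by move=> s; exact: (test_fun_twist k n0 a b phi C (2 * pi * eps) s e0 (ltW C0) hphi hC hcvg).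
- split.
    apply: entire_mellin => // p; apply: (fin' 1 (1 + p)) => //.
      apply: measurable_funM; first exact: measurable_cnorm.
      apply: measurableT_comp => //; apply: measurable_funM => //.
      exact: measurableT_comp.
    move=> y y0; rewrite mulr_ge0 ?cnorm_ge0 ?expR_ge0//= mul1r /u cnormM -mulrA.
    rewrite ler_wpM2l ?cnorm_ge0// cnorm_cpow -expRD ler_expR mulrDl mul1r lerD2r.
    by rewrite /= mulN1r; apply: le_trans (ler_norm _) _; rewrite normrN.
  move=> s ts; rewrite LfE.
  by have [_ ->] := Lmap_eq k n0 a b f (twist phi s) hab0 ts.
move=> n1 c d hcd.
have cn0 := coef_vanish k n1 n0 c d _ hcd hg0.
have hcd0 := fourier_expansion_shift _ _ _ _ _ _ hcd cn0.
(* Lg is written with the exponent of (N y)^-1 so that entire_mellin applies. *)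
pose kap : R[i] := cpow N%:R (k%:~R / 2) * 'i%C ^ (- k).
pose u2 y := kap * (f (y *i) * phi y).
pose l2 y : R := - ln y - ln N%:R.
pose Lg s := cintegral (Rpos R) (fun y => u2 y * cexp (s * (l2 y)%:C)).
have LgE s : Lg s = cpow N%:R (k%:~R / 2 - s) * 'i%C ^ (- k) * Lf (1 - s).
  rewrite /Lf -cintegralZl//; apply: eq_cintegral => y _.
  rewrite /u2 /kap /u -/(cpow y (1 - s)) /l2 !cpowD.
  have -> : cexp (s * (- ln y - ln N%:R)%:C) = cpow y (- s) * cpow N%:R (- s).
    by rewrite /cpow -cexpD; congr cexp; rewrite rmorphB rmorphN; ring.
  have yy : cpow y (- 1) * cpow y (1 : R[i]) = 1 by rewrite -cpowD addNr cpow0.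
  move: yy; set c1 := cpow y (- 1); set c2 := cpow y 1 => yy.
  rewrite -[LHS]mulr1 -[X in _ * X = _]yy; ring.
exists Lg; split; last first.
  move=> s; rewrite LgE.
  have -> : 1 - (1 - s) = s by ring.
  have ii : ('i%C : R[i]) ^ k * 'i%C ^ (- k) = 1.
    rewrite -expfzDr ?subrr ?expr0z// -cnorm_eq0 /cnorm /= expr0n /= add0r expr1n sqrtr1.
    exact: oner_neq0.
  have NN : cpow N%:R (- s - k%:~R / 2 + 1) * cpow N%:R (k%:~R / 2 - (1 - s)) = 1 :> R[i].
    by rewrite -cpowD -[RHS](cpow0 N%:R); congr cpow; ring.
  transitivity ((cpow N%:R (- s - k%:~R / 2 + 1) * cpow N%:R (k%:~R / 2 - (1 - s))) *
     ('i%C ^ k * 'i%C ^ (- k)) * Lf s); first by rewrite NN ii !mul1r.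
  by ring.
have mfp : cmeasurable (Rpos R) (fun y => f (y *i) * phi y) by exact: cmeasurableM.
have mu2 : cmeasurable (Rpos R) u2 by apply: cmeasurableM => //; exact: cmeasurable_cst.
have ml2 : measurable_fun (Rpos R) l2.
  by apply: measurable_funB => //; exact: measurableT_comp.
split.
  apply: entire_mellin => // p.
  apply: (fin' (cnorm kap * expR (`|p| * `|ln N%:R|)) `|p|).
  - by rewrite mulr_ge0 ?cnorm_ge0 ?expR_ge0.
  - apply: measurable_funM; first exact: measurable_cnorm.
    apply: measurableT_comp => //; apply: measurable_funM => //.
    exact: measurableT_comp.
  move=> y y0; rewrite mulr_ge0 ?cnorm_ge0 ?expR_ge0//= /u2 cnormM.
  have -> : cnorm kap * expR (`|p| * `|ln N%:R|) *
    (cnorm (f (y *i) * phi y) * expR (`|p| * `|ln y|)) =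
    cnorm kap * cnorm (f (y *i) * phi y) * (expR (`|p| * `|ln y|) * expR (`|p| * `|ln N%:R|)) by ring.
  rewrite ler_wpM2l ?mulr_ge0 ?cnorm_ge0// -expRD ler_expR -mulrDr.
  apply: le_trans (ler_norm _) _; rewrite normrM normr_id ler_wpM2l// /l2.
  by apply: le_trans (ler_normD _ _) _; rewrite !normrN.
move=> s ts; have [ig ->] := Lmap_eq k n0 c d _ _ hcd0 ts.
rewrite -(cintegral_comp_inv N%:R _ NR (cintegrable_cmeasurable _ _ ig)).
apply: eq_cintegral => y; rewrite inE in_Rpos => y0.
have Ny0 : 0 < N%:R * y by rewrite mulr_gt0.
rewrite slash_W_imag ?invr_gt0// /twist /slashW.
have E1 : (N%:R * (N%:R * y)^-1)^-1 = y by rewrite invfM invrK mulrA mulVf ?mul1r// gt_eqF.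
have E2 : N%:R * (N%:R * y)^-1 = y^-1 by rewrite invfM mulrA mulfV ?mul1r// gt_eqF.
rewrite E1 E2.
pose sN := Num.sqrt (N%:R : R).
have sN0 : 0 < sN by rewrite sqrtr_gt0.
have ss : sN * sN = N%:R by rewrite -expr2 sqr_sqrtr ?ltW.
have E3 : ((sN * (N%:R * y)^-1)%:C * 'i%C) ^ (- k) = ((sN ^ k) * (y ^ k))%:C * 'i%C ^ (- k) :> R[i].
  have e : (sN * (N%:R * y)^-1) ^ (- k) = sN ^ k * y ^ k.
    have -> : sN * (N%:R * y)^-1 = (sN * y)^-1.
      by rewrite -ss; field; rewrite !gt_eqF.
    by rewrite exprz_inv opprK expfzMl.
  by rewrite expfzMl -fmorphXz e.
have E4 : cpow (N%:R * y)^-1 (s - 1) =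
    (N%:R * y)%:C * (cpow N%:R (- s) * cpow y (- s)) :> R[i].
  rewrite cpowV// opprB cpowM// !cpowD !cpow1// rmorphM; ring.
have E5 : (y^-1) ^ (- (1 - k)) = y * (y ^ k)^-1.
  by rewrite exprz_inv opprK expfzDr ?gt_eqF// expr1z -invr_expz.
rewrite -/sN E3 E4 E5 /u2 /kap cpow_sqrt// -/sN.
have -> : cexp (s * (l2 y)%:C) = cpow N%:R (- s) * cpow y (- s).
  by rewrite /cpow -cexpD; congr cexp; rewrite /l2 rmorphB rmorphN; ring.
have E6 : (N%:R * y ^+ 2)^-1 * (sN ^ k * y ^ k) * (y * (y ^ k)^-1) * (N%:R * y) = sN ^ k.
  by field; rewrite !gt_eqF// exprz_gt0.
rewrite -[in LHS]E6 !rmorphM; ring.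
Qed.
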